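(* Let $n\ge1$, $\mathfrak g=\mathfrak{osp}(2n-1|2n)$ with $f=\sum_{i=1}^{2n-1}F_{i+1,i}$ and $E_{ij}=\frac12(-1)^{p(i)}F_{ij}$ as in the context. Let $\mathcal A$ be the $(4n-1)\times(4n-1)$ matrix with $\mathcal A_{ij}=\delta_{ij}D+\bar E_{ji}$ for $i\le j$ and $\mathcal A_{ij}=-f_{ij}$ for $i>j$, where $f=\sum f_{ij}e_{ij}$ is the matrix of $f$ in $\mathfrak{gl}(2n-1|2n)$. Write $\operatorname{rdet}(\mathcal A)=\sum_{t=0}^{4n-1}w_{4n-1-t}D^t$. Then $w_1,\dots,w_{4n-1}\in\mathcal W(\bar{\mathfrak g},f)$, and $\{w_t:1\le t\le4n-1,\ t\equiv0\text{ or }3\pmod4\}$ freely generates $\mathcal W(\bar{\mathfrak g},f)$ as a differential algebra.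
   Context: $\mathfrak{gl}(2n-1|2n)$: index set $I=\{1,\dots,4n-1\}$, $p(i)=1$ for $i$ odd, $p(i)=0$ for $i$ even; matrix units $e_{ij}$ of parity $p(i)+p(j)$, $[e_{ij},e_{kl}]=\delta_{jk}e_{il}-(-1)^{(p(i)+p(j))(p(k)+p(l))}\delta_{il}e_{kj}$, $\operatorname{str}(\sum a_{ij}e_{ij})=\sum(-1)^{p(i)}a_{ii}$. Put $i'=4n-i$, $\delta_k=1$ if $k\in\{2n+1,2n+3,\dots,4n-1\}$, else $0$. $\theta(e_{ij})=(-1)^{p(i)p(j)+p(j)+1+\delta_i+\delta_j}e_{j'i'}$, $F_{ij}=e_{ij}+\theta(e_{ij})$, $\mathfrak g=\operatorname{span}\{F_{ij}\}\cong\mathfrak{osp}(2n-1|2n)$ with form $(X|Y)=\operatorname{str}(XY)$ and grading $F_{ij}\in\mathfrak g_{(j-i)/2}$; $\mathfrak n=\mathfrak g_{>0}$, $\mathfrak p=\mathfrak g_{\le0}$. For $\mathfrak a$ with even supersymmetric invariant form, $\bar{\mathfrak a}$ is a parity-reversed copy ($p(\bar a)=p(a)+1$); $\mathcal V(\bar{\mathfrak a})=S(\mathbb C[D]\otimes\bar{\mathfrak a})$ is the free supercommutative algebra on $D^m\bar a$ with odd derivation $D$ and SUSY PVA bracket $\{\bar a{}_\chi\bar b\}=(-1)^{p(a)(p(b)+1)}\overline{[a,b]}+\chi(a|b)$ extended by sesquilinearity $\{Dx{}_\chi y\}=-\chi\{x{}_\chi y\}$, $\{x{}_\chi Dy\}=(-1)^{p(x)+1}(D+\chi)\{x{}_\chi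 y\}$ and Leibniz $\{x{}_\chi yz\}=(-1)^{(p(x)+1)p(y)}y\{x{}_\chi z\}+\{x{}_\chi y\}z$; $\chi$ odd, supercommuting with $\mathcal V$, $D\chi+\chi D=-2\chi^2$; $x^{(m)}=D^mx$. $\mathcal V(\bar{\mathfrak p})=S(\mathbb C[D]\otimes\bar{\mathfrak p})$; $\mathfrak J$ = differential ideal of $\mathcal V(\bar{\mathfrak g})$ generated by $\bar n-(f|n)$, $n\in\mathfrak n$; $\mathcal W(\bar{\mathfrak g},f)=\{w\in\mathcal V(\bar{\mathfrak p}):\{\bar n{}_\chi w\}\in\mathbb C[\chi]\otimes\mathfrak J\ \forall n\in\mathfrak n\}$. ''Freely generates'' means $\mathcal W=\mathbb C[w_t^{(m)}]$ with free supercommutative generators. In $\mathcal V[D]$, $D\,a=D(a)+(-1)^{p(a)}aD$, coefficients on the left. $\operatorname{rdet}(A)=\sum_{\sigma\in S_N}\operatorname{sgn}(\sigma)A_{1\sigma(1)}\cdots A_{N\sigma(N)}$. *)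

(* Defs.v *)
From mathcomp Require Import all_boot all_algebra.
From mathcomp Require Import fingroup perm.
From mathcomp Require Import Rstruct complex.
Set Implicit Arguments. Unset Strict Implicit. Unset Printing Implicit Defensive.
Import GRing.Theory.
Local Open Scope ring_scope.

(* Free supercommutative algebra over K on generators X (parity par),       *)
(* presented by lists of terms (coefficient, word).  Two presentations are  *)
(* equal (feq) iff they have the same coefficient on every monomial, where  *)
(* a word is brought to a canonical order (ltX, a strict total order) with  *)
(* the Koszul sign, and words with a repeated odd letter vanish.            *)
Section FreeSuper.
Variables (K : fieldType) (X : eqType) (par : X -> bool) (ltX : rel X).

Definition fpoly := seq (K * seq X).

Fixpoint winv (w : seq X) : nat :=
  match w with
  | [::] => 0
  | x :: w' => ((if par x then count (fun y => par y && ltX y x) w' else 0) + winv w')%N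
  end.

Definition oddfree (w : seq X) : bool := uniq (filter par w).

Definition coef (P : fpoly) (mu : seq X) : K :=
  \sum_(t <- P | perm_eq t.2 mu && oddfree t.2) t.1 * (-1) ^+ winv t.2.

Definition feq (P Q : fpoly) : Prop := forall mu, coef P mu = coef Q mu.

Definition fconst (c : K) : fpoly := [:: (c, [::])].
Definition fgen (x : X) : fpoly := [:: (1, [:: x])].
Definition fscale (c : K) (P : fpoly) : fpoly := [seq (c * t.1, t.2) | t <- P].
Definition fadd (P Q : fpoly) : fpoly := P ++ Q.
Definition fmul (P Q : fpoly) : fpoly :=
  [seq (t.1 * s.1, t.2 ++ s.2) | t <- P, s <- Q].
Definition fprod (s : seq fpoly) : fpoly := foldr fmul (fconst 1) s.
Definition wpar (w : seq X) : bool := foldr (fun x b => par x (+) b) false w.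
Definition fsignpar (P : fpoly) : fpoly :=
  [seq ((-1) ^+ wpar t.2 * t.1, t.2) | t <- P].

Variable dX : X -> X.
Fixpoint Dword (w : seq X) : fpoly :=
  match w with
  | [::] => [::]
  | x :: w' => (1, dX x :: w') ::
               [seq ((-1) ^+ par x * t.1, x :: t.2) | t <- Dword w']
  end.
Definition Dpoly (P : fpoly) : fpoly := flatten [seq fscale t.1 (Dword t.2) | t <- P].

End FreeSuper.

(* Indices are natural numbers 1..N, N = 4n-1; matrices are functions.      *)
Section Osp.
Variable K : fieldType.

Definition Nd (n : nat) : nat := (4 * n - 1)%N.
Definition rng (n : nat) : seq nat := iota 1 (Nd n).

Definition mat := nat -> nat -> K.

Definition pI (i : nat) : bool := odd i.
Definition primeI (n i : nat) : nat := (4 * n - i)%N.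
Definition deltaI (n k : nat) : bool := odd k && (2 * n + 1 <= k)%N.

Definition eij (i j : nat) : mat := fun k l => ((k == i) && (l == j))%:R.

Definition theta_e (n i j : nat) : mat := fun k l =>
  (-1) ^+ ((pI i && pI j) (+) pI j (+) true (+) deltaI n i (+) deltaI n j)
    * eij (primeI n j) (primeI n i) k l.

Definition Fm (n i j : nat) : mat := fun k l => eij i j k l + theta_e n i j k l.

Definition in_span (n : nat) (S : nat -> nat -> bool) (a : mat) : Prop :=
  exists c : nat -> nat -> K, forall k l,
    a k l = \sum_(i <- rng n) \sum_(j <- rng n | S i j) c i j * Fm n i j k l.

Definition in_g (n : nat) := in_span n (fun _ _ => true).
(* n = g_{>0} : F_ij in g_{(j-i)/2} *)
Definition in_n (n : nat) := in_span n (fun i j => (i < j)%N).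
(* p = g_{<=0} *)
Definition in_p (n : nat) := in_span n (fun i j => (j <= i)%N).

Definition matmul (n : nat) (a b : mat) : mat :=
  fun i j => \sum_(k <- rng n) a i k * b k j.
Definition str (n : nat) (a : mat) : K := \sum_(i <- rng n) (-1) ^+ pI i * a i i.
Definition form (n : nat) (a b : mat) : K := str n (matmul n a b).

Definition fmat (n : nat) : mat :=
  fun k l => \sum_(i <- iota 1 (2 * n - 1)) Fm n i.+1 i k l.
Definition Emat (n i j : nat) : mat :=
  fun k l => 2^-1 * (-1) ^+ pI i * Fm n i j k l.

(* V = V(bar gl): generators (m,i,j) = D^m bar e_ij, parity p(i)+p(j)+1+m.  *)
Definition X3 := (nat * nat * nat)%type.
Definition par3 (x : X3) : bool := pI x.1.2 (+) pI x.2 (+) true (+) odd x.1.1.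
Definition lt3 (x y : X3) : bool :=
  (x.1.1 < y.1.1)%N || ((x.1.1 == y.1.1) &&
    ((x.1.2 < y.1.2)%N || ((x.1.2 == y.1.2) && (x.2 < y.2)%N))).
Definition d3 (x : X3) : X3 := (x.1.1.+1, x.1.2, x.2).

Definition V := fpoly K X3.
Definition Veq (P Q : V) : Prop := feq par3 lt3 P Q.
Definition DV (P : V) : V := Dpoly par3 d3 P.
Definition gen3 (x : X3) : V := fgen K x.
Definition cst (c : K) : V := @fconst K X3 c.

Definition barD (n m : nat) (a : mat) : V :=
  [seq (a k l, [:: (m, k, l)]) | k <- rng n, l <- rng n].

Definition inVsub (n : nat) (S : mat -> Prop) (v : V) : Prop :=
  exists Q : seq (K * seq (nat * mat)),
    (forall t x, List.In t Q -> List.In x t.2 -> S x.2) /\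
    Veq v (flatten [seq fscale t.1 (fprod [seq barD n x.1 x.2 | x <- t.2]) | t <- Q]).

(* ---- chi-brackets.  Elements of C[chi] (x) V : lists (k, v) = chi^k v. ---- *)
Definition CV := seq (nat * V).
Definition chicoef (P : CV) (k : nat) : V := flatten [seq t.2 | t <- P & t.1 == k].

(* (-1)^{sa} (D + chi), using D chi^k v = (-1)^k chi^k Dv - 2[k odd] chi^{k+1} v *)
Definition Sop (sa : bool) (P : CV) : CV :=
  flatten [seq [:: (t.1, fscale ((-1) ^+ (sa (+) odd t.1)) (DV t.2));
                  (t.1.+1, fscale ((-1) ^+ sa * (1 - (odd t.1)%:R *+ 2)) t.2)]
          | t <- P].

Definition brgen (i j : nat) (x : X3) : CV :=
  let: (m, k, l) := x in
  let pa := pI i (+) pI j in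
  let pb := pI k (+) pI l in
  iter m (Sop pa)
    [:: (0%N, fscale ((-1) ^+ (pa && ~~ pb))
                (fadd (fscale (j == k)%:R (gen3 (0%N, i, l)))
                      (fscale (- (-1) ^+ (pa && pb) * (i == l)%:R) (gen3 (0%N, k, j)))));
        (1%N, cst ((j == k)%:R * (i == l)%:R * (-1) ^+ pI i))].

(* Leibniz rule: {x_chi y z} = (-1)^{(p(x)+1)p(y)} y {x_chi z} + {x_chi y} z *)
Fixpoint brword (i j : nat) (w : seq X3) : CV :=
  match w with
  | [::] => [::]
  | y :: w' =>
      [seq (t.1, fscale ((-1) ^+ (((pI i (+) pI j) && par3 y) (+) (odd t.1 && par3 y)))
                        (fmul (gen3 y) t.2)) | t <- brword i j w']
      ++ [seq (t.1, fmul t.2 [:: (1, w')]) | t <- brgen i j y]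
  end.

Definition brpoly (i j : nat) (P : V) : CV :=
  flatten [seq [seq (s.1, fscale t.1 s.2) | s <- brword i j t.2] | t <- P].

Definition bracket (n : nat) (a : mat) (P : V) : CV :=
  flatten [seq [seq (s.1, fscale (a ij.1 ij.2) s.2) | s <- brpoly ij.1 ij.2 P]
          | ij <- [seq (i, j) | i <- rng n, j <- rng n]].

(* the differential ideal J of V(bar g) generated by bar m - (f|m), m in n *)
Definition inJ (n : nat) (v : V) : Prop :=
  exists L : seq (V * nat * mat),
    (forall t, List.In t L -> inVsub n (in_g n) t.1.1 /\ in_n n t.2) /\
    Veq v (flatten [seq fmul t.1.1
                       (fadd (barD n t.1.2 t.2)
                             (cst (if t.1.2 == 0%N then - form n (fmat n) t.2 else 0)))
                   | t <- L]).

Definition inW (n : nat) (v : V) : Prop :=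
  inVsub n (in_p n) v /\
  forall a, in_n n a -> forall k, inJ n (chicoef (bracket n a v) k).

(* ---- V[D] : lists (k, v) = v D^k, coefficients on the left. ---- *)
Definition VD := seq (nat * V).
(* D o (v D^j) = D(v) D^j + (-1)^{p(v)} v D^{j+1} *)
Definition Dop (P : VD) : VD :=
  flatten [seq [:: (t.1, DV t.2); (t.1.+1, fsignpar par3 t.2)] | t <- P].
Definition opmul (A B : VD) : VD :=
  flatten [seq flatten [seq [seq (s.1 + b.1, fmul a.2 s.2)%N
                            | s <- iter a.1 Dop [:: (0%N, b.2)]]
                       | b <- B]
          | a <- A].
Definition opone : VD := [:: (0%N, cst 1)].
Definition dcoef (P : VD) (k : nat) : V := flatten [seq t.2 | t <- P & t.1 == k].

Definition Aent (n i j : nat) : VD :=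
  if i == j then [:: (1%N, cst 1); (0%N, barD n 0 (Emat n j i))]
  else if (i < j)%N then [:: (0%N, barD n 0 (Emat n j i))]
  else [:: (0%N, cst (- fmat n i j))].

Definition rdet (n : nat) : VD :=
  flatten [seq [seq (t.1, fscale ((-1) ^+ odd_perm s) t.2)
               | t <- foldr opmul opone
                        [seq Aent n (nat_of_ord i).+1 (nat_of_ord (s i)).+1
                        | i <- enum 'I_(Nd n)]]
          | s <- enum [set: {perm 'I_(Nd n)}]].

Definition wt (n s : nat) : V := dcoef (rdet n) (Nd n - s).

(* ---- free supercommutative algebra on symbols (t,m) = D^m w_t ---- *)
Definition X2 := (nat * nat)%type.
Definition par2 (x : X2) : bool := odd (x.1 + x.2).   (* p(w_t) = t mod 2 *)
Definition lt2 (x y : X2) : bool :=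
  (x.1 < y.1)%N || ((x.1 == y.1) && (x.2 < y.2)%N).
Definition evalW (n : nat) (Q : fpoly K X2) : V :=
  flatten [seq fscale q.1 (fprod [seq iter x.2 DV (wt n x.1) | x <- q.2]) | q <- Q].
Definition Tset (n t : nat) : bool :=
  (1 <= t <= Nd n)%N && ((t %% 4 == 0)%N || (t %% 4 == 3)%N).

End Osp.

Definition Cc : fieldType := Rdefinitions.R[i].

(* Main.v *)
Require Import Defs.
From HB Require Import structures.
From mathcomp Require Import all_boot all_algebra.
From mathcomp Require Import fingroup perm generic_quotient.
From mathcomp Require Import Rstruct complex.
From mathcomp Require Import boolp ring zify.
Set Implicit Arguments. Unset Strict Implicit. Unset Printing Implicit Defensive.
Import GRing.Theory Num.Theory.
Local Open Scope ring_scope.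

(** Let A be the Lax matrix. It is a Hessenberg matrix with nonzero constants below
    the diagonal, so its suitably normalised trailing minors form a vector v with
    A v = v_0 e_1, where v_0 is the row determinant up to sign. Bracketing this system
    with bar a, a in n, and reducing modulo J changes A by a gauge transformation; a
    descending induction on the rows then shows that the bracket of v_0 vanishes
    modulo J, i.e. that every w_t lies in W.

    For t = 0, 3 mod 4 the linear part of w_t in the root vectors of level t - 1 has a
    nonzero coefficient on exactly one element of a chosen basis of p outside the
    "plain" ones, while all other terms have lower level. Hence these w_t and the plain
    root vectors are free differential generators of V(bar p), which already gives the
    independence of the w_t. If w lies in W, consider the plain generators F_{l+s,l}
    in decreasing order of (s, l): the chi^m-coefficient of the bracket with
    F_{l,l+s+1}, modulo J, is a nonzero multiple of the partial derivative with respect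
    to the m-th derivative of that generator, because it kills every w_t and every
    other generator not yet eliminated. In characteristic 0 the generator therefore does not
    occur in w, and only the w_t remain. *)

(** * Words and Koszul signs *)

(** The lists of the definitions become a ring [SV] on all matrix units of gl and their derivatives.
    V(bar g) and V(bar p) stay subalgebras of it, and J is detected by a morphism [rho]. Every map
    is prescribed on words and descends once it respects adjacent Koszul swaps. The mirror i' = 4n -
    i explains the residues of t. At level s = t - 1 every root vector F_kl of p is plain up to
    mirror, except near k + l = 4n. For t = 3 mod 4 a self-mirror F_{l'l} with l odd is left over;
    for t = 1 mod 4 that l is even and F_{l'l} = 0. For t = 0 mod 4 a pair with k + l = 4n - 1 and l
    even is left over; for t = 2 mod 4 that l is odd and the pair is plain. Plainness is fitted to
    the elimination. F_{l+s,l} is paired with F_{l,l+s+1} because their bracket lies one step above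
    degree 0, where pairing with f turns it into a constant. For k + l = 4n - 1 the vector
    F_{l,l+s+1} is self-mirror, and it is nonzero only for l odd. *)

Section SwapCompatible.
Variables (K : fieldType) (X : eqType) (par : X -> bool) (ltX : rel X).
Hypothesis ltasym : forall x y, x != y -> ltX x y = ~~ ltX y x.

Definition cw (w mu : seq X) : K :=
  if perm_eq w mu && oddfree par w then (-1) ^+ winv par ltX w else 0.

Lemma coef_cwE (P : fpoly K X) mu :
  coef par ltX P mu = \sum_(t <- P) t.1 * cw t.2 mu.
Proof.
rewrite /coef big_mkcond /=; apply: eq_bigr => t _; rewrite /cw.
by case: ifP => //; rewrite mulr0.
Qed.

Lemma coef_cat (P Q : fpoly K X) mu :
  coef par ltX (P ++ Q) mu = coef par ltX P mu + coef par ltX Q mu.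
Proof. by rewrite !coef_cwE big_cat. Qed.

Lemma coef_fscale c (P : fpoly K X) mu :
  coef par ltX (fscale c P) mu = c * coef par ltX P mu.
Proof.
rewrite !coef_cwE big_map mulr_sumr; apply: eq_bigr => t _ /=.
by rewrite mulrA.
Qed.

Lemma coef_nil mu : coef par ltX ([::] : fpoly K X) mu = 0.
Proof. by rewrite coef_cwE big_nil. Qed.

Lemma oddfree_perm w w' : perm_eq w w' -> oddfree par w = oddfree par w'.
Proof. by move=> h; rewrite /oddfree; apply/perm_uniq/perm_filter. Qed.

Lemma perm_swap (u v : seq X) x y :
  perm_eq (u ++ x :: y :: v) (u ++ y :: x :: v).
Proof.
by rewrite perm_cat2l -[x :: y :: v]/([:: x; y] ++ v) -[y :: x :: v]/([:: y; x] ++ v)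
  perm_cat2r -[[:: x; y]]/([:: x] ++ [:: y]) -[[:: y; x]]/([:: y] ++ [:: x]) perm_catC.
Qed.

Lemma winv_swap u x y v : x != y -> par x && par y ->
  (-1) ^+ winv par ltX (u ++ x :: y :: v) = - (-1) ^+ winv par ltX (u ++ y :: x :: v) :> K.
Proof.
move=> nxy /andP[px py]; elim: u => [|z u IH] /=.
  rewrite px py /= (ltasym nxy) !exprD; case: (ltX y x) => /=; ring.
rewrite !exprD IH mulrN; congr (- (_ * _)); congr (_ ^+ _).
by rewrite (seq.permP (perm_swap u v x y)).
Qed.

Lemma winv_swap_even u x y v : x != y -> ~~ (par x && par y) ->
  winv par ltX (u ++ x :: y :: v) = winv par ltX (u ++ y :: x :: v).
Proof.
move=> nxy; rewrite negb_and => h; elim: u => [|z u IH] /=; last first.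
  by rewrite IH (seq.permP (perm_swap u v x y)).
case: (boolP (par x)) h => px /=; case: (boolP (par y)) => py //= _;
 by rewrite ?add0n ?andbF ?addn0 ?add0n // addnA.
Qed.

Lemma cw_swap u x y v mu :
  cw (u ++ x :: y :: v) mu = (-1) ^+ (par x && par y) * cw (u ++ y :: x :: v) mu.
Proof.
rewrite /cw; have hp := perm_swap u v x y.
rewrite (oddfree_perm hp) (permPl hp); case: ifP => [/andP[_ ho]|_]; last by rewrite mulr0.
case: (eqVneq x y) => [exy|nxy].
  subst y; case px: (par x); rewrite /= ?mul1r //.
  by move: ho; rewrite /oddfree filter_cat /= px cat_uniq /= inE eqxx /= !andbF.
case h: (par x && par y); first by rewrite winv_swap // mulN1r.
by rewrite mul1r winv_swap_even // h.
Qed.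

Lemma cw_sq u x v mu : par x -> cw (u ++ x :: x :: v) mu = 0.
Proof.
move=> px; rewrite /cw /oddfree filter_cat /= px cat_uniq /= inE eqxx /=.
by rewrite !andbF.
Qed.

(** The functions on words that descend to the free supercommutative algebra. The second clause is
    separate because it follows from the first only when 2 is invertible. *)
Definition swapc (M : lmodType K) (phi : seq X -> M) :=
  (forall u x y v, phi (u ++ x :: y :: v) = (-1) ^+ (par x && par y) *: phi (u ++ y :: x :: v))
  /\ (forall u x v, par x -> phi (u ++ x :: x :: v) = 0).

Lemma perm_of_swap (T : Type) (psi : seq X -> T) :
  (forall u x y v, psi (u ++ x :: y :: v) = psi (u ++ y :: x :: v)) ->
  forall w w', perm_eq w w' -> psi w = psi w'.
Proof.
move=> hs w w' hp.
(* The prefix is generalised so that the common head letter can be absorbed into it. *)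
suff H : forall u, psi (u ++ w) = psi (u ++ w') by exact: (H [::]).
elim: w w' hp => [|x w IH] w' hp u.
  by move: hp; rewrite perm_sym => /perm_nilP ->.
have : x \in w' by rewrite -(perm_mem hp) inE eqxx.
move=> xw; case: (path.splitPr xw) hp => w1 w2 hp.
have -> : psi (u ++ w1 ++ x :: w2) = psi (u ++ x :: w1 ++ w2).
  elim/last_ind: w1 w2 {hp} => [|w1 y IHw] w2 //.
  by rewrite -cats1 -!catA /= catA hs -catA (IHw (y :: w2)).
rewrite -cat_rcons (IH (w1 ++ w2)) ?cat_rcons //.
by rewrite -(perm_cons x) (permPl hp) perm_catC /= perm_cons perm_catC.
Qed.

Section LemmaU.
Variables (M : lmodType K) (phi : seq X -> M).
Hypothesis hphi : swapc phi.

Lemma swap_perm_sign w w' : perm_eq w w' -> exists b : bool, phi w = (-1) ^+ b *: phi w'.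
Proof.
have [hs _] := hphi.
pose psi w := [exists b : bool, `[< phi w = (-1) ^+ b *: phi w' >]].
move=> hp; have : psi w.
  rewrite (perm_of_swap (psi := psi) _ hp).
    by apply/existsP; exists false; apply/asboolP; rewrite scale1r.
  have H u x y v : psi (u ++ x :: y :: v) -> psi (u ++ y :: x :: v).
    case/existsP=> b /asboolP e; apply/existsP; exists ((par x && par y) (+) b).
    apply/asboolP; rewrite signr_addb -scalerA -e (hs u x y) scalerA -signr_addb.
    by rewrite addbb scale1r.
  by move=> u x y v; apply/idP/idP; apply: H.
by case/existsP=> b /asboolP; exists b.
Qed.

(** A repeated odd letter can be permuted to the first two places, where the second clause of
    [swapc] applies. *)
Lemma swap_oddfree w : ~~ oddfree par w -> phi w = 0.
Proof.
move=> h; have [hs hq] := hphi.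
have [x px hx] : exists2 x, par x & (1 < count_mem x w)%N.
  have [z _] : exists z : X, True by case: (w) h => // z; exists z.
  case/(uniqPn z): h => i [j [ij jw e]].
  set x := nth z (filter par w) j in e.
  have xf : x \in filter par w by apply: mem_nth.
  have px : par x by move: xf; rewrite mem_filter => /andP[].
  exists x => //.
  suff: (1 < count_mem x (filter par w))%N.
    move=> /leq_trans; apply; rewrite count_filter; apply: sub_count => y /=.
    by case/andP.
  rewrite -(cat_take_drop j (filter par w)) count_cat.
  have h1 : (0 < count_mem x (take j (filter par w)))%N.
    rewrite -has_count has_pred1; apply/(nthP z); exists i.
      by rewrite size_take jw.
    by rewrite nth_take.
  have h2 : (0 < count_mem x (drop j (filter par w)))%N.
    rewrite -has_count has_pred1; apply/(nthP z); exists 0%N.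
      by rewrite size_drop subn_gt0.
    by rewrite nth_drop addn0.
  by rewrite -(addn1 1) leq_add.
have xw : x \in w by rewrite -has_pred1 has_count (leq_trans _ hx).
have p1 := perm_to_rem xw.
have xw2 : x \in rem x w.
  move: hx; rewrite (seq.permP p1) /= eqxx add1n ltnS => hx.
  by rewrite -has_pred1 has_count.
have p2 := perm_to_rem xw2.
have p : perm_eq w (x :: x :: rem x (rem x w)).
  by rewrite (permPl p1) perm_cons.
case: (swap_perm_sign p) => b ->.
by rewrite (hq [::]) // scaler0.
Qed.

Definition phin w := if oddfree par w then (-1) ^+ winv par ltX w *: phi w else 0.

Lemma phin_perm w w' : perm_eq w w' -> phin w = phin w'.
Proof.
apply: perm_of_swap => u x y v; have [hs hq] := hphi; rewrite /phin.
have hp := perm_swap u v x y; rewrite (oddfree_perm hp).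
case: ifP => // ho; case: (eqVneq x y) => [-> //|nxy].
rewrite hs scalerA; congr (_ *: _).
case h: (par x && par y); first by rewrite winv_swap // mulrN1 opprK.
by rewrite mulr1 winv_swap_even // h.
Qed.

(** Universal property. All terms whose word rearranges the first one contribute a coefficient of P
    times the sign-normalised value [phin], hence 0. The shorter list that remains still has zero
    coefficients, so induction on the number of terms applies. *)
Lemma lin_coef0 (P : fpoly K X) :
  (forall mu, coef par ltX P mu = 0) -> \sum_(t <- P) t.1 *: phi t.2 = 0.
Proof.
have [k] := ubnP (size P); elim: k P => // k IH [|t0 P] /=; first by rewrite big_nil.
rewrite ltnS => hk h; set P' := t0 :: P in h *.
pose mu := t0.2.
rewrite (bigID (fun t : K * seq X => perm_eq t.2 mu)) /=.
rewrite -[X in _ + X]big_filter IH ?addr0.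
- have -> : \sum_(t <- P' | perm_eq t.2 mu) t.1 *: phi t.2 = coef par ltX P' mu *: phin mu.
    rewrite coef_cwE scaler_suml big_mkcond /=; apply: eq_bigr => t _.
    rewrite /cw; case: ifP => hp; last by rewrite mulr0 scale0r.
    case: ifP => /= ho; last by rewrite mulr0 scale0r swap_oddfree ?scaler0 ?ho.
    by rewrite -(phin_perm hp) /phin ho scalerA -mulrA -signr_odd -signr_addb addbb mulr1.
  by rewrite h scale0r.
- apply: leq_trans hk; rewrite /P' /= perm_refl /= ltnS size_filter; exact: count_size.
- move=> nu; rewrite coef_cwE big_filter.
  case e: (perm_eq nu mu).
    apply: big1 => t ht; rewrite /cw.
    by rewrite (permPr e) (negbTE ht) mulr0.
  have := h nu; rewrite coef_cwE (bigID (fun t : K * seq X => perm_eq t.2 mu)) /=.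
  rewrite big1 ?add0r // => t ht.
  by rewrite /cw (permPl ht) perm_sym e mulr0.
Qed.

Lemma lin_feq (P Q : fpoly K X) : feq par ltX P Q ->
  \sum_(t <- P) t.1 *: phi t.2 = \sum_(t <- Q) t.1 *: phi t.2.
Proof.
move=> h; apply/eqP; rewrite -subr_eq0 -scaleN1r scaler_sumr.
apply/eqP; rewrite -[RHS](@lin_coef0 (P ++ fscale (-1) Q)); last first.
  by move=> mu; rewrite coef_cat coef_fscale h mulN1r subrr.
rewrite big_cat big_map /=; congr (_ + _).
by apply: eq_bigr => t _; rewrite scalerA.
Qed.

End LemmaU.

Lemma swapc_cw mu : swapc (fun w => cw w mu : K^o).
Proof. split; [exact: (fun u x y v => cw_swap u x y v mu) | exact: (fun u x v => @cw_sq u x v mu)]. Qed.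

End SwapCompatible.

Local Open Scope quotient_scope.

Lemma lt3_asym x y : x != y -> lt3 x y = ~~ lt3 y x.
Proof.
by case: x y => [[a b] c] [[a' b'] c']; rewrite /lt3 !xpair_eqE /=; lia.
Qed.

(** * The free supercommutative algebra as a ring *)

Section Quotient.
Variable K : numFieldType.
Implicit Types P Q : V K.

Lemma feq_equiv_axiom : equiv_class_of (fun P Q : V K => `[< Veq P Q >]).
Proof.
split=> [P|P Q|Q P S].
- by apply/asboolP.
- by apply/asboolP/asboolP => h mu.
- by move=> /asboolP h1 /asboolP h2; apply/asboolP => mu; rewrite h1 h2.
Qed.

Canonical feq_equiv := EquivRelPack feq_equiv_axiom.

Definition SV := {eq_quot feq_equiv}.
HB.instance Definition _ := Choice.on SV.

Definition cl : V K -> SV := \pi_SV.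

Lemma clP P Q : cl P = cl Q <-> Veq P Q.
Proof. by split=> [/eqmodP /asboolP|/asboolP h]; [|apply/eqmodP]. Qed.

Lemma cl_repr u : cl (repr u) = u.
Proof. exact: reprK. Qed.

Lemma Veq_repr P : Veq (repr (cl P)) P.
Proof. by apply/clP; rewrite cl_repr. Qed.

Definition sv_zero : SV := cl [::].
Definition sv_one : SV := cl (cst 1).
Definition sv_add (u v : SV) : SV := cl (fadd (repr u) (repr v)).
Definition sv_scale (c : K) (u : SV) : SV := cl (fscale c (repr u)).
Definition sv_opp (u : SV) : SV := sv_scale (-1) u.
Definition sv_mul (u v : SV) : SV := cl (fmul (repr u) (repr v)).

Lemma sv_addE P Q : sv_add (cl P) (cl Q) = cl (P ++ Q).
Proof. by apply/clP => mu; rewrite !coef_cat !Veq_repr. Qed.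

Lemma sv_scaleE c P : sv_scale c (cl P) = cl (fscale c P).
Proof. by apply/clP => mu; rewrite !coef_fscale !Veq_repr. Qed.

Lemma big_fmul (M : lmodType K) P Q (F : seq X3 -> M) :
  \sum_(t <- fmul P Q) t.1 *: F t.2 =
  \sum_(p <- P) p.1 *: \sum_(q <- Q) q.1 *: F (p.2 ++ q.2).
Proof.
rewrite big_allpairs_dep; apply: eq_bigr => p _.
by rewrite scaler_sumr; apply: eq_bigr => q _ /=; rewrite scalerA.
Qed.

Definition cwo (mu w : seq X3) : K^o := cw K par3 lt3 w mu.

Lemma coefZE P mu : coef par3 lt3 P mu = \sum_(t <- P) t.1 *: cwo mu t.2.
Proof. exact: coef_cwE. Qed.

(** Well-definedness is checked one factor at a time: with the other factor fixed, the coefficient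
    functional still respects the Koszul relations, so [lin_feq] may exchange representatives. *)
Lemma sv_mulE P Q : sv_mul (cl P) (cl Q) = cl (fmul P Q).
Proof.
apply/clP => mu; rewrite !coefZE !(big_fmul _ _ (cwo mu)).
have [hs hq] : swapc par3 (cwo mu) := swapc_cw K par3 lt3_asym mu.
have hb w : \sum_(q <- repr (cl Q)) q.1 *: cwo mu (w ++ q.2) = \sum_(q <- Q) q.1 *: cwo mu (w ++ q.2).
  apply: (lin_feq lt3_asym (phi := fun w' => cwo mu (w ++ w'))); last exact: Veq_repr.
  split=> [u x y v|u x v px]; rewrite !catA; first exact: hs.
  exact: hq.
under eq_bigr => p _ do rewrite hb.
apply: (lin_feq lt3_asym (phi := fun w => \sum_(q <- Q) q.1 *: cwo mu (w ++ q.2))).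
  split=> [u x y v|u x v px].
    rewrite scaler_sumr; apply: eq_bigr => q _; rewrite -!catA /= hs.
    by rewrite !scalerA mulrC.
  by apply: big1 => q _; rewrite -!catA /= hq // scaler0.
exact: Veq_repr.
Qed.

(** Suited to identities that already hold in the free associative algebra, such as the ring axioms:
    no compatibility of F is asked. *)
Lemma Veq_lin P Q : (forall F : seq X3 -> K^o,
   \sum_(t <- P) t.1 *: F t.2 = \sum_(t <- Q) t.1 *: F t.2) -> cl P = cl Q.
Proof. by move=> h; apply/clP => mu; rewrite !coefZE h. Qed.

Lemma big_fscale (M : lmodType K) c P (F : seq X3 -> M) :
  \sum_(t <- fscale c P) t.1 *: F t.2 = c *: \sum_(t <- P) t.1 *: F t.2.
Proof. by rewrite big_map scaler_sumr; apply: eq_bigr => t _; rewrite scalerA. Qed.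

Lemma big_fconst (M : lmodType K) c (F : seq X3 -> M) :
  \sum_(t <- cst c) t.1 *: F t.2 = c *: F [::].
Proof. by rewrite big_seq1. Qed.

Lemma big_fadd (M : lmodType K) P Q (F : seq X3 -> M) :
  \sum_(t <- P ++ Q) t.1 *: F t.2 = \sum_(t <- P) t.1 *: F t.2 + \sum_(t <- Q) t.1 *: F t.2.
Proof. exact: big_cat. Qed.

Ltac sv_rep := repeat intro; repeat (match goal with u : SV |- _ => rewrite -(cl_repr u); move: (repr u) => {u} ? end);
  rewrite ?(sv_addE, sv_scaleE, sv_mulE); apply: Veq_lin => F.
Ltac sv_lin := sv_rep; rewrite ?(big_fadd, big_fmul, big_fscale, big_fconst, big_nil).

Fact sv_addA : associative sv_add.
Proof. by sv_lin; rewrite addrA. Qed.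
Fact sv_addC : commutative sv_add.
Proof. by sv_lin; rewrite addrC. Qed.
Fact sv_add0 : left_id sv_zero sv_add.
Proof. by rewrite /sv_zero; sv_lin. Qed.
Fact sv_addN : left_inverse sv_zero sv_opp sv_add.
Proof. by rewrite /sv_zero /sv_opp; sv_lin; rewrite scaleN1r addNr. Qed.

HB.instance Definition _ := GRing.isZmodule.Build SV sv_addA sv_addC sv_add0 sv_addN.

Fact sv_mulA : associative sv_mul.
Proof.
move=> x y z; rewrite -[x]cl_repr -[y]cl_repr -[z]cl_repr.
move: (repr x) (repr y) (repr z) => P Q S; rewrite !sv_mulE; apply: Veq_lin => F.
rewrite (big_fmul _ (fmul Q S)) (big_fmul _ S).
rewrite (big_fmul P Q (fun w => \sum_(s <- S) s.1 *: F (w ++ s.2))).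
apply: eq_bigr => p _; rewrite (big_fmul Q S (fun w => F (p.2 ++ w))).
congr (_ *: _); apply: eq_bigr => q _; congr (_ *: _).
by apply: eq_bigr => r _; rewrite catA.
Qed.
Fact sv_mul1r : left_id sv_one sv_mul.
Proof.
move=> x; rewrite -[x]cl_repr sv_mulE; apply: Veq_lin => F.
by rewrite (big_fmul _ _ F) big_seq1 scale1r.
Qed.
Fact sv_mulr1 : right_id sv_one sv_mul.
Proof.
move=> x; rewrite -[x]cl_repr sv_mulE; apply: Veq_lin => F.
rewrite (big_fmul _ _ F); apply: eq_bigr => p _.
by rewrite big_seq1 scale1r cats0.
Qed.
Fact sv_mulDl : left_distributive sv_mul sv_add.
Proof.
move=> x y z; rewrite -[x]cl_repr -[y]cl_repr -[z]cl_repr.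
move: (repr x) (repr y) (repr z) => P Q S; rewrite ?(sv_mulE, sv_addE).
apply: Veq_lin => F; rewrite [RHS](big_fadd _ _ F) !(big_fmul _ _ F).
by rewrite (big_fadd _ _ (fun w => \sum_(s <- S) s.1 *: F (w ++ s.2))).
Qed.
Fact sv_mulDr : right_distributive sv_mul sv_add.
Proof.
move=> x y z; rewrite -[x]cl_repr -[y]cl_repr -[z]cl_repr.
move: (repr x) (repr y) (repr z) => P Q S; rewrite ?(sv_mulE, sv_addE).
apply: Veq_lin => F; rewrite [RHS](big_fadd _ _ F) !(big_fmul _ _ F) -big_split.
apply: eq_bigr => p _ /=.
by rewrite (big_fadd _ _ (fun w => F (p.2 ++ w))) scalerDr.
Qed.
Fact sv_1neq0 : sv_one != 0.
Proof.
apply/eqP => /clP /(_ [::]); rewrite coef_cwE big_seq1 coef_cwE big_nil /= /cw /=.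
by rewrite mulr1; apply/eqP/oner_neq0.
Qed.

HB.instance Definition _ := GRing.Zmodule_isNzRing.Build SV
  sv_mulA sv_mul1r sv_mulr1 sv_mulDl sv_mulDr sv_1neq0.

Fact sv_scaleA a b v : sv_scale a (sv_scale b v) = sv_scale (a * b) v.
Proof. by sv_lin; rewrite scalerA. Qed.
Fact sv_scale1 : left_id 1 sv_scale.
Proof. by sv_lin; rewrite scale1r. Qed.
Fact sv_scaleDr : right_distributive sv_scale +%R.
Proof. by move=> a u v; rewrite /GRing.add /=; sv_lin; rewrite scalerDr. Qed.
Fact sv_scaleDl v : {morph sv_scale^~ v : a b / a + b >-> a + b}.
Proof. by move=> a b; rewrite [RHS]/GRing.add /=; sv_lin; rewrite scalerDl. Qed.

HB.instance Definition _ := GRing.Zmodule_isLmodule.Build K SV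
  sv_scaleA sv_scale1 sv_scaleDr sv_scaleDl.

Fact sv_scaleAl (a : K) (u v : SV) : a *: (u * v) = (a *: u) * v.
Proof.
rewrite /GRing.scale /GRing.mul /= -[u]cl_repr -[v]cl_repr.
move: (repr u) (repr v) => P Q; rewrite ?(sv_mulE, sv_scaleE).
apply: Veq_lin => F; rewrite (big_fscale _ _ F) !(big_fmul _ _ F).
by rewrite (big_fscale _ _ (fun w => \sum_(s <- Q) s.1 *: F (w ++ s.2))).
Qed.
HB.instance Definition _ := GRing.Lmodule_isLalgebra.Build K SV sv_scaleAl.
Fact sv_scaleAr (a : K) (u v : SV) : a *: (u * v) = u * (a *: v).
Proof.
rewrite /GRing.scale /GRing.mul /= -[u]cl_repr -[v]cl_repr.
move: (repr u) (repr v) => P Q; rewrite ?(sv_mulE, sv_scaleE).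
apply: Veq_lin => F; rewrite (big_fscale _ _ F) !(big_fmul _ _ F) scaler_sumr.
apply: eq_bigr => p _; rewrite (big_fscale _ _ (fun w => F (p.2 ++ w))).
by rewrite !scalerA mulrC.
Qed.
HB.instance Definition _ := GRing.Lalgebra_isAlgebra.Build K SV sv_scaleAr.

Lemma clD P Q : cl (P ++ Q) = cl P + cl Q.
Proof. by rewrite -sv_addE. Qed.
Lemma clZ c P : cl (fscale c P) = c *: cl P.
Proof. by rewrite -sv_scaleE. Qed.
Lemma clM P Q : cl (fmul P Q) = cl P * cl Q.
Proof. by rewrite -sv_mulE. Qed.
Lemma clC c : cl (cst c) = c%:A.
Proof.
have -> : cst c = fscale c (cst 1) by rewrite /fscale /= mulr1.
by rewrite clZ.
Qed.
Lemma cl_flatten (I : Type) (s : seq I) (F : I -> V K) :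
  cl (flatten [seq F i | i <- s]) = \sum_(i <- s) cl (F i).
Proof. by elim: s => [|i s IH]; rewrite ?big_nil ?big_cons //= clD IH. Qed.
Lemma cl_fprod (s : seq (V K)) : cl (Defs.fprod s) = \prod_(P <- s) cl P.
Proof. by elim: s => [|P s IH]; rewrite ?big_nil ?big_cons //= clM IH. Qed.

End Quotient.

(** * Parity, algebra morphisms and derivations prescribed on generators *)

Section SuperCalculus.
Variable K : numFieldType.
Local Notation SV := (SV K).
Implicit Types (u v : SV) (w : seq X3) (b : bool).

Lemma two_neq0 : 2%:R != 0 :> K.
Proof. by rewrite pnatr_eq0. Qed.

Definition gen (x : X3) : SV := cl (gen3 K x).
Definition word w : SV := cl ([:: (1, w)] : V K).

Lemma word_nil : word [::] = 1. Proof. by []. Qed.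

Lemma word_cons x w : word (x :: w) = gen x * word w.
Proof. by rewrite -clM /fmul /= mulr1. Qed.

Lemma word_cat w1 w2 : word (w1 ++ w2) = word w1 * word w2.
Proof. by rewrite -clM /fmul /= mulr1. Qed.

Lemma wordE w : word w = \prod_(x <- w) gen x.
Proof. by elim: w => [|x w IH]; rewrite ?big_nil // word_cons IH big_cons. Qed.

Lemma cl_words (P : V K) : cl P = \sum_(t <- P) t.1 *: word t.2.
Proof.
elim: P => [|t P IH]; first by rewrite big_nil.
rewrite big_cons -IH -clZ -clD; congr cl; case: t => c w.
by rewrite /fscale /= mulr1.
Qed.

Lemma sv_ind (P : SV -> Prop) : P 0 -> (forall c w u, P u -> P (c *: word w + u)) ->
  forall u, P u.
Proof.
move=> h0 hs u; rewrite -(cl_repr u) cl_words.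
elim: (repr u) => [|t Q IH]; first by rewrite big_nil.
by rewrite big_cons; apply: hs.
Qed.

(** Swapping two equal odd letters gives the opposite value, and 2 is invertible. *)
Lemma swapc_of_swap (M : lmodType K) (phi : seq X3 -> M) :
  (forall w1 x y w2, phi (w1 ++ x :: y :: w2) = (-1) ^+ (par3 x && par3 y) *: phi (w1 ++ y :: x :: w2))
  -> swapc par3 phi.
Proof.
move=> h; split=> // w1 x w2 px; have := h w1 x x w2; rewrite px /= expr1 scaleN1r => e.
have : (2%:R : K) *: phi (w1 ++ x :: x :: w2) = 0.
  by rewrite scaler_nat mulr2n {1}e addNr.
by move/eqP; rewrite scaler_eq0 (negbTE two_neq0) => /eqP.
Qed.

(* The linear map prescribed on words by [phi]; junk value 0 when [phi] does not
   respect the supercommutation relations, so that [lin phi] is always linear. *)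
Definition lin (M : lmodType K) (phi : seq X3 -> M) (u : SV) : M :=
  if pselect (swapc par3 phi) then \sum_(t <- repr u) t.1 *: phi t.2 else 0.

Lemma lin_cl (M : lmodType K) (phi : seq X3 -> M) P : swapc par3 phi ->
  lin phi (cl P) = \sum_(t <- P) t.1 *: phi t.2.
Proof.
move=> h; rewrite /lin; case: pselect => //= _.
by apply: (lin_feq lt3_asym h); apply: Veq_repr.
Qed.

Lemma lin_word (M : lmodType K) (phi : seq X3 -> M) w : swapc par3 phi ->
  lin phi (word w) = phi w.
Proof. by move=> h; rewrite lin_cl // big_seq1 scale1r. Qed.

Fact lin_is_linear (M : lmodType K) (phi : seq X3 -> M) : linear (lin phi).
Proof.
move=> a u v; case: (pselect (swapc par3 phi)) => h; last first.
  by rewrite /lin; case: pselect => //= _; rewrite scaler0 addr0.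
rewrite -[u]cl_repr -[v]cl_repr -clZ -clD !lin_cl //.
by rewrite big_fadd big_fscale.
Qed.
HB.instance Definition _ (M : lmodType K) (phi : seq X3 -> M) :=
  GRing.isLinear.Build K SV M _ (lin phi) (lin_is_linear phi).

Lemma word_swap (w1 w2 : seq X3) x y :
  word (w1 ++ x :: y :: w2) = (-1) ^+ (par3 x && par3 y) *: word (w1 ++ y :: x :: w2).
Proof.
rewrite -clZ; apply/clP => mu; rewrite coef_fscale !coef_cwE !big_seq1 /= !mul1r.
exact: (cw_swap _ _ lt3_asym).
Qed.

Lemma gen_swap x y : gen x * gen y = (-1) ^+ (par3 x && par3 y) *: (gen y * gen x).
Proof. by have := word_swap [::] [::] x y; rewrite !word_cons word_nil !mulr1. Qed.

Lemma wpar_cat w1 w2 : wpar par3 (w1 ++ w2) = wpar par3 w1 (+) wpar par3 w2.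
Proof. by elim: w1 => //= x w1 ->; rewrite addbA. Qed.

Lemma swapc_word_sign (s : bool -> K) :
  swapc par3 (fun w => s (wpar par3 w) *: word w).
Proof.
apply: swapc_of_swap => w1 x y w2; rewrite word_swap !wpar_cat /=.
by rewrite (addbCA (par3 x)) !scalerA mulrC.
Qed.

(** The parity automorphism. Koszul signs are carried by applying it rather than by naming a parity,
    so that product rules hold for inhomogeneous arguments too. *)
Definition sg : SV -> SV := lin (fun w => (-1) ^+ wpar par3 w *: word w).
HB.instance Definition _ := GRing.Linear.copy sg sg.
Definition sgb b u := if b then sg u else u.

Lemma sg_word w : sg (word w) = (-1) ^+ wpar par3 w *: word w.
Proof. exact: lin_word (swapc_word_sign (fun b => (-1) ^+ b)). Qed.

Lemma sgM u v : sg (u * v) = sg u * sg v.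
Proof.
elim/sv_ind: u => [|c w u IH]; first by rewrite !(mul0r, linear0).
rewrite mulrDl !linearD /= mulrDl IH -scalerAl !linearZ /= -scalerAl.
congr (_ *: _ + _); elim/sv_ind: v {u IH} => [|c' w' v IH]; first by rewrite !(mulr0, linear0).
rewrite mulrDr !linearD /= mulrDr IH -scalerAr !linearZ /= -scalerAr.
congr (_ *: _ + _); rewrite -word_cat !sg_word wpar_cat word_cat signr_addb.
by rewrite -scalerAl -scalerAr scalerA.
Qed.

Lemma sg1 : sg 1 = 1. Proof. by rewrite -word_nil sg_word scale1r. Qed.

Lemma sgK : involutive sg.
Proof.
elim/sv_ind => [|c w u IH]; first by rewrite !linear0.
rewrite linearD linearZ linearD linearZ /= IH; congr (_ *: _ + _).
by rewrite sg_word linearZ /= sg_word scalerA -signr_addb addbb scale1r.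
Qed.

Fact sgb_linear b : linear (sgb b).
Proof. by move=> a u v; case: b; rewrite /sgb ?linearP. Qed.
HB.instance Definition _ b := GRing.isLinear.Build K SV SV _ (sgb b) (sgb_linear b).

Lemma sgbM b u v : sgb b (u * v) = sgb b u * sgb b v.
Proof. by case: b; rewrite //= sgM. Qed.
Lemma sgb1 b : sgb b 1 = 1. Proof. by case: b; rewrite //= sg1. Qed.
Lemma sgb_word b w : sgb b (word w) = (-1) ^+ (b && wpar par3 w) *: word w.
Proof. by case: b; rewrite /= ?scale1r // sg_word. Qed.
Lemma sgb_sgb b b' u : sgb b (sgb b' u) = sgb (b (+) b') u.
Proof. by case: b; case: b'; rewrite /= ?sgK. Qed.

Definition homo b u := sg u = (-1) ^+ b *: u.

Lemma homo_sgb b b' u : homo b u -> sgb b' u = (-1) ^+ (b' && b) *: u.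
Proof. by case: b' => //= _; rewrite scale1r. Qed.

Lemma homo0 b : homo b 0. Proof. by rewrite /homo linear0 scaler0. Qed.
Lemma homo1 : homo false 1. Proof. by rewrite /homo sg1 scale1r. Qed.
Lemma homoD b u v : homo b u -> homo b v -> homo b (u + v).
Proof. by rewrite /homo linearD /= => -> ->; rewrite scalerDr. Qed.
Lemma homoZ b c u : homo b u -> homo b (c *: u).
Proof. by rewrite /homo linearZ /= => ->; rewrite !scalerA mulrC. Qed.
Lemma homoN b u : homo b u -> homo b (- u).
Proof. by rewrite -scaleN1r; apply: homoZ. Qed.
Lemma homoB b u v : homo b u -> homo b v -> homo b (u - v).
Proof. by move=> hu hv; apply: homoD => //; apply: homoN. Qed.
Lemma homoM b b' u v : homo b u -> homo b' v -> homo (b (+) b') (u * v).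
Proof.
rewrite /homo sgM => -> ->; rewrite signr_addb.
by rewrite -scalerAl -scalerAr scalerA.
Qed.
Lemma homo_const c : homo false c%:A. Proof. exact/homoZ/homo1. Qed.
Lemma homo_sum (I : Type) (s : seq I) (P : pred I) b (F : I -> SV) :
  (forall i, P i -> homo b (F i)) -> homo b (\sum_(i <- s | P i) F i).
Proof.
move=> h; elim/big_rec: _ => [|i u Pi hu]; first exact: homo0.
by apply: homoD => //; apply: h.
Qed.
Lemma homo_sg b b' u : homo b u -> homo b (sgb b' u).
Proof. by move=> h; rewrite (homo_sgb _ h); apply: homoZ. Qed.
Lemma homo_word w : homo (wpar par3 w) (word w). Proof. exact: sg_word. Qed.
Lemma homo_gen x : homo (par3 x) (gen x).
Proof. by have := homo_word [:: x]; rewrite word_cons mulr1 /= addbF. Qed.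

Lemma gen_comm x u : gen x * u = sgb (par3 x) u * gen x.
Proof.
elim/sv_ind: u => [|c w u IH]; first by rewrite linear0 mulr0 mul0r.
rewrite linearP /= mulrDr mulrDl IH -scalerAr -scalerAl; congr (_ *: _ + _) => {u IH c}.
elim: w => [|y w IH]; first by rewrite word_nil sgb1 mulr1 mul1r.
rewrite word_cons mulrA gen_swap -scalerAl -mulrA IH sgbM !mulrA.
by rewrite (homo_sgb _ (homo_gen y)) -!scalerAl.
Qed.

Lemma word_comm w u : word w * u = sgb (wpar par3 w) u * word w.
Proof.
elim: w u => [|x w IH] u; first by rewrite mulr1 mul1r.
by rewrite word_cons -mulrA IH mulrA gen_comm -mulrA sgb_sgb.
Qed.

Lemma homo_comm b z u : homo b z -> z * u = sgb b u * z.
Proof.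
(* A presentation of z may contain words of the wrong parity. Replacing z by its projection to
   parity b removes them, and the claim reduces to single words. *)
move=> hz; have -> : z = 2%:R^-1 *: (z + (-1) ^+ b *: sg z).
  rewrite hz scalerA -signr_addb addbb scale1r -[X in X + _]scale1r -[X in _ + X]scale1r.
  by rewrite -scalerDl scalerA mulVf ?two_neq0 ?scale1r.
rewrite -scalerAl -scalerAr; congr (_ *: _).
elim/sv_ind: z {hz} => [|c w z IH]; first by rewrite linear0 scaler0 addr0 mul0r mulr0.
rewrite linearP /= scalerDr addrACA mulrDl IH [RHS]mulrDr; congr (_ + _).
have -> : c *: word w + (-1) ^+ b *: (c *: sg (word w)) =
          (c * (1 + (-1) ^+ (b (+) wpar par3 w))) *: word w.
  by rewrite sg_word !scalerA -scalerDl signr_addb; congr (_ *: _); ring.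
rewrite -scalerAl -scalerAr.
case e: (b (+) wpar par3 w); first by rewrite /= expr1 subrr mulr0 !scale0r.
have -> : b = wpar par3 w by case: (b) (wpar par3 w) e => [] [].
by rewrite word_comm.
Qed.

Lemma homo_swap b b' u v : homo b u -> homo b' v -> u * v = (-1) ^+ (b && b') *: (v * u).
Proof. by move=> hu hv; rewrite (homo_comm _ hu) (homo_sgb _ hv) -scalerAl. Qed.

Definition compat (g : X3 -> SV) := forall x, homo (par3 x) (g x).
Definition hprod (g : X3 -> SV) w : SV := \prod_(x <- w) g x.
Definition sHom (g : X3 -> SV) : SV -> SV := lin (hprod g).
HB.instance Definition _ g := GRing.Linear.copy (sHom g) (sHom g).

Lemma hprod_cat g w1 w2 : hprod g (w1 ++ w2) = hprod g w1 * hprod g w2.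
Proof. exact: big_cat. Qed.
Lemma hprod_cons g x w : hprod g (x :: w) = g x * hprod g w.
Proof. exact: big_cons. Qed.

Lemma homo_hprod g w : compat g -> homo (wpar par3 w) (hprod g w).
Proof.
move=> hg; elim: w => [|x w IH]; first by rewrite /hprod big_nil; apply: homo1.
by rewrite hprod_cons; apply: homoM.
Qed.

Lemma swapc_hprod g : compat g -> swapc par3 (hprod g).
Proof.
move=> hg; apply: swapc_of_swap => w1 x y w2; rewrite !hprod_cat !hprod_cons.
rewrite !(mulrA (g _)) (homo_swap (hg x) (hg y)) -!scalerAl -scalerAr.
by [].
Qed.

Section HomTheory.
Variable g : X3 -> SV.
Hypothesis hg : compat g.

Lemma Hom_word w : sHom g (word w) = hprod g w.
Proof. exact/lin_word/swapc_hprod. Qed.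
Lemma Hom_gen x : sHom g (gen x) = g x.
Proof. by rewrite -[gen x]mulr1 -word_nil -word_cons Hom_word hprod_cons /hprod big_nil mulr1. Qed.
Lemma Hom1 : sHom g 1 = 1. Proof. by rewrite -word_nil Hom_word /hprod big_nil. Qed.
Lemma HomM u v : sHom g (u * v) = sHom g u * sHom g v.
Proof.
elim/sv_ind: u => [|c w u IH]; first by rewrite !(mul0r, linear0).
rewrite mulrDl !linearD /= mulrDl IH -scalerAl !linearZ /= -scalerAl.
congr (_ *: _ + _); elim/sv_ind: v {u IH} => [|c' w' v IH]; first by rewrite !(mulr0, linear0).
rewrite mulrDr !linearD /= mulrDr IH -scalerAr !linearZ /= -scalerAr.
by congr (_ *: _ + _); rewrite -word_cat !Hom_word hprod_cat.
Qed.
Lemma HomC c : sHom g c%:A = c%:A. Proof. by rewrite linearZ /= Hom1. Qed.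
Lemma Hom_sgb b u : sHom g (sgb b u) = sgb b (sHom g u).
Proof.
elim/sv_ind: u => [|c w u IH]; first by rewrite !linear0.
rewrite !linearP /= IH ?linearP /=; congr (_ *: _ + _).
rewrite sgb_word linearZ /= Hom_word (homo_sgb _ (homo_hprod w hg)).
by [].
Qed.
Lemma homo_Hom b u : homo b u -> homo b (sHom g u).
Proof. by rewrite /homo => h; have := Hom_sgb true u; rewrite /= h linearZ /= => <-. Qed.
End HomTheory.

Lemma Hom_id u : sHom gen u = u.
Proof.
elim/sv_ind: u => [|c w u IH]; first by rewrite linear0.
by rewrite linearP /= IH Hom_word ?wordE //; apply: homo_gen.
Qed.

Section Derivation.
Variables (g d : X3 -> SV) (b : bool).
Fixpoint dword w : SV :=
  if w is x :: w' then d x * hprod g w' + (-1) ^+ (b && par3 x) *: (g x * dword w') else 0.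
(* The derivation of parity [b] along the algebra morphism [sHom g] that sends x to [d x]. *)
Definition Der : SV -> SV := lin dword.
HB.instance Definition _ := GRing.Linear.copy Der Der.

Hypotheses (hg : compat g) (hd : forall x, homo (par3 x (+) b) (d x)).

Lemma swapc_dword : swapc par3 dword.
Proof.
apply: swapc_of_swap => w1 x y w2; elim: w1 => [|z w1 IH] /=; last first.
  rewrite IH -!scalerAr scalerA mulrC -scalerA [RHS]scalerDr; congr (_ + _).
  have [hs _] := swapc_hprod hg.
  by rewrite hs -scalerAr.
rewrite !hprod_cons.
have e1 : d x * (g y * hprod g w2) = (-1) ^+ ((par3 x (+) b) && par3 y) *: (g y * (d x * hprod g w2)).
  by rewrite mulrA (homo_swap (hd x) (hg y)) -scalerAl mulrA.
have e2 : g x * (d y * hprod g w2) = (-1) ^+ (par3 x && (par3 y (+) b)) *: (d y * (g x * hprod g w2)).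
  by rewrite mulrA (homo_swap (hg x) (hd y)) -scalerAl mulrA.
have e3 : g x * (g y * dword w2) = (-1) ^+ (par3 x && par3 y) *: (g y * (g x * dword w2)).
  by rewrite mulrA (homo_swap (hg x) (hg y)) -scalerAl mulrA.
rewrite !mulrDr -!scalerAr e1 e2 e3 !scalerDr !scalerA addrCA.
by congr (_ *: _ + (_ *: _ + _ *: _)); case: b (par3 x) (par3 y) => [] [] [] /=; ring.
Qed.

Lemma Der_word w : Der (word w) = dword w.
Proof. exact/lin_word/swapc_dword. Qed.
Lemma Der_gen x : Der (gen x) = d x.
Proof.
rewrite -[gen x]mulr1 -word_nil -word_cons Der_word /= mulr0 scaler0 addr0.
by rewrite /hprod big_nil mulr1.
Qed.
Lemma Der1 : Der 1 = 0. Proof. by rewrite -word_nil Der_word. Qed.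
Lemma DerC c : Der c%:A = 0. Proof. by rewrite linearZ /= Der1 scaler0. Qed.

Lemma dword_cat w1 w2 :
  dword (w1 ++ w2) = dword w1 * hprod g w2 + (-1) ^+ (b && wpar par3 w1) *: (hprod g w1 * dword w2).
Proof.
elim: w1 => [|x w1 IH] /=.
  by rewrite /hprod big_nil mul1r mul0r add0r andbF scale1r.
rewrite IH hprod_cat hprod_cons mulrDr -scalerAr scalerDr scalerA mulrDl -scalerAl !mulrA addrA.
by congr (_ + _ *: _); case: (b) => //=; rewrite ?mulr1 // signr_addb.
Qed.

Lemma DerM u v : Der (u * v) = Der u * sHom g v + sHom g (sgb b u) * Der v.
Proof.
elim/sv_ind: u => [|c w u IH]; first by rewrite !(mul0r, linear0) addr0.
rewrite mulrDl linearD /= IH !linearP /= !mulrDl addrACA; congr (_ + _).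
rewrite -scalerAl linearZ /= -!scalerAl -scalerDr; congr (_ *: _) => {u IH c}.
elim/sv_ind: v => [|c w' v IH]; first by rewrite !(mulr0, linear0) addr0.
rewrite mulrDr linearD /= IH !linearP /= !mulrDr addrACA; congr (_ + _).
rewrite -scalerAr linearZ /=.
rewrite -!scalerAr -scalerDr; congr (_ *: _).
rewrite -word_cat !Der_word dword_cat !Hom_word //; congr (_ + _).
by rewrite sgb_word linearZ /= Hom_word // -scalerAl.
Qed.

Lemma homo_dword w : homo (wpar par3 w (+) b) (dword w).
Proof.
elim: w => [|x w IH] /=; first exact: homo0.
apply: homoD; first by rewrite addbAC; apply: homoM => //; apply: homo_hprod.
by apply: homoZ; rewrite -addbA; apply: homoM.
Qed.

Lemma Der_sgb b' u : Der (sgb b' u) = (-1) ^+ (b && b') *: sgb b' (Der u).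
Proof.
elim/sv_ind: u => [|c w u IH]; first by rewrite !linear0 ?scaler0.
rewrite (linearP (sgb b') c (word w) u) (linearP Der c (sgb b' (word w)) (sgb b' u)) /=.
rewrite (linearP Der c (word w) u) (linearP (sgb b') c (Der (word w)) (Der u)) /= IH scalerDr.
congr (_ + _).
rewrite !scalerA mulrC -scalerA; congr (_ *: _).
rewrite sgb_word linearZ /= Der_word (homo_sgb _ (homo_dword w)) scalerA -signr_addb.
by congr (_ *: _); case: (b) (b') (wpar _ _) => [] [] []; rewrite /= ?expr0 ?expr1 ?mulr1 ?mul1r ?mulrNN ?mulr1.
Qed.

Lemma homo_Der b' u : homo b' u -> homo (b' (+) b) (Der u).
Proof.
rewrite /homo => h; have := Der_sgb true u; rewrite /= h linearZ /= andbT => e.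
rewrite addbC signr_addb -scalerA e scalerA -signr_addb addbb scale1r.
by [].
Qed.
End Derivation.

End SuperCalculus.

(** * Bracket coefficients as derivations *)

Section BracketCalculus.
Variable K : numFieldType.
Local Notation SV := (SV K).
Local Notation gen := (gen K).
Implicit Types (u v : SV) (w : seq X3).

Lemma par3_d3 x : par3 (d3 x) = par3 x (+) true.
Proof. by case: x => [[m k] l]; rewrite /par3 /=; case: (pI k) (pI l) (odd m) => [] [] []. Qed.

Definition D : SV -> SV := Der gen (fun x => gen (d3 x)) true.
HB.instance Definition _ := GRing.Linear.copy D D.

Lemma compat_gen : compat gen. Proof. exact: homo_gen. Qed.
Lemma homo_d3 x : homo (par3 x (+) true) (gen (d3 x)).
Proof. by rewrite -par3_d3; apply: homo_gen. Qed.

Lemma DM u v : D (u * v) = D u * v + sg u * D v.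
Proof. by rewrite /D (DerM compat_gen homo_d3) !Hom_id. Qed.
Lemma D_gen x : D (gen x) = gen (d3 x).
Proof. exact: (Der_gen compat_gen homo_d3). Qed.
Lemma DC c : D c%:A = 0. Proof. exact: (DerC compat_gen homo_d3). Qed.
Lemma homo_D b u : homo b u -> homo (~~ b) (D u).
Proof. by move=> h; rewrite -addbT; apply: (homo_Der compat_gen homo_d3). Qed.
Lemma DZ c u : D (c *: u) = c *: D u. Proof. exact: linearZ. Qed.
Lemma DD u v : D (u + v) = D u + D v. Proof. exact: linearD. Qed.
Lemma D0 : D 0 = 0. Proof. exact: linear0. Qed.

Lemma cl_Dword w : cl (Dword K par3 d3 w) = D (word K w).
Proof.
rewrite /D (Der_word compat_gen homo_d3); elim: w => [//|x w IH] /=.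
rewrite -cat1s clD -/(word K _) word_cons -IH wordE /hprod; congr (_ + _).
have -> : [seq ((-1) ^+ par3 x * t.1, x :: t.2) | t <- Dword K par3 d3 w] =
   fscale ((-1) ^+ par3 x) (fmul (gen3 K x) (Dword K par3 d3 w)).
  rewrite /fmul /fscale /= cats0 -map_comp; apply: eq_map => t /=.
  by rewrite mul1r.
by rewrite clZ clM.
Qed.

Lemma cl_DV (P : V K) : cl (DV P) = D (cl P).
Proof.
rewrite cl_flatten [in RHS]cl_words linear_sum; apply: eq_bigr => t _.
by rewrite clZ cl_Dword linearZ.
Qed.

Lemma cl_fsignpar (P : V K) : cl (fsignpar par3 P) = sg (cl P).
Proof.
rewrite !cl_words linear_sum big_map; apply: eq_bigr => t _ /=.
by rewrite linearZ /= sg_word scalerA mulrC.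
Qed.

Definition cchi (P : CV K) k : SV := cl (chicoef P k).

Lemma cchiE P k : cchi P k = \sum_(t <- P | t.1 == k) cl t.2.
Proof. by rewrite /cchi /chicoef cl_flatten big_filter. Qed.

Lemma cchi_nil k : cchi [::] k = 0. Proof. by []. Qed.

Lemma cchi_cons t P k : cchi (t :: P) k = (if t.1 == k then cl t.2 else 0) + cchi P k.
Proof. by rewrite !cchiE big_cons; case: ifP => //; rewrite add0r. Qed.

Lemma cchi_cat P Q k : cchi (P ++ Q) k = cchi P k + cchi Q k.
Proof. by rewrite !cchiE big_cat. Qed.

Lemma cchi_flatten (I : Type) (s : seq I) (F : I -> CV K) k :
  cchi (flatten [seq F i | i <- s]) k = \sum_(i <- s) cchi (F i) k.
Proof.
elim: s => [|i s IH]; first by rewrite cchiE !big_nil.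
by rewrite /= cchi_cat IH big_cons.
Qed.

Lemma cchi_scale c P k : cchi [seq (s.1, fscale c s.2) | s <- P] k = c *: cchi P k.
Proof.
by rewrite !cchiE big_map scaler_sumr; apply: eq_bigr => t _ /=; rewrite clZ.
Qed.

Definition pre (F : nat -> SV) k : SV := if k is k'.+1 then F k' else 0.

(** Because 1 - 2[k odd] is (-1)^k, both terms of (D + chi) chi^k v carry the sign (-1)^k. Read at
    index k, the chi-term comes from k - 1, whence the minus sign; [pre] is this index shift. *)
Lemma cchi_Sop b P k :
  cchi (Sop b P) k = (-1) ^+ (b (+) odd k) *: (D (cchi P k) - pre (cchi P) k).
Proof.
elim: P => [|t P IH].
  by case: k => [|k]; rewrite /= !cchiE !big_nil ?(linear0, oppr0, addr0, scaler0).
rewrite /Sop /= -/(Sop b P) -[_ :: _ :: _]/([:: _; _] ++ _) cchi_cat IH.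
have e j : cchi (t :: P) j = (if t.1 == j then cl t.2 else 0) + cchi P j.
  exact: cchi_cons.
have -> : pre (cchi (t :: P)) k = pre (fun j => if t.1 == j then cl t.2 else 0) k + pre (cchi P) k.
  by case: k {IH} => [|k] /=; rewrite ?addr0 ?e.
rewrite e DD [in RHS]opprD [in RHS]addrACA [in RHS]scalerDr; congr (_ + _).
rewrite !cchi_cons cchi_nil addr0 /= clZ clZ cl_DV scalerBr.
case: k {IH e} => [|k] /=.
  rewrite scaler0 subr0; case: eqP => [->|_]; rewrite ?addr0 //.
  by rewrite D0 scaler0.
rewrite eqSS; case: (eqVneq t.1 k.+1) => [->|_].
  by rewrite eqn_leq ltnn /= addr0 scaler0 subr0.
rewrite D0 scaler0 !add0r; case: eqP => [->|_]; last by rewrite scaler0 oppr0.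
rewrite -scaleNr; congr (_ *: _).
by case: (b) (odd k) => [] [] /=; ring.
Qed.

Definition dgen i j k (x : X3) : SV := cchi (brgen K i j x) k.

Lemma dgen_S i j k m k1 l : dgen i j k (m.+1, k1, l) =
  (-1) ^+ (pI i (+) pI j (+) odd k) *:
    (D (dgen i j k (m, k1, l)) - pre (fun k' => dgen i j k' (m, k1, l)) k).
Proof. by rewrite /dgen /= cchi_Sop. Qed.

Lemma dgen00 i j k l : dgen i j 0 (0, k, l) =
  (-1) ^+ ((pI i (+) pI j) && ~~ (pI k (+) pI l)) *:
   ((j == k)%:R *: gen (0, i, l)%N -
    ((-1) ^+ ((pI i (+) pI j) && (pI k (+) pI l)) * (i == l)%:R) *: gen (0, k, j)%N).
Proof.
rewrite /dgen /brgen [iter _ _ _]/iter !cchi_cons cchi_nil eqxx addr0 clZ clD !clZ.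
by rewrite addr0 mulNr scaleNr.
Qed.

Lemma dgen01 i j k l : dgen i j 1 (0, k, l) = ((j == k)%:R * (i == l)%:R * (-1) ^+ pI i)%:A.
Proof. by rewrite /dgen !cchi_cons cchi_nil /= add0r addr0 clC. Qed.

Lemma dgen02 i j k l r : dgen i j r.+2 (0, k, l) = 0.
Proof. by rewrite /dgen !cchi_cons cchi_nil /= !addr0. Qed.

Lemma homo_dgen i j k x : homo (par3 x (+) (pI i (+) pI j (+) odd k)) (dgen i j k x).
Proof.
case: x => [[m k1] l]; elim: m k => [|m IH] k.
  case: k => [|[|k]]; rewrite ?dgen00 ?dgen01 ?dgen02.
  - apply/homoZ/homoB; case: eqP => [e|_]; rewrite ?mulr0 ?scale0r; try exact: homo0.
      apply: homoZ; have := homo_gen K (0, i, l)%N; congr (homo _ _).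
      by rewrite /par3 /= e; case: (pI i) (pI k1) (pI l) => [] [] [].
    apply: homoZ; have := homo_gen K (0, k1, j)%N; congr (homo _ _).
    by rewrite /par3 /= e; case: (pI j) (pI k1) (pI l) => [] [] [].
  - case: eqP => [<-|_]; last by rewrite !mul0r scale0r; apply: homo0.
    case: eqP => [<-|_]; last by rewrite mulr0 mul0r scale0r; apply: homo0.
    have := homo_const (1 * 1 * (-1) ^+ pI i : K); congr (homo _ _).
    by rewrite /par3 /=; case: (pI i) (pI j) => [] [].
  - exact: homo0.
rewrite dgen_S; apply/homoZ/homoB.
  have := homo_D (IH k); congr (homo _ _); rewrite /par3 /=.
  by case: (odd m) (pI k1) (pI l) (pI i) (pI j) (odd k) => [] [] [] [] [] [].
case: k => [|k] /=; first exact: homo0.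
have := IH k; congr (homo _ _); rewrite /par3 /=.
by case: (odd m) (pI k1) (pI l) (pI i) (pI j) (odd k) => [] [] [] [] [] [].
Qed.

Definition delta i j k : SV -> SV := Der gen (dgen i j k) (pI i (+) pI j (+) odd k).
HB.instance Definition _ i j k := GRing.Linear.copy (delta i j k) (delta i j k).

Lemma deltaM i j k u v : delta i j k (u * v) =
  delta i j k u * v + sgb (pI i (+) pI j (+) odd k) u * delta i j k v.
Proof. by rewrite /delta (DerM compat_gen (homo_dgen i j k)) !Hom_id. Qed.
Lemma delta_gen i j k x : delta i j k (gen x) = dgen i j k x.
Proof. exact: (Der_gen compat_gen (homo_dgen i j k)). Qed.
Lemma deltaC i j k c : delta i j k c%:A = 0.
Proof. exact: (DerC compat_gen (homo_dgen i j k)). Qed.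
Lemma delta_sgb i j k b u :
  delta i j k (sgb b u) = (-1) ^+ ((pI i (+) pI j (+) odd k) && b) *: sgb b (delta i j k u).
Proof. exact: (Der_sgb compat_gen (homo_dgen i j k)). Qed.

(** Sesquilinearity in the second argument, extended from letters, where it defines the bracket, to
    all elements. On products both sides obey the same twisted Leibniz rule. *)
Lemma delta_D i j k u : delta i j k (D u) =
  (-1) ^+ (pI i (+) pI j (+) odd k) *: (D (delta i j k u) - pre (fun k' => delta i j k' u) k).
Proof.
elim/sv_ind: u => [|c w u IH].
  by case: k => [|k] /=; rewrite ?(linear0, oppr0, addr0, scaler0).
have pD : pre (fun k' => delta i j k' (c *: word K w + u)) k =
   c *: pre (fun k' => delta i j k' (word K w)) k + pre (fun k' => delta i j k' u) k.
  by case: k {IH} => [|k] /=; rewrite ?linearP // scaler0 addr0.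
rewrite pD DD DZ !(linearP (delta i j k)) /= DD DZ IH.
rewrite opprD addrACA -scalerBr [RHS]scalerDr scalerA [in RHS]mulrC -scalerA.
congr (_ *: _ + _) => {u IH pD c}.
elim: w => [|x w IH].
  rewrite word_nil -[1]scale1r DC linear0 deltaC linear0 sub0r.
  by case: k => [|k] /=; rewrite ?deltaC oppr0 scaler0.
rewrite !word_cons DM linearD /= !deltaM IH DD !DM !D_gen.
have -> : delta i j k (gen (d3 x)) = (-1) ^+ (pI i (+) pI j (+) odd k) *:
   (D (delta i j k (gen x)) - pre (fun k' => delta i j k' (gen x)) k).
  case: x => [[m k1] l]; rewrite !delta_gen dgen_S.
  by case: k {IH} => [|k] //=; rewrite delta_gen.
have -> : delta i j k (sg (gen x)) = (-1) ^+ (pI i (+) pI j (+) odd k) *: sg (delta i j k (gen x)).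
  by have := delta_sgb i j k true (gen x); rewrite /= andbT.
have hx := homo_gen K x.
have pw : pre (fun k' => delta i j k' (gen x * word K w)) k =
  pre (fun k' => delta i j k' (gen x)) k * word K w +
  sgb (~~ (pI i (+) pI j (+) odd k)) (gen x) * pre (fun k' => delta i j k' (word K w)) k.
  case: k {IH} => [|k] /=; first by rewrite mul0r mulr0 addr0.
  by rewrite deltaM addbN negbK.
have -> : sg (gen x) = (-1) ^+ par3 x *: gen x := hx.
rewrite pw linearZ /= !(homo_sgb _ hx) (homo_sgb _ (homo_d3 x)) !DZ D_gen.
have -> : sg ((-1) ^+ ((pI i (+) pI j (+) odd k) && par3 x) *: gen x) =
   (-1) ^+ ((pI i (+) pI j (+) odd k) && par3 x) *: ((-1) ^+ par3 x *: gen x).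
  by rewrite linearZ /=; congr (_ *: _).
move: (delta i j k (gen x)) (delta i j k (word K w)) (pre _ k) (pre _ k) => A B E F.
set s := pI i (+) pI j (+) odd k.
have aux (a b c d e f : SV) : a - b + c + (d + (e - f)) = (a + d) + (c + e) - (b + f).
  by rewrite opprD !addrA (ACl (1*4*3*5*2*6)).
rewrite -!scalerAl mulrBl -!scalerAr mulrBr !scalerA !scalerBr.
rewrite aux !scalerDr !scalerA.
by congr (_ + _ + (_ *: _ + _ *: _) - (_ + _ *: _)); case: (s) (par3 x) => [] [] /=; ring.
Qed.

Lemma cchi_brword i j w k : cchi (brword K i j w) k = delta i j k (word K w).
Proof.
rewrite /delta (Der_word compat_gen (homo_dgen i j k)); elim: w => [//|x w IH] /=.
rewrite cchi_cat addrC; congr (_ + _).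
  rewrite /dgen !cchiE big_map mulr_suml; apply: eq_bigr => t _ /=.
  by rewrite clM -/(word K w) wordE.
rewrite -IH !cchiE big_map mulr_sumr scaler_sumr; apply: eq_bigr => t /= /eqP <-.
by rewrite clZ clM; congr (_ ^+ _ *: _); case: (pI i) (pI j) (odd t.1) (par3 x) => [] [] [] [].
Qed.

Lemma cchi_brpoly i j (P : V K) k : cchi (brpoly i j P) k = delta i j k (cl P).
Proof.
rewrite cchi_flatten cl_words linear_sum; apply: eq_bigr => t _ /=.
by rewrite cchi_scale cchi_brword linearZ.
Qed.

(* The chi^k-coefficient of the bracket of bar a with u; it is a derivation of
   parity p(a) + k in u because chi is odd. *)
Definition delt n (a : mat K) k u : SV :=
  \sum_(i <- rng n) \sum_(j <- rng n) a i j *: delta i j k u.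

Fact delt_linear n a k : linear (delt n a k).
Proof.
move=> c u v; rewrite /delt scaler_sumr -big_split; apply: eq_bigr => i _ /=.
rewrite scaler_sumr -big_split; apply: eq_bigr => j _ /=.
by rewrite linearP scalerDr !scalerA mulrC.
Qed.
HB.instance Definition _ n a k := GRing.isLinear.Build K SV SV _ (delt n a k) (delt_linear n a k).

Lemma cchi_bracket n a (P : V K) k : cchi (bracket n a P) k = delt n a k (cl P).
Proof.
rewrite cchi_flatten big_allpairs_dep /delt; apply: eq_bigr => i _; apply: eq_bigr => j _.
by rewrite cchi_scale cchi_brpoly.
Qed.

Definition mhomo (b : bool) (a : mat K) := forall i j, a i j != 0 -> pI i (+) pI j = b.

Section Homogeneous.
Variables (n : nat) (a : mat K) (b : bool).
Hypothesis ha : mhomo b a.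

(** Entries of the wrong parity vanish, so the parity of an index pair may be replaced by the fixed
    [b] inside the sum. *)
Lemma delt_eq k u (F : nat -> nat -> SV) :
  (forall i j, pI i (+) pI j = b -> delta i j k u = F i j) ->
  delt n a k u = \sum_(i <- rng n) \sum_(j <- rng n) a i j *: F i j.
Proof.
move=> h; apply: eq_bigr => i _; apply: eq_bigr => j _.
by case: (eqVneq (a i j) 0) => [->|/ha/h->//]; rewrite !scale0r.
Qed.

Lemma deltM k u v : delt n a k (u * v) =
  delt n a k u * v + sgb (b (+) odd k) u * delt n a k v.
Proof.
rewrite (@delt_eq k (u * v) (fun i j => delta i j k u * v + sgb (b (+) odd k) u * delta i j k v)); last first.
  by move=> i j e; rewrite deltaM e.
rewrite /delt mulr_suml mulr_sumr -big_split; apply: eq_bigr => i _ /=.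
rewrite mulr_suml mulr_sumr -big_split; apply: eq_bigr => j _ /=.
by rewrite scalerDr scalerAl scalerAr.
Qed.

Lemma deltC k c : delt n a k c%:A = 0.
Proof. by apply: big1 => i _; apply: big1 => j _; rewrite deltaC scaler0. Qed.

Lemma delt_sgb k b' u : delt n a k (sgb b' u) = (-1) ^+ ((b (+) odd k) && b') *: sgb b' (delt n a k u).
Proof.
rewrite (@delt_eq k _ (fun i j => (-1) ^+ ((b (+) odd k) && b') *: sgb b' (delta i j k u))); last first.
  by move=> i j e; rewrite delta_sgb e.
rewrite /delt linear_sum scaler_sumr; apply: eq_bigr => i _ /=.
rewrite linear_sum scaler_sumr; apply: eq_bigr => j _ /=.
by rewrite [sgb b' (_ *: _)]linearZ /= !scalerA mulrC.
Qed.

Lemma delt_D k u : delt n a k (D u) =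
  (-1) ^+ (b (+) odd k) *: (D (delt n a k u) - pre (fun k' => delt n a k' u) k).
Proof.
rewrite (@delt_eq k _ (fun i j => (-1) ^+ (b (+) odd k) *: (D (delta i j k u) - pre (fun k' => delta i j k' u) k))); last first.
  by move=> i j e; rewrite delta_D e.
have -> : pre (fun k' => delt n a k' u) k =
    \sum_(i <- rng n) \sum_(j <- rng n) a i j *: pre (fun k' => delta i j k' u) k.
  case: k => [|k] //=; rewrite big1 // => i _; apply: big1 => j _; exact: scaler0.
rewrite /delt linear_sum -sumrB scaler_sumr; apply: eq_bigr => i _ /=.
rewrite linear_sum -sumrB scaler_sumr; apply: eq_bigr => j _ /=.
by rewrite DZ -scalerBr !scalerA mulrC.
Qed.
End Homogeneous.

Lemma delt_lin n (I J : Type) (s : seq I) (s' : seq J) (P : I -> pred J) (c : I -> J -> K) (F : I -> J -> mat K) a k u :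
  (forall i j, a i j = \sum_(x <- s) \sum_(y <- s' | P x y) c x y * F x y i j) ->
  delt n a k u = \sum_(x <- s) \sum_(y <- s' | P x y) c x y *: delt n (F x y) k u.
Proof.
move=> e; rewrite /delt.
transitivity (\sum_(i <- rng n) \sum_(j <- rng n) \sum_(x <- s) \sum_(y <- s' | P x y)
   (c x y * F x y i j) *: delta i j k u).
  apply: eq_bigr => i _; apply: eq_bigr => j _; rewrite e scaler_suml.
  by apply: eq_bigr => x _; rewrite scaler_suml.
under eq_bigr => i _ do rewrite exchange_big.
rewrite exchange_big /=; apply: eq_bigr => x _.
under eq_bigr => i _ do rewrite exchange_big.
rewrite exchange_big /=; apply: eq_bigr => y _.
rewrite scaler_sumr; apply: eq_bigr => i _; rewrite scaler_sumr; apply: eq_bigr => j _.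
by rewrite scalerA.
Qed.

End BracketCalculus.

(** * Generated subalgebras and the orthosymplectic root vectors *)

Section Subalgebras.
Variable K : numFieldType.
Local Notation SV := (SV K).
Local Notation gen := (gen K).
Implicit Types (u v : SV) (w : seq X3).

Inductive salg (G : SV -> Prop) : SV -> Prop :=
| salg_gen u : G u -> salg G u
| salg_const c : salg G c%:A
| salg_add u v : salg G u -> salg G v -> salg G (u + v)
| salg_mul u v : salg G u -> salg G v -> salg G (u * v).

Section SalgTheory.
Variable G : SV -> Prop.

Lemma salg1 : salg G 1. Proof. by have := salg_const G 1; rewrite scale1r. Qed.
Lemma salg0 : salg G 0. Proof. by have := salg_const G 0; rewrite scale0r. Qed.
Lemma salg_scale c u : salg G u -> salg G (c *: u).
Proof. by move=> h; rewrite -[u]mul1r scalerAl; apply: salg_mul => //; apply: salg_const. Qed.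
Lemma salg_opp u : salg G u -> salg G (- u).
Proof. by rewrite -scaleN1r; apply: salg_scale. Qed.
Lemma salg_sub u v : salg G u -> salg G v -> salg G (u - v).
Proof. by move=> hu hv; apply: salg_add => //; apply: salg_opp. Qed.
Lemma salg_sum (I : eqType) (s : seq I) (P : pred I) (F : I -> SV) :
  (forall i, i \in s -> P i -> salg G (F i)) -> salg G (\sum_(i <- s | P i) F i).
Proof.
move=> h; rewrite big_seq_cond; elim/big_rec: _ => [|i u /andP[hi Pi] hu]; first exact: salg0.
by apply: salg_add => //; apply: h.
Qed.
Lemma salg_sg u : (forall u, G u -> salg G (sg u)) -> salg G u -> salg G (sg u).
Proof.
move=> h; elim=> {u} [u /h //|c|u v _ hu _ hv|u v _ hu _ hv].
- by rewrite linearZ /= sg1; apply: salg_const.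
- by rewrite linearD; apply: salg_add.
- by rewrite sgM; apply: salg_mul.
Qed.
Lemma salg_D u : (forall u, G u -> salg G (sg u)) -> (forall u, G u -> salg G (D u)) ->
  salg G u -> salg G (D u).
Proof.
move=> hs h; elim=> {u} [u /h //|c|u v _ hu _ hv|u v hu hu' hv hv'].
- by rewrite DC; apply: salg0.
- by rewrite DD; apply: salg_add.
- rewrite DM; apply: salg_add; apply: salg_mul => //.
  exact: salg_sg.
Qed.
End SalgTheory.

Lemma salg_le (G G' : SV -> Prop) u : (forall v, G v -> salg G' v) -> salg G u -> salg G' u.
Proof.
move=> h; elim=> {u} [u /h //|c|u v _ hu _ hv|u v _ hu _ hv].
- exact: salg_const.
- exact: salg_add.
- exact: salg_mul.
Qed.

(** Bridge between the inductive subalgebra, convenient for proofs, and the lists of coefficients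
    and words that the definitions quantify over. *)
Lemma salg_lists (I : Type) (val : I -> SV) (S : I -> Prop) u :
  salg (fun u => exists x, S x /\ u = val x) u <->
  exists Q : seq (K * seq I),
    (forall t x, List.In t Q -> List.In x t.2 -> S x) /\
    u = \sum_(t <- Q) t.1 *: \prod_(x <- t.2) val x.
Proof.
split=> [|[Q [hQ ->]]].
  elim=> {u} [u [x [Sx ->]]|c|u v _ [Q [hQ ->]] _ [Q' [hQ' ->]]|u v _ [Q [hQ ->]] _ [Q' [hQ' ->]]].
  - exists [:: (1, [:: x])]; split.
      by move=> t y [<-|//] [<-|//].
    by rewrite big_seq1 scale1r big_seq1.
  - exists [:: (c, [::])]; split.
      by move=> t y [<-|//].
    by rewrite big_seq1 big_nil.
  - exists (Q ++ Q'); split; last by rewrite big_cat.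
    by move=> t x /List.in_app_iff [h1|h1]; [apply: hQ|apply: hQ'].
  - exists [seq (t.1 * s.1, t.2 ++ s.2) | t <- Q, s <- Q']; split.
      have aux R : (forall t x, List.In t R -> List.In x t.2 -> S x) ->
          forall t x, List.In t [seq (t.1 * s.1, t.2 ++ s.2) | t <- R, s <- Q'] -> List.In x t.2 -> S x.
        elim: R => [//|r R IH] hR t x /= /List.in_app_iff [|]; last first.
          by apply: IH => t' x' h1 h2; apply: (hR t') => //; right.
        move=> /List.in_map_iff [s [<- hs]] /= /List.in_app_iff [h|h].
          by apply: (hR r) => //; left.
        exact: (hQ' s).
      exact: aux hQ.
    rewrite big_allpairs_dep mulr_suml; apply: eq_bigr => t _.
    rewrite mulr_sumr; apply: eq_bigr => s _ /=.
    by rewrite big_cat -scalerAl -scalerAr scalerA.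
elim: Q hQ => [|t Q IH] hQ; first by rewrite big_nil; apply: salg0.
rewrite big_cons; apply: salg_add; last first.
  by apply: IH => t' x h1 h2; apply: (hQ t') => //; right.
apply: salg_scale; have: forall x, List.In x t.2 -> S x by move=> x; apply: hQ; left.
elim: t.2 => [|x w IHw] hw; first by rewrite big_nil; apply: salg1.
rewrite big_cons; apply: salg_mul; last by apply: IHw => y hy; apply: hw; right.
by apply: salg_gen; exists x; split => //; apply: hw; left.
Qed.

Lemma Hom_D (g : X3 -> SV) u : compat g -> (forall x, g (d3 x) = D (g x)) ->
  sHom g (D u) = D (sHom g u).
Proof.
move=> hg h; elim/sv_ind: u => [|c w u IH]; first by rewrite !(D0, linear0).
rewrite DD DZ linearD /= linearZ /= IH linearP /= DD DZ; congr (_ *: _ + _).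
elim: w => [|x w IHw]; first by rewrite word_nil -[1]scale1r DC HomC // DC linear0.
have hs : sHom g (sg (gen x)) = sg (sHom g (gen x)) by have := Hom_sgb hg true (gen x).
by rewrite word_cons DM linearD /= !HomM // IHw hs D_gen !Hom_gen // h DM.
Qed.

Lemma Hom_salg (g : X3 -> SV) (G G' : SV -> Prop) u : compat g ->
  (forall v, G v -> salg G' (sHom g v)) -> salg G u -> salg G' (sHom g u).
Proof.
move=> hg h; elim=> {u} [u /h //|c|u v _ hu _ hv|u v _ hu _ hv].
- by rewrite HomC //; apply: salg_const.
- by rewrite linearD; apply: salg_add.
- by rewrite HomM //; apply: salg_mul.
Qed.

Section Orthosymplectic.
Variable n : nat.

Lemma mem_rng i : (i \in rng n) = (0 < i < 4 * n)%N.
Proof. rewrite mem_iota /Nd; lia. Qed.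

Lemma big_rng1 (M : lmodType K) i (F : nat -> M) : i \in rng n ->
  \sum_(k <- rng n) (k == i)%:R *: F k = F i.
Proof.
move=> hi; rewrite (bigD1_seq i) ?iota_uniq //= eqxx scale1r big1 ?addr0 // => k /negbTE ->.
by rewrite scale0r.
Qed.

Local Notation pr := (primeI n).

Lemma prime_rng i : i \in rng n -> (pr i) \in rng n.
Proof. rewrite !mem_rng /primeI; lia. Qed.
Lemma primeK i : i \in rng n -> (pr (pr i)) = i.
Proof. rewrite !mem_rng /primeI; lia. Qed.
Lemma pI_prime i : i \in rng n -> pI (pr i) = pI i.
Proof.
rewrite mem_rng /pI /primeI => hi; rewrite oddB; last by lia.
by rewrite oddM.
Qed.
Lemma eq_prime i j : i \in rng n -> j \in rng n -> (i == (pr j)) = ((pr i) == j).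
Proof. rewrite !mem_rng /primeI => hi hj; apply/eqP/eqP; lia. Qed.

Lemma big_prime (M : zmodType) (F : nat -> M) :
  \sum_(k <- rng n) F k = \sum_(k <- rng n) F (pr k).
Proof.
rewrite -(big_map (primeI n) xpredT F); apply: perm_big.
apply: uniq_perm; first exact: iota_uniq.
  rewrite map_inj_in_uniq ?iota_uniq // => i j hi hj e.
  by rewrite -(primeK hi) e primeK.
move=> i; apply/idP/mapP => [hi|[j hj ->]]; last exact: prime_rng.
by exists (pr i); rewrite ?primeK ?prime_rng.
Qed.

Definition sF i j : bool := (pI i && pI j) (+) pI j (+) true (+) deltaI n i (+) deltaI n j.

(* [sF] is the exponent of the sign in theta. *)
Lemma FmE i j k l : Fm K n i j k l =
  ((k == i) && (l == j))%:R + (-1) ^+ sF i j * ((k == (pr j)) && (l == (pr i)))%:R.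
Proof. by []. Qed.

(** For i odd, i and i' are distinct odd numbers with sum 4n, so exactly one of them is at least 2n
    + 1. *)
Lemma deltaI_prime i : i \in rng n -> deltaI n (pr i) = deltaI n i (+) pI i.
Proof.
move=> hi; have := pI_prime hi; rewrite /deltaI /pI => ->.
move: hi; rewrite mem_rng /primeI => hi.
case oi: (odd i) => //=.
case: (leqP (2 * n + 1) i) => h; case: (leqP (2 * n + 1) (4 * n - i)) => h' //=; lia.
Qed.

Lemma sF_prime i j : i \in rng n -> j \in rng n -> sF (pr j) (pr i) = sF i j.
Proof.
move=> hi hj; rewrite /sF !pI_prime // !deltaI_prime //.
by case: (pI i) (pI j) (deltaI n i) (deltaI n j) => [] [] [] [].
Qed.

Lemma sF_sym i j : sF j i = sF i j (+) pI i (+) pI j.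
Proof. by rewrite /sF; case: (pI i) (pI j) (deltaI n i) (deltaI n j) => [] [] [] []. Qed.

(** In terms of theta: theta(xy) = -(-1)^(p(x)p(y)) theta(y) theta(x) on matrix units, which makes
    theta an automorphism of the superbracket. *)
Lemma sF_mul k l r : sF k r (+) sF r l = ~~ (sF k l (+) ((pI k (+) pI r) && (pI r (+) pI l))).
Proof. by rewrite /sF; case: (pI k) (pI l) (pI r) (deltaI n k) (deltaI n l) (deltaI n r) => [] [] [] [] [] []. Qed.

Definition bar m (a : mat K) : SV := cl (barD n m a).

Lemma barE m a : bar m a = \sum_(k <- rng n) \sum_(l <- rng n) a k l *: gen (m, k, l).
Proof.
rewrite /bar cl_words big_allpairs_dep; apply: eq_bigr => k _; apply: eq_bigr => l _.
by rewrite word_cons word_nil mulr1.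
Qed.

Lemma D_bar m a : D (bar m a) = bar m.+1 a.
Proof.
rewrite !barE linear_sum; apply: eq_bigr => k _; rewrite linear_sum; apply: eq_bigr => l _ /=.
by rewrite DZ D_gen.
Qed.

Lemma bar_lin (S : nat -> nat -> bool) (c : nat -> nat -> K) (F : nat -> nat -> mat K) m a :
  (forall k l, a k l = \sum_(i <- rng n) \sum_(j <- rng n | S i j) c i j * F i j k l) ->
  bar m a = \sum_(i <- rng n) \sum_(j <- rng n | S i j) c i j *: bar m (F i j).
Proof.
move=> e; rewrite barE.
transitivity (\sum_(k <- rng n) \sum_(l <- rng n) \sum_(i <- rng n) \sum_(j <- rng n | S i j)
   (c i j * F i j k l) *: gen (m, k, l)).
  apply: eq_bigr => k _; apply: eq_bigr => l _; rewrite e scaler_suml.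
  by apply: eq_bigr => i _; rewrite scaler_suml.
under eq_bigr => k _ do rewrite exchange_big.
rewrite exchange_big /=; apply: eq_bigr => i _.
under eq_bigr => k _ do rewrite exchange_big.
rewrite exchange_big /=; apply: eq_bigr => j _.
rewrite barE scaler_sumr; apply: eq_bigr => k _; rewrite scaler_sumr; apply: eq_bigr => l _.
by rewrite scalerA.
Qed.

Definition Fb m i j : SV := bar m (Fm K n i j).

Lemma FbE m i j : i \in rng n -> j \in rng n ->
  Fb m i j = gen (m, i, j) + (-1) ^+ sF i j *: gen (m, (pr j), (pr i)).
Proof.
move=> hi hj; rewrite /Fb barE.
transitivity (\sum_(k <- rng n) ((k == i)%:R *: gen (m, k, j) +
    (-1) ^+ sF i j *: ((k == (pr j))%:R *: gen (m, k, (pr i))))).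
  apply: eq_bigr => k _.
  rewrite -(big_rng1 (fun l => gen (m, k, l)) hj) -(big_rng1 (fun l => gen (m, k, l)) (prime_rng hi)).
  rewrite !scaler_sumr -big_split; apply: eq_bigr => l _ /=.
  rewrite FmE scalerDl !scalerA -!natrM !mulnb; congr (_ + _ *: _).
  by rewrite -mulnb natrM mulrA.
rewrite big_split /= -scaler_sumr (big_rng1 (fun k => gen (m, k, j)) hi).
by rewrite (big_rng1 (fun k => gen (m, k, (pr i))) (prime_rng hj)).
Qed.

Lemma Fb_prime m i j : i \in rng n -> j \in rng n -> Fb m (pr j) (pr i) = (-1) ^+ sF i j *: Fb m i j.
Proof.
move=> hi hj; rewrite !FbE ?prime_rng // !primeK // sF_prime // scalerDr scalerA.
by rewrite -signr_addb addbb scale1r addrC.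
Qed.

Lemma D_Fb m i j : D (Fb m i j) = Fb m.+1 i j. Proof. exact: D_bar. Qed.

Lemma homo_Fb m i j : i \in rng n -> j \in rng n -> homo (par3 (m, i, j)) (Fb m i j).
Proof.
move=> hi hj; rewrite FbE //; apply: homoD; first exact: homo_gen.
apply: homoZ; have := homo_gen K (m, (pr j), (pr i)); congr (homo _ _).
by rewrite /par3 /= !pI_prime // (addbC (pI j)).
Qed.

Definition Gens (S : nat -> nat -> bool) u :=
  exists m i j, [/\ i \in rng n, j \in rng n, S i j & u = Fb m i j].

Lemma Gens_sg S u : Gens S u -> salg (Gens S) (sg u).
Proof.
move=> [m [i [j [hi hj hS ->]]]]; have -> := homo_Fb m hi hj.
by apply/salg_scale/salg_gen; exists m, i, j.
Qed.
Lemma Gens_D S u : Gens S u -> salg (Gens S) (D u).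
Proof. by move=> [m [i [j [hi hj hS ->]]]]; rewrite D_Fb; apply: salg_gen; exists m.+1, i, j. Qed.
Lemma V_D S u : salg (Gens S) u -> salg (Gens S) (D u).
Proof. by apply: salg_D => v; [apply: Gens_sg|apply: Gens_D]. Qed.
Lemma Vsgb S b u : salg (Gens S) u -> salg (Gens S) (sgb b u).
Proof. by case: b => //=; apply: salg_sg => v; apply: Gens_sg. Qed.
Lemma V_le (S S' : nat -> nat -> bool) u : (forall i j, S i j -> S' i j) ->
  salg (Gens S) u -> salg (Gens S') u.
Proof.
move=> h; apply: salg_le => v [m [i [j [hi hj hS e]]]]; apply: salg_gen.
by exists m, i, j; split=> //; apply: h.
Qed.

Lemma bar_span S m a : in_span n S a -> salg (Gens S) (bar m a).
Proof.
move=> [c e]; rewrite (bar_lin m e); apply: salg_sum => i hi _; apply: salg_sum => j hj hS.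
by apply/salg_scale/salg_gen; exists m, i, j.
Qed.

Lemma Fm_span (S : nat -> nat -> bool) i j : i \in rng n -> j \in rng n -> S i j -> in_span n S (Fm K n i j).
Proof.
move=> hi hj hS; exists (fun i' j' => ((i' == i) && (j' == j))%:R) => k l.
rewrite (bigD1_seq i) ?iota_uniq //= big_mkcond (bigD1_seq j) ?iota_uniq //= hS !eqxx mul1r.
rewrite big1 => [|j' /negbTE ->]; last by rewrite andbF mul0r; case: ifP.
rewrite big1 => [|i' /negbTE ->]; first by rewrite !addr0.
by apply: big1 => j' _; rewrite mul0r.
Qed.
End Orthosymplectic.
End Subalgebras.

(** * Brackets of orthosymplectic elements with root vectors *)

Section OspBrackets.
Variable K : numFieldType.
Variable n : nat.
Local Notation SV := (SV K).
Local Notation gen := (gen K).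
Local Notation pr := (primeI n).
Local Notation Fb := (Fb K n).
Local Notation Gens := (@Gens K n).
Implicit Types (u v : SV) (w : seq X3).

(** The equation theta(a) = a in coordinates. *)
Definition oinv (a : mat K) := forall k l, k \in rng n -> l \in rng n ->
  a (pr l) (pr k) = (-1) ^+ sF n k l * a k l.

Lemma oinv_Fm i j : i \in rng n -> j \in rng n -> oinv (Fm K n i j).
Proof.
move=> hi hj k l hk hl; rewrite !FmE.
have ep x y : x \in rng n -> y \in rng n -> (pr x == y) = (x == pr y).
  by move=> hx hy; rewrite eq_prime.
rewrite !ep ?prime_rng // !primeK // [(k == i) && _]andbC [(k == pr j) && _]andbC.
rewrite mulrDr addrC; congr (_ + _).
  by case: eqP => [->|_]; case: eqP => [->|_]; rewrite ?mulr0.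
case: eqP => [->|_]; case: eqP => [->|_]; rewrite ?mulr0 //.
by rewrite sF_prime // mulr1 -signr_addb addbb.
Qed.

Lemma mhomo_Fm i j : i \in rng n -> j \in rng n -> mhomo (pI i (+) pI j) (Fm K n i j).
Proof.
move=> hi hj k l; rewrite FmE; case: (boolP ((k == i) && (l == j))) => [/andP[/eqP-> /eqP->] _ //|_].
rewrite add0r; case: (boolP ((k == pr j) && (l == pr i))) => [/andP[/eqP-> /eqP->] _|_]; last by rewrite mulr0 eqxx.
by rewrite !pI_prime // addbC.
Qed.

Lemma sign_sF k l r : (-1) ^+ sF n k r * (-1) ^+ sF n r l =
  - ((-1) ^+ sF n k l * (-1) ^+ ((pI k (+) pI r) && (pI r (+) pI l))) :> K.
Proof. by rewrite -signr_addb sF_mul signrN -signr_addb. Qed.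

Lemma sign_sF_sym i j : (-1) ^+ sF n j i = (-1) ^+ sF n i j * ((-1) ^+ pI i * (-1) ^+ pI j) :> K.
Proof. by rewrite -!signr_addb sF_sym addbA. Qed.

Section Invariant.
Variables (a : mat K) (b : bool).
Hypotheses (ha : mhomo b a) (hinv : oinv a).

Lemma delt_gen0 k l : k \in rng n -> l \in rng n ->
  delt n a 0 (gen (0, k, l)%N) = (-1) ^+ (b && ~~ (pI k (+) pI l)) *:
   (\sum_(r <- rng n) a r k *: gen (0, r, l)%N -
    (-1) ^+ (b && (pI k (+) pI l)) *: \sum_(r <- rng n) a l r *: gen (0, k, r)%N).
Proof.
move=> hk hl.
rewrite (delt_eq n ha (F := fun i j => (-1) ^+ (b && ~~ (pI k (+) pI l)) *:
   ((j == k)%:R *: gen (0, i, l)%N -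
    ((-1) ^+ (b && (pI k (+) pI l)) * (i == l)%:R) *: gen (0, k, j)%N))); last first.
  by move=> i j e; rewrite delta_gen dgen00 e.
transitivity (\sum_(i <- rng n) (-1) ^+ (b && ~~ (pI k (+) pI l)) *:
    (a i k *: gen (0, i, l)%N - (-1) ^+ (b && (pI k (+) pI l)) *:
      ((i == l)%:R *: \sum_(j <- rng n) a i j *: gen (0, k, j)%N))).
  apply: eq_bigr => i _; rewrite -(big_rng1 (fun j => a i j *: gen (0, i, l)%N) hk).
  rewrite !scaler_sumr -sumrB scaler_sumr; apply: eq_bigr => j _.
  rewrite !scalerBr !scalerA; congr (_ *: _ - _ *: _); ring.
rewrite -scaler_sumr sumrB; congr (_ *: (_ - _)); rewrite -scaler_sumr; congr (_ *: _).
exact: (big_rng1 (fun i => \sum_(j <- rng n) a i j *: gen (0, k, j)%N) hl).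
Qed.

Lemma delt_gen1 k l : k \in rng n -> l \in rng n ->
  delt n a 1 (gen (0, k, l)%N) = ((-1) ^+ pI l * a l k)%:A.
Proof.
move=> hk hl; rewrite /delt.
transitivity (\sum_(i <- rng n) (i == l)%:R *: \sum_(j <- rng n) (j == k)%:R *: (((-1) ^+ pI i * a i j)%:A : SV)).
  apply: eq_bigr => i _; rewrite scaler_sumr; apply: eq_bigr => j _.
  by rewrite delta_gen dgen01 !scalerA; congr (_ *: _); ring.
by rewrite (big_rng1 _ hl) (big_rng1 _ hk).
Qed.

Lemma delt_gen2 k l r : delt n a r.+2 (gen (0, k, l)%N) = 0.
Proof.
by apply: big1 => i _; apply: big1 => j _; rewrite delta_gen dgen02 scaler0.
Qed.

(** F_kl is a matrix unit plus its mirror. Reindexing by r -> r' and using theta(a) = a turns left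
    multiplication on one half into the mirror of right multiplication on the other, so that the
    result closes on root vectors. *)
Lemma delt_Fb0 k l : k \in rng n -> l \in rng n ->
  delt n a 0 (Fb 0 k l) = (-1) ^+ (b && ~~ (pI k (+) pI l)) *:
   (\sum_(r <- rng n) a r k *: Fb 0 r l -
    (-1) ^+ (b && (pI k (+) pI l)) *: \sum_(r <- rng n) a l r *: Fb 0 k r).
Proof.
move=> hk hl; rewrite FbE // linearD linearZ /= !delt_gen0 ?prime_rng // !pI_prime //.
rewrite (addbC (pI l)) scalerA mulrC -scalerA -scalerDr; congr (_ *: _).
have e1 : \sum_(r <- rng n) a r k *: Fb 0 r l = \sum_(r <- rng n) a r k *: gen (0, r, l)%N
   + \sum_(r <- rng n) (a r k * (-1) ^+ sF n r l) *: gen (0, pr l, pr r)%N.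
  rewrite -big_split; apply: eq_big_seq => r hr /=.
  by rewrite FbE // scalerDr scalerA.
have e2 : \sum_(r <- rng n) a l r *: Fb 0 k r = \sum_(r <- rng n) a l r *: gen (0, k, r)%N
   + \sum_(r <- rng n) (a l r * (-1) ^+ sF n k r) *: gen (0, pr r, pr k)%N.
  rewrite -big_split; apply: eq_big_seq => r hr /=.
  by rewrite FbE // scalerDr scalerA.
rewrite e1 e2 [in RHS]scalerDr [in LHS]scalerBr opprD [RHS]addrACA; congr (_ + _).
rewrite addrC; congr (_ + _).
  rewrite big_prime -scaleNr !scaler_sumr; apply: eq_big_seq => r hr.
  rewrite hinv // !scalerA; congr (_ *: _).
  case: (eqVneq (a l r) 0) => [->|/ha e]; first by rewrite mul0r !mulr0.
  have h := sign_sF k r l; rewrite e andbC in h.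
  by rewrite mulrA h; ring.
rewrite scalerA -scaleNr big_prime !scaler_sumr; apply: eq_big_seq => r hr.
rewrite hinv // !scalerA; congr (_ *: _).
case: (eqVneq (a r k) 0) => [->|/ha e]; first by rewrite mul0r !mulr0.
have h := sign_sF r l k; rewrite e in h.
have := sqrr_sign K (b && (pI k (+) pI l)); rewrite expr2.
move: h; set A := (-1) ^+ sF n r k; set B := (-1) ^+ sF n k l; set C := (-1) ^+ (b && _).
move=> h s2; transitivity (- (A * B) * C * a r k); first by ring.
by rewrite h -[RHS]mulr1 -s2; ring.
Qed.

(** This is (a|F_kl); the factor 2 arises because the unit and its mirror contribute equally. *)
Lemma delt_Fb1 k l : k \in rng n -> l \in rng n ->
  delt n a 1 (Fb 0 k l) = (2%:R * (-1) ^+ pI l * a l k)%:A.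
Proof.
move=> hk hl; rewrite FbE // linearD linearZ /= !delt_gen1 ?prime_rng // !pI_prime //.
rewrite scalerA -scalerDl; congr (_ *: _); rewrite hinv // (sign_sF_sym l k).
have := sqrr_sign K (sF n l k); have := sqrr_sign K (pI k); rewrite !expr2 => s1 s2.
have -> : (-1) ^+ sF n l k * ((-1) ^+ pI l * (-1) ^+ pI k) * ((-1) ^+ pI k * ((-1) ^+ sF n l k * a l k))
  = ((-1) ^+ sF n l k * (-1) ^+ sF n l k) * ((-1) ^+ pI k * (-1) ^+ pI k) * ((-1) ^+ pI l * a l k) :> K by ring.
by rewrite s1 s2; ring.
Qed.

Lemma delt_Fb2 k l r : k \in rng n -> l \in rng n -> delt n a r.+2 (Fb 0 k l) = 0.
Proof. by move=> hk hl; rewrite FbE // linearD linearZ /= !delt_gen2 scaler0 addr0. Qed.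

Lemma delt_V k u : salg (Gens (fun _ _ => true)) u -> salg (Gens (fun _ _ => true)) (delt n a k u).
Proof.
move=> h; elim: h k => {u} [u [m [i [j [hi hj _ ->]]]]|c|u v _ hu _ hv|u v hu hu' hv hv'] k.
- have g0 m' i' j' : i' \in rng n -> j' \in rng n -> salg (Gens (fun _ _ => true)) (Fb m' i' j').
    by move=> h1 h2; apply: salg_gen; exists m', i', j'.
  elim: m k => [|m IH] k.
    case: k => [|[|k]]; rewrite ?delt_Fb0 ?delt_Fb1 ?delt_Fb2 //.
    + apply/salg_scale/salg_sub; [|apply: salg_scale]; apply: salg_sum => r hr _;
      by apply: salg_scale; apply: g0.
    + exact: salg_const.
    + exact: salg0.
  rewrite -D_Fb (delt_D _ ha); apply/salg_scale/salg_sub; first exact/V_D/IH.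
  by case: k => [|k] /=; [apply: salg0|apply: IH].
- by rewrite deltC; apply: salg0.
- by rewrite linearD; apply: salg_add; [apply: hu|apply: hv].
- by rewrite (deltM _ ha); apply: salg_add; apply: salg_mul => //; apply: Vsgb.
Qed.

End Invariant.

End OspBrackets.

(** * Reduction modulo J *)

Section Reduction.
Variable K : numFieldType.
Variable n : nat.
Local Notation SV := (SV K).
Local Notation gen := (gen K).
Local Notation pr := (primeI n).
Local Notation Fb := (Fb K n).
Local Notation Gens := (@Gens K n).
Local Notation bar := (@bar K n).
Local Notation fmat := (fmat K n).
Local Notation allS := (fun _ _ : nat => true).
Local Notation lowS := (fun i j : nat => (j <= i)%N).
Implicit Types (u v : SV) (w : seq X3).

(* f_{k+1,k} for 1 <= k <= 4n-2; the value 1 at k = 0 is a convention. *)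
Definition phi (k : nat) : K := if (k < 2 * n)%N then 1 else (-1) ^+ odd k.

Lemma phi_neq0 k : phi k != 0.
Proof. by rewrite /phi; case: ifP; rewrite ?oner_neq0 // signr_eq0. Qed.

Lemma phi_lt k : (k < 2 * n)%N -> phi k = 1.
Proof. by rewrite /phi => ->. Qed.

Lemma phi_ge k : (2 * n <= k)%N -> phi k = (-1) ^+ odd k.
Proof. by rewrite /phi ltnNge => ->. Qed.

Lemma phi0 : (0 < n)%N -> phi 0 = 1.
Proof. by move=> h; rewrite /phi muln_gt0 h. Qed.

Lemma phi_sq k : phi k * phi k = 1.
Proof. by rewrite /phi; case: ifP; rewrite ?mulr1 // -expr2 sqrr_sign. Qed.

Lemma big_iota1 (M : lmodType K) a b i (F : nat -> M) :
  \sum_(k <- iota a b) (i == k)%:R *: F k = if (a <= i < a + b)%N then F i else 0.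
Proof.
rewrite -mem_iota; case: ifP => hi.
  rewrite (bigD1_seq i) ?iota_uniq //= eqxx scale1r big1 ?addr0 // => k /negbTE.
  by rewrite eq_sym => ->; rewrite scale0r.
rewrite big_seq big1 // => k hk; case: eqP => [e|]; last by rewrite scale0r.
by rewrite e hk in hi.
Qed.

(** The subdiagonal entries in columns 1 to 2n - 1 come from the units e_{i+1,i}, those in columns
    2n to 4n - 2 from their mirrors, which sit in column l = 4n - 1 - i and carry the sign of
    theta. *)
Lemma fmatE k l : fmat k l =
  if (k == l.+1) && (0 < l < (4 * n).-1)%N then phi l else 0.
Proof.
rewrite /fmat.
transitivity (\sum_(i <- iota 1 (2 * n - 1)) ((k == i.+1) && (l == i))%:R +
   \sum_(i <- iota 1 (2 * n - 1)) (if (k == l.+1) && (i == (4 * n).-1 - l)%N && (l < (4 * n).-1)%N then (-1) ^+ odd l else 0 : K)).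
  rewrite -big_split; apply: eq_big_seq => i /=; rewrite mem_iota => hi.
  rewrite FmE; congr (_ + _); rewrite /primeI.
  case: ifP => h.
    have [e1 e2] : k = (4 * n - i)%N /\ l = (4 * n - i.+1)%N by lia.
    rewrite e1 e2 !eqxx mulr1; congr (_ ^+ nat_of_bool _).
    have d j : (j <= 2 * n)%N -> deltaI n j = false.
      by move=> hj; rewrite /deltaI addn1 ltnNge hj andbF.
    rewrite /sF /pI !d; [|lia|lia]; rewrite oddB; last by lia.
    by rewrite oddM /=; case: (odd i).
  by case: eqP => [e1|_]; case: eqP => [e2|_]; rewrite ?mulr0 //; lia.
have -> : \sum_(i <- iota 1 (2 * n - 1)) ((k == i.+1) && (l == i))%:R =
   if (k == l.+1) && (0 < l < 2 * n)%N then 1 else 0 :> K.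
  have := big_iota1 1 (2 * n - 1) l (fun i => (k == i.+1)%:R : K^o).
  under eq_bigr => i _ do rewrite -[_ *: _]/(_ * _) -natrM mulnb andbC.
  move=> ->; case: eqP => [_|_] /=; last by rewrite if_same.
  by congr (if _ then _ else _); lia.
have -> : \sum_(i <- iota 1 (2 * n - 1)) (if (k == l.+1) && (i == (4 * n).-1 - l)%N && (l < (4 * n).-1)%N then (-1) ^+ odd l else 0) =
   if (k == l.+1) && (2 * n <= l < (4 * n).-1)%N then (-1) ^+ odd l else 0 :> K.
  case: (eqVneq k l.+1) => [_|_] /=; last by rewrite big1.
  case: (ltnP l (4 * n).-1) => hl; last by rewrite andbF big1 // => i _; rewrite andbF.
  have := big_iota1 1 (2 * n - 1) ((4 * n).-1 - l)%N (fun i => (-1) ^+ odd l : K^o).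
  move=> h; transitivity (if (0 < (4 * n).-1 - l < 1 + (2 * n - 1))%N then (-1) ^+ odd l else 0 : K).
    by rewrite -h; apply: eq_bigr => i _; rewrite andbT eq_sym; case: eqP; rewrite ?scale1r ?scale0r.
  by congr (if _ then _ else _); lia.
rewrite /phi; case: (eqVneq k l.+1) => [_|_] /=; last by rewrite addr0.
case: (ltnP l (2 * n)) => h1; case: (ltnP 0 l) => h2; case: (ltnP l (4 * n).-1) => h3 //=; rewrite ?addr0 ?add0r //; lia.
Qed.

Lemma fmat_odd : mhomo true fmat.
Proof.
move=> i j; rewrite fmatE; case: ifP => [/andP[/eqP -> _] _|_]; last by rewrite eqxx.
by rewrite /pI /=; case: (odd j).
Qed.

(* Normal form modulo J: bar e_kl with k < l becomes (f|e_kl), and its derivatives 0. *)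
Definition rhog (x : X3) : SV := let: (m, k, l) := x in
  if (k < l)%N then ((m == 0%N)%:R * ((-1) ^+ pI l * fmat l k))%:A else gen x.

Lemma compat_rhog : compat rhog.
Proof.
move=> [[m k] l] /=; case: ifP => h; last exact: homo_gen.
case: (eqVneq m 0%N) => [->|_]; last by rewrite mul0r scale0r; apply: homo0.
case: (eqVneq (fmat l k) 0) => [->|/fmat_odd e]; first by rewrite !mulr0 scale0r; apply: homo0.
have := homo_const (1 * ((-1) ^+ pI l * fmat l k)); congr (homo _ _).
by rewrite /par3 /= addbF (addbC (pI k)) e.
Qed.

Definition rho : SV -> SV := sHom rhog.
HB.instance Definition _ := GRing.Linear.copy rho rho.

Lemma rhoM u v : rho (u * v) = rho u * rho v. Proof. exact: HomM compat_rhog _ _. Qed.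
Lemma rhoC c : rho c%:A = c%:A. Proof. exact: HomC compat_rhog _. Qed.
Lemma rho_gen x : rho (gen x) = rhog x. Proof. exact: Hom_gen compat_rhog _. Qed.
Lemma rho_sgb b u : rho (sgb b u) = sgb b (rho u). Proof. exact: Hom_sgb compat_rhog _ _. Qed.
Lemma rho_D u : rho (D u) = D (rho u).
Proof.
apply: Hom_D; first exact: compat_rhog.
move=> [[m k] l] /=; case: ifP => h; last by rewrite D_gen.
by rewrite mul0r scale0r DC.
Qed.

Lemma rho_Fb_low m i j : i \in rng n -> j \in rng n -> (j <= i)%N -> rho (Fb m i j) = Fb m i j.
Proof.
move=> hi hj ji; rewrite FbE // linearD linearZ /= !rho_gen /= ltnNge ji /=.
by have -> : (pr j < pr i)%N = false by move: hi hj; rewrite !mem_rng /primeI; lia.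
Qed.

Lemma rho_bar_up m a : in_n n a ->
  rho (bar m a) = (if m == 0%N then Defs.form n fmat a else 0)%:A.
Proof.
move=> [c ec].
have low k l : k \in rng n -> l \in rng n -> (l <= k)%N -> a k l = 0.
  move=> hk hl lk; rewrite ec big_seq; apply: big1 => i hi; rewrite big_seq_cond; apply: big1 => j /andP[hj hij].
  rewrite FmE; have -> : (k == i) && (l == j) = false by lia.
  have -> : (k == pr j) && (l == pr i) = false by move: hi hj; rewrite !mem_rng /primeI; lia.
  by rewrite mulr0 addr0 mulr0.
have -> : Defs.form n fmat a = \sum_(k <- rng n) \sum_(l <- rng n) a k l * ((-1) ^+ pI l * fmat l k).
  rewrite exchange_big /=; apply: eq_bigr => l _; rewrite /matmul mulr_sumr.
  by apply: eq_bigr => k _; ring.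
rewrite barE linear_sum /=.
have -> : (if m == 0%N then \sum_(k <- rng n) \sum_(l <- rng n) a k l * ((-1) ^+ pI l * fmat l k) else 0)
   = \sum_(k <- rng n) \sum_(l <- rng n) a k l * ((m == 0%N)%:R * ((-1) ^+ pI l * fmat l k)).
  case: eqP => _; first by apply: eq_bigr => k _; apply: eq_bigr => l _; rewrite mul1r.
  by rewrite big1 // => k _; apply: big1 => l _; rewrite mul0r mulr0.
rewrite scaler_suml; apply: eq_big_seq => k hk; rewrite linear_sum scaler_suml.
apply: eq_big_seq => l hl; rewrite linearZ /= rho_gen /=.
case: ltnP => h; first by rewrite scalerA.
by rewrite low // mul0r !scale0r.
Qed.

Lemma rho_low u : salg (Gens lowS) u -> rho u = u.
Proof.
elim=> {u} [u [m [i [j [hi hj hij ->]]]]|c|u v _ hu _ hv|u v _ hu _ hv].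
- exact: rho_Fb_low.
- exact: rhoC.
- by rewrite linearD /= hu hv.
- by rewrite rhoM hu hv.
Qed.

Lemma inVsubP (S : nat -> nat -> bool) (v : V K) : inVsub n (in_span n S) v <-> salg (Gens S) (cl v).
Proof.
have := salg_lists (fun y : nat * mat K => bar y.1 y.2) (fun y => in_span n S y.2) (cl v).
set GG := fun u : SV => _.
have e : salg GG (cl v) <-> salg (Gens S) (cl v).
  split; apply: salg_le => u.
    by move=> [[m a] [/= h ->]]; apply: bar_span.
  move=> [m [i [j [hi hj hS ->]]]]; apply: salg_gen; exists (m, Fm K n i j); split=> //=.
  exact: Fm_span.
rewrite e => h; rewrite h {h e GG}.
have E (Q : seq (K * seq (nat * mat K))) :
  cl (flatten [seq fscale t.1 (Defs.fprod [seq barD n x.1 x.2 | x <- t.2]) | t <- Q]) =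
  \sum_(t <- Q) t.1 *: \prod_(x <- t.2) bar x.1 x.2.
  rewrite cl_flatten; apply: eq_bigr => t _; rewrite clZ cl_fprod.
  by rewrite big_map.
split=> [[Q [h1 h2]]|[Q [h1 h2]]]; exists Q; split=> //.
  by rewrite -E; apply/clP.
by apply/clP; rewrite E.
Qed.

(** A generator is written as an element minus its reduction, which covers the constant (f|a) and
    the zero constants of the derivatives uniformly. *)
Definition Jset (u : SV) := exists L : seq (SV * nat * mat K),
  (forall t, List.In t L -> salg (Gens allS) t.1.1 /\ in_n n t.2) /\
  u = \sum_(t <- L) t.1.1 * (bar t.1.2 t.2 - rho (bar t.1.2 t.2)).

Lemma inJ_Jset (v : V K) : inJ n v <-> Jset (cl v).
Proof.
have E (L : seq (V K * nat * mat K)) : (forall t, List.In t L -> in_n n t.2) ->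
   cl (flatten [seq fmul t.1.1 (fadd (barD n t.1.2 t.2)
                (cst (if t.1.2 == 0%N then - Defs.form n fmat t.2 else 0))) | t <- L]) =
   \sum_(t <- L) cl t.1.1 * (bar t.1.2 t.2 - rho (bar t.1.2 t.2)).
  elim: L => [|t L IH] h; first by rewrite big_nil.
  rewrite big_cons /= clD IH; last by move=> t' h'; apply: h; right.
  rewrite clM clD clC rho_bar_up; last by apply: h; left.
  congr (_ * (_ + _) + _); rewrite -scaleNr; congr (_ *: _).
  by case: eqP => //; rewrite oppr0.
split=> [[L [h1 h2]]|[L [h1 h2]]].
  exists [seq ((cl t.1.1, t.1.2), t.2) | t <- L]; split.
    by move=> t /List.in_map_iff [s [<- /h1 [/inVsubP hs hs']]].
  rewrite big_map /= -E; first by apply/clP.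
  by move=> t /h1 [].
exists [seq ((repr t.1.1, t.1.2), t.2) | t <- L]; split.
  move=> t /List.in_map_iff [s [<- /h1 [hs hs']]] /=; split=> //.
  by apply/inVsubP; rewrite cl_repr.
apply/clP; rewrite E; last by move=> t /List.in_map_iff [s [<- /h1 []]].
by rewrite big_map /= h2; apply: eq_bigr => t _; rewrite cl_repr.
Qed.

Lemma Jset0 : Jset 0.
Proof. by exists [::]; rewrite big_nil. Qed.
Lemma Jset_add u v : Jset u -> Jset v -> Jset (u + v).
Proof.
move=> [L [h1 ->]] [L' [h2 ->]]; exists (L ++ L'); rewrite big_cat; split=> //.
by move=> t /List.in_app_iff [h|h]; [apply: h1|apply: h2].
Qed.
Lemma Jset_mul u v : salg (Gens allS) u -> Jset v -> Jset (u * v).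
Proof.
move=> hu [L [h1 ->]]; exists [seq ((u * t.1.1, t.1.2), t.2) | t <- L]; split.
  by move=> t /List.in_map_iff [s [<- /h1 [hs hs']]] /=; split=> //; apply: salg_mul.
by rewrite big_map mulr_sumr; apply: eq_bigr => t _; rewrite mulrA.
Qed.

Lemma Jset_scale c u : Jset u -> Jset (c *: u).
Proof. by move=> h; rewrite -[u]mul1r scalerAl; apply: Jset_mul => //; apply: salg_const. Qed.

Lemma rho_V u : salg (Gens allS) u -> salg (Gens lowS) (rho u).
Proof.
apply: Hom_salg; first exact: compat_rhog.
move=> v [m [i [j [hi hj _ ->]]]]; rewrite -/rho; case: (leqP j i) => h.
  by rewrite rho_Fb_low //; apply: salg_gen; exists m, i, j.
by rewrite rho_bar_up; [apply: salg_const|apply: Fm_span].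
Qed.

(** J is presented by left multiples only. Carrying a right factor [r] makes the induction on
    products work, since a homogeneous generator can be moved past [r] at the price of a parity
    twist. *)
Lemma Jset_sub_rho_mul u r : salg (Gens allS) u -> salg (Gens allS) r -> Jset ((u - rho u) * r).
Proof.
move=> h; elim: h r => {u} [u [m [i [j [hi hj _ ->]]]]|c|u v _ hu _ hv|u v hu hu' hv hv'] r hr.
- have hF := homo_Fb K m hi hj.
  rewrite (homo_comm r (homoB hF (homo_Hom compat_rhog hF))) -/rho.
  apply: Jset_mul; first exact: Vsgb.
  case: (leqP j i) => h; first by rewrite rho_Fb_low // subrr; apply: Jset0.
  exists [:: ((1, m), Fm K n i j)]; rewrite big_seq1 mul1r; split=> // t [<-|//] /=.
  by split; [apply: salg1|apply: Fm_span].
- by rewrite rhoC subrr mul0r; apply: Jset0.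
- by rewrite linearD /= opprD addrACA mulrDl; apply: Jset_add; [apply: hu|apply: hv].
- rewrite rhoM; have -> : (u * v - rho u * rho v) * r = u * ((v - rho v) * r) + (u - rho u) * (rho v * r).
    by rewrite mulrBl mulrBl mulrBr mulrBl !mulrA addrA subrK.
  apply: Jset_add; first by apply: Jset_mul => //; apply: hv'.
  by apply: hu'; apply: salg_mul => //; apply: V_le (rho_V hv).
Qed.

(** Turns ideal membership into an equation: inside V(bar g), the ideal is the kernel of [rho]. *)
Lemma JsetP u : salg (Gens allS) u -> Jset u <-> rho u = 0.
Proof.
move=> hu; split=> [[L [hL ->]]|e]; last first.
  have := Jset_sub_rho_mul hu (salg1 _); rewrite e subr0 mulr1; exact.
elim: L hL => [|t L IH] hL; first by rewrite big_nil linear0.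
rewrite big_cons linearD /= IH; last by move=> t' h; apply: hL; right.
have [_ hn] : salg (Gens allS) t.1.1 /\ in_n n t.2 by apply: hL; left.
by rewrite rhoM linearB /= rho_bar_up // rhoC subrr mulr0 addr0.
Qed.

Lemma Jset_V u : Jset u -> salg (Gens allS) u.
Proof.
move=> [L [hL ->]]; elim: L hL => [|t L IH] hL; first by rewrite big_nil; apply: salg0.
rewrite big_cons; apply: salg_add; last by apply: IH => t' h; apply: hL; right.
have [ht hn] : salg (Gens allS) t.1.1 /\ in_n n t.2 by apply: hL; left.
apply: salg_mul => //; apply: salg_sub; last by rewrite rho_bar_up //; apply: salg_const.
by apply: V_le (bar_span t.1.2 hn).
Qed.

(** The defining condition of W, tested only on the F_ij that span n. *)
Definition killed u := forall i j k, i \in rng n -> j \in rng n -> (i < j)%N ->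
  rho (delt n (Fm K n i j) k u) = 0.

Lemma inWP (v : V K) : inW n v <-> salg (Gens lowS) (cl v) /\ killed (cl v).
Proof.
have ed a k : cl (chicoef (bracket n a v) k) = delt n a k (cl v) by exact: cchi_bracket.
split=> [[/inVsubP hv h]|[hv h]]; split=> //; try exact/inVsubP.
  move=> i j k hi hj ij; have /inJ_Jset : inJ n (chicoef (bracket n (Fm K n i j) v) k).
    by apply: h; apply: Fm_span.
  by rewrite ed => /[dup] /Jset_V /JsetP e /e.
move=> a [c ec] k; apply/inJ_Jset; rewrite ed (delt_lin _ k _ ec).
rewrite big_seq; elim/big_rec: _ => [|i x hi hx]; first exact: Jset0.
apply: Jset_add => //; rewrite big_seq_cond; elim/big_rec: _ => [|j y /andP[hj ij] hy]; first exact: Jset0.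
apply: Jset_add => //; apply: Jset_scale.
apply/JsetP; last exact: h.
apply: delt_V; [exact: mhomo_Fm hi hj|exact: oinv_Fm|].
by apply: V_le hv.
Qed.

End Reduction.

(** * Row determinants of Hessenberg operators *)

Section RowDeterminant.

Lemma big_lift_perm (M : zmodType) m (i0 j0 : 'I_m.+1) (F : 'S_m.+1 -> M) :
  \sum_(s : 'S_m.+1 | s i0 == j0) F s = \sum_(s : 'S_m) F (lift_perm i0 j0 s).
Proof.
have ne (s : 'S_m.+1) k : s i0 = j0 -> j0 != s (lift i0 k).
  by move=> <-; apply/eqP => /perm_inj e; have := neq_lift i0 k; rewrite {1}e eqxx.
pose t (s : 'S_m.+1) k := odflt k (unlift j0 (s (lift i0 k))).
have tK (s : 'S_m.+1) k : s i0 = j0 -> lift j0 (t s k) = s (lift i0 k).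
  by move=> e; rewrite /t; have [k' -> ->] := unlift_some (ne s k e).
have t_inj (s : 'S_m.+1) : s i0 = j0 -> injective (t s).
  move=> e k k' /(congr1 (lift j0)); rewrite !tK // => /perm_inj; exact: lift_inj.
pose inv (s : 'S_m.+1) : 'S_m :=
  if pselect (injective (t s)) is left h then perm h else 1%g.
rewrite (reindex (lift_perm i0 j0)) /=.
  by apply: eq_bigl => s; rewrite lift_perm_id eqxx.
exists inv => s; rewrite inE => /eqP e.
  rewrite /inv; case: pselect => [h|[]]; last exact: t_inj.
  by apply/permP => k; rewrite permE; apply: (@lift_inj _ j0); rewrite tK // lift_perm_lift.
rewrite /inv; case: pselect => [h|[]]; last exact: t_inj.
apply/permP => k; case: (unliftP i0 k) => [k'|] ->; rewrite ?lift_perm_id //.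
by rewrite lift_perm_lift permE tK.
Qed.

Variable G : zmodType.
Implicit Types (B : nat -> nat -> G -> G) (x p : G).

(* The coefficients of the Lax matrix do not commute, so its row determinant is
   handled as a sum of composites of operators, applied to a vector. *)
Definition opdet m B p : G :=
  \sum_(s : 'S_m) (foldr (fun i x => B (nat_of_ord i) (nat_of_ord (s i)) x) p (enum 'I_m)) *~ ((-1) ^+ odd_perm s).

Lemma eq_opdet m B B' p : (forall i j x, B i j x = B' i j x) -> opdet m B p = opdet m B' p.
Proof.
move=> h; apply: eq_bigr => s _; congr (_ *~ _).
by elim: (enum _) => //= i l ->.
Qed.

Lemma opdet0 B p : opdet 0 B p = p.
Proof.
rewrite /opdet (bigD1 1%g) //= odd_perm1 mulr1z big1 ?addr0 => [|s /eqP []].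
  by case e: (enum 'I_0) => [|i l] //; case: i e.
by apply/permP => -[].
Qed.

Lemma opdet1 B p : opdet 1 B p = B 0%N 0%N p.
Proof.
rewrite /opdet (bigD1 1%g) //= odd_perm1 mulr1z big1 ?addr0 => [|s /eqP []].
  by rewrite enum_ordSl /= perm1; case e: (enum 'I_0) => [|i l] //; case: i e.
by apply/permP => i; rewrite perm1 !ord1.
Qed.

Lemma opdet_col m B (Z : {additive G -> G}) p :
  (forall i j, {morph B i j : x y / x - y}) ->
  (forall i j x, B i j (Z x) = Z (B i j x)) ->
  (forall i x, B i.+2 0%N x = 0) -> (forall x, B 1%N 0%N x = - Z x) ->
  opdet m.+2 B p = B 0%N 0%N (opdet m.+1 (fun i j => B i.+1 j.+1) p) +
    Z (opdet m.+1 (fun i j => if i is i'.+1 then B i'.+2 j.+1 else B 0%N j.+1) p).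
Proof.
move=> hB hZ h2 h1.
have B0 i j : B i j 0 = 0 by rewrite -[0 in LHS](subrr 0) hB subrr.
have BN i j x : B i j (- x) = - B i j x by rewrite -sub0r hB B0 sub0r.
have BD i j x y : B i j (x + y) = B i j x + B i j y by rewrite -{1}[y]opprK hB BN opprK.
have Bz i j x (b : bool) : B i j (x *~ ((-1) ^+ b)) = B i j x *~ ((-1) ^+ b).
  by case: b; rewrite /= ?expr1 ?expr0 ?mulrNz ?mulr1z ?BN.
have Bsum i j (I : finType) (F : I -> G) : B i j (\sum_k F k) = \sum_k B i j (F k).
  by apply: (big_morph (B i j)); [apply: BD|apply: B0].
pose T (s : 'S_m.+2) := foldr (fun i x => B (nat_of_ord i) (nat_of_ord (s i)) x) p (enum 'I_m.+2).
rewrite /opdet -/T (partition_big (fun s : 'S_m.+2 => (s^-1)%g ord0) predT) //=.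
have eqs k (s : 'S_m.+2) : ((s^-1)%g ord0 == k) = (s k == ord0).
  by apply/eqP/eqP => [<-|e]; [rewrite permKV|rewrite -[X in (s^-1)%g X]e permK].
rewrite (bigD1 ord0) //= (bigD1 (lift ord0 ord0)) //= addrA [X in _ + X]big1 ?addr0; last first.
  move=> k /andP[k0 k1]; apply: big1 => s; rewrite eqs => /eqP sk.
  suff e : T s = 0 by rewrite -[X in X *~ _]/(T s) e mul0rz.
  rewrite /T; have : k \in enum 'I_m.+2 by rewrite mem_enum.
  elim: (enum _) => [//|i l IH]; rewrite inE /= => /orP[/eqP <-|/IH ->]; last exact: B0.
  by rewrite sk; case: k k0 k1 {sk IH} => [[|[|k]] hk] //=.
congr (_ + _).
  under eq_bigl => s do rewrite eqs.
  rewrite big_lift_perm Bsum; apply: eq_bigr => s _.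
  rewrite odd_lift_perm /= Bz; congr (_ *~ _).
  rewrite /T enum_ordSl /= lift_perm_id; congr (B _ _ _).
  rewrite foldr_map; elim: (enum 'I_m.+1) => //= i l ->.
  by rewrite lift_perm_lift !lift0.
under eq_bigl => s do rewrite eqs.
rewrite big_lift_perm raddf_sum; apply: eq_bigr => s _.
(* The sign of removing row 1 and column 0 is -1; it cancels the minus in -Z. *)
rewrite odd_lift_perm /= [Z (_ *~ _)](raddfMz Z) signrN mulrNz -mulNrz; congr (_ *~ _).
rewrite enum_ordSl /= enum_ordSl /= lift_perm_id h1 BN opprK hZ /=.
congr (Z _).
have e0 : lift_perm (lift ord0 ord0) ord0 s ord0 = lift ord0 (s ord0) :> 'I_m.+2.
  rewrite -(lift_perm_lift (lift ord0 ord0) ord0 s ord0); congr (lift_perm _ _ _ _).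
  exact: val_inj.
have e1 l : lift_perm (lift ord0 ord0) ord0 s (lift ord0 (lift ord0 l)) = lift ord0 (s (lift ord0 l)) :> 'I_m.+2.
  rewrite -(lift_perm_lift (lift ord0 ord0) ord0 s (lift ord0 l)); congr (lift_perm _ _ _ _).
  exact: val_inj.
rewrite e0 !lift0; congr (B _ _ _).
rewrite !foldr_map; move: (Finite.enum _) => L.
by elim: L => [//|i l IH]; rewrite [LHS]/= IH e1 !lift0.
Qed.
End RowDeterminant.

Section Hessenberg.
Variables (S : nzRingType) (G : lmodType S) (N : nat) (A : nat -> nat -> G -> G) (z : nat -> S) (p : G).
Hypothesis A_sub : forall i j, {morph A i j : x y / x - y}.
Hypothesis A_comm : forall i j k x, A i j (z k *: x) = z k *: A i j x.
Hypothesis A_zero : forall i j x, (j.+1 < i)%N -> A i j x = 0.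
Hypothesis A_sdiag : forall i x, A i.+1 i x = - (z i *: x).

Definition tail_det i := opdet (N.+1 - i) (fun r c => A (i + r) (i + c)) p.
Definition top_det (a : nat -> G -> G) i :=
  opdet (N.+1 - i) (fun r c => if r is r'.+1 then A (i + r'.+1) (i + c) else a (i + c)%N) p.

(** The second minor of a column expansion has its old top row above later rows, so it is no
    trailing minor. Allowing an arbitrary top row [a] makes the family closed under expansion. *)
Lemma top_det_sum (a : nat -> G -> G) i :
  (forall j, {morph a j : x y / x - y}) -> (forall j k x, a j (z k *: x) = z k *: a j x) ->
  (i <= N)%N ->
  top_det a i = \sum_(i <= j < N.+1) (\prod_(i <= k < j) z k) *: a j (tail_det j.+1).
Proof.
move=> ha hz; move e: (N - i)%N => m; elim: m i e => [|m IH] i e hi.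
  have -> : i = N by lia.
  rewrite big_nat1 big_geq // scale1r /top_det subSnn opdet1 addn0 /tail_det subnn opdet0.
  by [].
rewrite big_ltn; last by lia.
rewrite big_geq // scale1r /top_det.
have -> : (N.+1 - i = m.+2)%N by lia.
rewrite (@opdet_col _ _ _ (GRing.scale (z i))) /=; first last.
- by move=> x; rewrite addn1 addn0 A_sdiag.
- by move=> i' x; apply: A_zero; lia.
- by case=> [|i'] j x /=; rewrite ?hz ?A_comm.
- by case=> [|i'] j x y /=; rewrite ?ha ?A_sub.
rewrite addn0; congr (_ + _).
  rewrite /tail_det (_ : N.+1 - i.+1 = m.+1)%N; last by lia.
  by congr (a i _); apply: eq_opdet => r c x; rewrite !addnS !addSn.
have := IH i.+1; rewrite /top_det (_ : N.+1 - i.+1 = m.+1)%N; last by lia.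
move=> IH'; transitivity (z i *: (\sum_(i.+1 <= j < N.+1) (\prod_(i.+1 <= k < j) z k) *: a j (tail_det j.+1))).
  rewrite -IH'; [|lia|lia]; congr (_ *: _); apply: eq_opdet => [[|r]] c x; rewrite ?addnS ?addSn //.
rewrite scaler_sumr; apply: eq_big_nat => j /andP[hj _].
by rewrite scalerA [in RHS]big_ltn.
Qed.

Lemma tail_det_sum i : (i <= N)%N ->
  tail_det i = \sum_(i <= j < N.+1) (\prod_(i <= k < j) z k) *: A i j (tail_det j.+1).
Proof.
move=> hi; rewrite -top_det_sum //.
by apply: eq_opdet => [[|r]] c x; rewrite ?addn0.
Qed.

Lemma tail_det_end : tail_det N.+1 = p.
Proof. by rewrite /tail_det subnn opdet0. Qed.

End Hessenberg.

(** * The Lax matrix acting on polynomials in D *)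

Section LaxOperator.
Variable K : numFieldType.
Variable n : nat.
Hypothesis n_gt0 : (0 < n)%N.
Local Notation SV := (SV K).
Local Notation bar := (@bar K n).
Local Notation fmat := (fmat K n).
Local Notation phi := (phi K n).
Local Notation N := (Nd n).
Implicit Types (u v : SV) (w : seq X3) (p : {poly SV}).

(* Left multiplication by D on V[D], whose elements are polynomials in D with
   coefficients on the left. *)
Definition nabla p : {poly SV} := map_poly (@D K) p + map_poly (@sg K) p * 'X.

Lemma coef_nabla p k : (nabla p)`_k = D p`_k + pre (fun j => sg p`_j) k.
Proof.
rewrite coefD coefMX !coef_map /=; congr (_ + _).
by case: k => [|k] //=; rewrite coef_map.
Qed.

Lemma nabla_sub : {morph nabla : p q / p - q}.
Proof.
move=> p q; apply/polyP => k; rewrite coefB !coef_nabla coefB linearB /= opprD [RHS]addrACA.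
by congr (_ + _); case: k => [|k] /=; rewrite ?subr0 // coefB linearB.
Qed.
HB.instance Definition _ := GRing.isZmodMorphism.Build {poly SV} {poly SV} nabla nabla_sub.
Local Opaque nabla.

Definition mono (c : SV) i : {poly SV} := c *: 'X^i.

Lemma coefXnZ (c : SV) i k : (mono c i)`_k = if i == k then c else 0.
Proof. by rewrite /mono coefZ coefXn eq_sym; case: eqP; rewrite ?mulr1 ?mulr0. Qed.

Lemma nablaXn (c : SV) i : nabla (mono c i) = mono (D c) i + mono (sg c) i.+1.
Proof.
apply/polyP => k; rewrite coef_nabla coefD !coefXnZ; congr (_ + _).
  by case: eqP => // _; rewrite D0.
by case: k => [|k] //=; rewrite coefXnZ eqSS; case: eqP => // _; rewrite linear0.
Qed.

Lemma nablaMXn p b : nabla (p * 'X^b) = nabla p * 'X^b.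
Proof.
apply/polyP => k; rewrite coef_nabla !coefMXn coef_nabla.
case: (ltnP k b) => h.
  rewrite D0 add0r; case: k h => [|k] //= h; rewrite coefMXn (ltn_trans _ h) ?linear0 //.
congr (_ + _); case: k h => [|k] /= h; first by rewrite ?sub0n.
rewrite coefMXn; case: (ltnP k b) => h'.
  have -> : (k.+1 - b = 0)%N by lia.
  by rewrite linear0.
by rewrite subSn.
Qed.

Definition gl (P : VD K) : {poly SV} := \sum_(t <- P) mono (cl t.2) t.1.

Lemma coef_gl P k : (gl P)`_k = cl (dcoef P k).
Proof.
rewrite coef_sum cl_flatten big_filter [RHS]big_mkcond; apply: eq_bigr => t _.
by rewrite coefXnZ.
Qed.

Lemma gl_cat P Q : gl (P ++ Q) = gl P + gl Q. Proof. exact: big_cat. Qed.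

Lemma gl_flatten (I : Type) (s : seq I) (F : I -> VD K) :
  gl (flatten [seq F i | i <- s]) = \sum_(i <- s) gl (F i).
Proof. by elim: s => [|i s IH]; rewrite ?big_nil ?big_cons /= ?gl_cat ?IH // /gl big_nil. Qed.

Lemma gl_Dop P : gl (Dop P) = nabla (gl P).
Proof.
rewrite gl_flatten raddf_sum; apply: eq_bigr => t _ /=.
by rewrite nablaXn /gl big_cons big_seq1 /= cl_DV cl_fsignpar.
Qed.

Lemma gl_iter k P : gl (iter k (@Dop K) P) = iter k nabla (gl P).
Proof. by elim: k => //= k <-; rewrite gl_Dop. Qed.

(** A left factor acts on the polynomial of the right factor through [nabla], which commutes with
    multiplication by D^b on the right. This turns a row-ordered product into a composite of
    operators. *)
Lemma gl_opmul (A B : VD K) : gl (opmul A B) = \sum_(a <- A) cl a.2 *: iter a.1 nabla (gl B).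
Proof.
rewrite gl_flatten; apply: eq_bigr => a _; rewrite gl_flatten.
have itD k (I : Type) (s : seq I) (F : I -> {poly SV}) :
    iter k nabla (\sum_(i <- s) F i) = \sum_(i <- s) iter k nabla (F i).
  by elim: k => //= k ->; rewrite raddf_sum.
rewrite [gl B in RHS]/gl itD scaler_sumr; apply: eq_bigr => b _.
transitivity (cl a.2 *: (gl (iter a.1 (@Dop K) [:: (0%N, b.2)]) * 'X^(b.1))).
  rewrite /gl big_map mulr_suml scaler_sumr; apply: eq_bigr => s _ /=.
  by rewrite /mono clM exprD -scalerAl scalerA.
congr (_ *: _); rewrite gl_iter /gl big_seq1 /=.
have -> : mono (cl b.2) b.1 = mono (cl b.2) 0 * 'X^(b.1) by rewrite /mono expr0 -scalerAl mul1r.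
by elim: (a.1) => //= k <-; rewrite nablaMXn.
Qed.

Definition q (i j : nat) : SV := bar 0 (Emat K n j i).

Definition opA (i j : nat) p : {poly SV} :=
  if i == j then nabla p + q i j *: p
  else if (i < j)%N then q i j *: p else (- fmat i j)%:A *: p.

Lemma gl_Aent i j B : gl (opmul (Aent K n i j) B) = opA i j (gl B).
Proof.
rewrite gl_opmul /opA /Aent; case: eqP => [->|_].
  by rewrite big_cons big_seq1 /= clC !scale1r.
by case: ifP => _; rewrite big_seq1 //= clC.
Qed.

Lemma signZ (b : bool) p : ((-1) ^+ b : K)%:A *: p = p *~ ((-1) ^+ b).
Proof. by case: b; rewrite /= ?expr1 ?expr0 ?scaleN1r ?scale1r ?mulrNz ?mulr1z ?scaleN1r ?scale1r. Qed.

Lemma glZ c P : gl [seq (t.1, fscale c t.2) | t <- P] = c%:A *: gl P.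
Proof.
rewrite /gl big_map scaler_sumr; apply: eq_bigr => t _ /=.
by rewrite /mono clZ scalerA -scalerAl mul1r.
Qed.

Lemma gl_rdet : gl (rdet K n) = opdet N (fun i j => opA i.+1 j.+1) 1.
Proof.
rewrite /rdet gl_flatten /opdet big_enum_cond /=.
apply: eq_big => [s|s _]; first by rewrite inE.
rewrite glZ signZ; congr (_ *~ _).
elim: (enum 'I_N) => [|i l IH] /=; last by rewrite gl_Aent IH.
by rewrite /gl big_seq1 /= /mono expr0 scale1r.
Qed.

Lemma constAZ (c : K) (u : SV) : u * c%:A = c%:A * u.
Proof. by rewrite -scalerAr -scalerAl mulr1 mul1r. Qed.

Lemma nablaC (c : K) p : nabla (c%:A *: p) = c%:A *: nabla p.
Proof.
apply/polyP => k; rewrite coefZ !coef_nabla coefZ mulrDr -!scalerAl !mul1r DZ; congr (_ + _).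
case: k => [|k] /=; first by rewrite scaler0.
by rewrite coefZ -scalerAl mul1r linearZ.
Qed.

Lemma opA_sub i j : {morph opA i j : x y / x - y}.
Proof.
move=> x y; rewrite /opA; case: eqP => _; last by case: ifP; rewrite scalerBr.
by rewrite nabla_sub scalerBr [- (nabla y + _)]opprD addrACA.
Qed.
Lemma opA_comm i j (c : K) x : opA i j (c%:A *: x) = c%:A *: opA i j x.
Proof.
rewrite /opA; case: eqP => _.
  by rewrite nablaC [in RHS]scalerDr !scalerA constAZ.
by case: ifP => _; rewrite !scalerA constAZ.
Qed.
Lemma opA_zero i j x : (j.+1 < i)%N -> opA i j x = 0.
Proof.
move=> h; rewrite /opA gtn_eqF; last by lia.
have -> : (i < j)%N = false by lia.
rewrite fmatE; have -> : (i == j.+1) = false by lia.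
by rewrite oppr0 !scale0r.
Qed.

Definition zz (k : nat) : K := fmat k.+1 k.
Lemma opA_sdiag i x : opA i.+1 i x = - ((zz i)%:A *: x).
Proof.
rewrite /opA gtn_eqF //; have -> : (i.+1 < i)%N = false by lia.
by rewrite -/(zz i) !scaleNr.
Qed.

Definition dd i := tail_det N opA (1 : {poly SV}) i.
Definition PP i j : K := \prod_(i <= k < j) phi k.
(* The trailing minors of the Lax matrix, normalised by products of entries of f so
   that they are the coordinates of a vector v with A v = v_0 e_1; v_0 is the row
   determinant up to sign. *)
Definition vv i : {poly SV} := (PP i N)%:A *: dd i.+1.

Lemma PP_sq i j : PP i j * PP i j = 1.
Proof. by rewrite /PP -big_split; apply: big1 => k _; apply: phi_sq. Qed.

Lemma PP_geq i j : (j <= i)%N -> PP i j = 1.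
Proof. exact: big_geq. Qed.

Lemma PP_ltn i j : (i < j)%N -> PP i j = phi i * PP i.+1 j.
Proof. exact: big_ltn. Qed.

Lemma PP_cat i k j : (i <= k)%N -> (k <= j)%N -> PP i j = PP i k * PP k j.
Proof. exact: big_cat_nat. Qed.

Lemma PP_neq0 i j : PP i j != 0.
Proof. by apply/eqP => e; have := PP_sq i j; rewrite e mul0r => /eqP; rewrite eq_sym oner_eq0. Qed.

Lemma vv_N : vv N = 1.
Proof. by rewrite /vv /PP big_geq // scale1r scale1r /dd tail_det_end. Qed.

Lemma alg_prod (F : nat -> K) i j : \prod_(i <= k < j) (F k)%:A = (\prod_(i <= k < j) F k)%:A :> SV.
Proof.
by elim/big_rec2: _ => [|k x y _ ->]; rewrite ?scale1r // -scalerAl mul1r scalerA.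
Qed.

Lemma dd_sum i : (0 < i <= N)%N -> dd i = \sum_(i <= j < N.+1) (PP i j)%:A *: opA i j (dd j.+1).
Proof.
move=> /andP[h0 hi]; rewrite /dd (tail_det_sum (z := fun k => (zz k)%:A)) //; first last.
- exact: opA_sdiag.
- exact: opA_zero.
- by move=> *; apply: opA_comm.
- exact: opA_sub.
apply: eq_big_nat => j /andP[hij hj]; rewrite alg_prod; congr (_%:A *: _).
apply: eq_big_nat => k /andP[hk1 hk2]; rewrite /zz fmatE eqxx /=.
have -> // : (0 < k < (4 * n).-1)%N by move: hk2 hj; rewrite /Nd; lia.
Qed.

(** Row i of the system solved for v_{i-1}, whose coefficient is -phi_{i-1}. The normalising
    products square to 1, so those produced by the determinant expansion cancel; the convention
    phi_0 = 1 covers row 1. *)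
Lemma vv_rec i : (0 < i <= N)%N ->
  vv i.-1 = (phi i.-1)%:A *: (nabla (vv i) + \sum_(i <= j < N.+1) q i j *: vv j).
Proof.
case: i => // i hi; rewrite /= {1}/vv dd_sum // scaler_sumr.
transitivity ((phi i)%:A *: \sum_(i.+1 <= j < N.+1) opA i.+1 j (vv j)).
  rewrite scaler_sumr; apply: eq_big_nat => j /andP[h1 h2].
  rewrite /vv opA_comm !scalerA -!scalerAl !mul1r !scalerA; congr (_%:A *: _).
  rewrite (@PP_ltn i N); last by lia.
  rewrite (@PP_cat i.+1 j N); [|lia|lia].
  have -> : phi i * (PP i.+1 j * PP j N) * PP i.+1 j = phi i * PP j N * (PP i.+1 j * PP i.+1 j) by ring.
  by rewrite PP_sq mulr1.
congr (_ *: _).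
have hN : (i.+1 < N.+1)%N by lia.
rewrite [in LHS](big_ltn hN).
have -> : \sum_(i.+1 <= j < N.+1) q i.+1 j *: vv j =
  q i.+1 i.+1 *: vv i.+1 + \sum_(i.+2 <= j < N.+1) q i.+1 j *: vv j by exact: big_ltn.
rewrite {1}/opA eqxx -addrA; congr (_ + (_ + _)).
apply: eq_big_nat => j /andP[h1 h2]; rewrite /opA ltn_eqF // h1.
by [].
Qed.

Lemma rdet_vv : gl (rdet K n) = (PP 0 N)%:A *: vv 0.
Proof.
rewrite gl_rdet /vv scalerA -scalerAl mul1r scalerA PP_sq scale1r scale1r /dd /tail_det.
rewrite subSS subn0; apply: eq_opdet => i j x.
by rewrite !add1n.
Qed.

Lemma cl_wt t : cl (wt K n t) = PP 0 N *: (vv 0)`_(N - t).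
Proof. by rewrite /wt -coef_gl rdet_vv coefZ -scalerAl mul1r. Qed.

End LaxOperator.

(** * Gauge invariance *)

Section GaugeInvariance.
Variable K : numFieldType.
Variable n : nat.
Hypothesis n_gt0 : (0 < n)%N.
Local Notation SV := (SV K).
Local Notation pr := (primeI n).
Local Notation Fb := (Fb K n).
Local Notation Gens := (@Gens K n).
Local Notation bar := (@bar K n).
Local Notation fmat := (fmat K n).
Local Notation phi := (phi K n).
Local Notation lowS := (fun i j : nat => (j <= i)%N).
Local Notation N := (Nd n).
Local Notation q := (@q K n).
Local Notation rho := (@rho K n).
Local Notation vv := (@vv K n).
Implicit Types (u v : SV) (w : seq X3) (p : {poly SV}).

Lemma rngN i : (i \in rng n) = (0 < i <= N)%N.
Proof. rewrite mem_rng /Nd; lia. Qed.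

Lemma big_rng (M : zmodType) (F : nat -> M) : \sum_(j <- rng n) F j = \sum_(1 <= j < N.+1) F j.
Proof. by rewrite /rng /index_iota subSS subn0. Qed.

Lemma qE i j : i \in rng n -> j \in rng n -> q i j = (2%:R^-1 * (-1) ^+ pI j) *: Fb 0 j i.
Proof.
move=> hi hj; rewrite /q /Fb !barE scaler_sumr; apply: eq_bigr => k _.
by rewrite scaler_sumr; apply: eq_bigr => l _; rewrite scalerA.
Qed.

Lemma Fbq i j : i \in rng n -> j \in rng n -> Fb 0 j i = (2%:R * (-1) ^+ pI j) *: q i j.
Proof.
move=> hi hj; rewrite qE // scalerA.
have -> : 2%:R * (-1) ^+ pI j * (2%:R^-1 * (-1) ^+ pI j) = (2%:R / 2%:R) * ((-1) ^+ pI j * (-1) ^+ pI j) :> K by ring.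
by rewrite -expr2 sqrr_sign divff ?two_neq0 // mulr1 scale1r.
Qed.

Lemma homo_q i j : i \in rng n -> j \in rng n -> homo (~~ (pI i (+) pI j)) (q i j).
Proof.
move=> hi hj; rewrite qE //; apply: homoZ; have := homo_Fb K 0 hj hi; congr (homo _ _).
by rewrite /par3 /=; case: (pI i) (pI j) => [] [].
Qed.

Lemma low_q i j : i \in rng n -> j \in rng n -> (i <= j)%N -> salg (Gens lowS) (q i j).
Proof. by move=> hi hj ij; rewrite qE //; apply/salg_scale/salg_gen; exists 0%N, j, i. Qed.

Definition Q i j : SV := if (i <= j)%N then q i j else (- fmat i j)%:A.

Lemma oinv_fmat : oinv n fmat.
Proof.
move=> k l hk hl; rewrite /Defs.fmat mulr_sumr; apply: eq_big_seq => i; rewrite mem_iota => hi.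
by apply: oinv_Fm => //; rewrite mem_rng; lia.
Qed.

(** For i > j, bar E_ji lies in bar n and reduces to (f|E_ji) = -f_ij. Thus modulo J the entries of
    the Lax matrix below the diagonal obey the same formula as those above, which makes the action
    of bar a a supercommutator of full matrices. *)
Lemma rho_q i j : i \in rng n -> j \in rng n -> rho (q i j) = Q i j.
Proof.
move=> hi hj; rewrite /Q qE // linearZ /=; case: leqP => h; first by rewrite rho_Fb_low.
rewrite FbE // linearD linearZ /= !rho_gen /= h.
have -> : (pr i < pr j)%N by move: hi hj; rewrite !mem_rng /primeI; lia.
rewrite !mul1r scalerA -scalerDl scalerA; congr (_ *: _).
rewrite pI_prime // oinv_fmat // (sign_sF_sym K n i j).
case: (eqVneq (fmat i j) 0) => [->|/fmat_odd e]; first by rewrite !(mulr0, addr0, oppr0).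
have := sqrr_sign K (sF n i j); rewrite expr2.
set s := (-1) ^+ sF n i j => s2.
have -> : s * ((-1) ^+ pI i * (-1) ^+ pI j) * ((-1) ^+ pI j * (s * fmat i j)) =
  (s * s) * ((-1) ^+ pI i * fmat i j) * ((-1) ^+ pI j) ^+ 2 by ring.
rewrite s2 sqrr_sign mul1r mulr1.
have -> : 2%:R^-1 * (-1) ^+ pI j * ((-1) ^+ pI i * fmat i j + (-1) ^+ pI i * fmat i j) =
  (2%:R^-1 * 2%:R) * ((-1) ^+ pI i * (-1) ^+ pI j) * fmat i j by ring.
by rewrite -signr_addb e mulVf ?two_neq0 // mul1r expr1 mulN1r.
Qed.

Lemma down_ind (P : nat -> Prop) :
  P N -> (forall i, (i < N)%N -> (forall j, (i < j <= N)%N -> P j) -> P i) ->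
  forall i, (i <= N)%N -> P i.
Proof.
move=> hN hs i hi; have [d] := ubnP (N - i)%N; elim: d i hi => // d IH i hi hd.
case: (ltnP i N) => h; last by have -> : i = N by lia.
by apply: hs => // j /andP[h1 h2]; apply: IH; lia.
Qed.

Lemma coef_vv i m : (i < N)%N -> (vv i)`_m = phi i *:
  (D (vv i.+1)`_m + pre (fun k => sg (vv i.+1)`_k) m +
    \sum_(i.+1 <= j < N.+1) q i.+1 j * (vv j)`_m).
Proof.
move=> hi; have := @vv_rec K n n_gt0 i.+1 hi; rewrite /= => ->.
rewrite coefZ -scalerAl mul1r coefD coef_nabla coef_sum; congr (_ *: (_ + _)).
by apply: eq_bigr => j _; rewrite coefZ.
Qed.

Lemma low_vv i m : (i <= N)%N -> salg (Gens lowS) (vv i)`_m.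
Proof.
move=> hi; elim/down_ind: hi m => [|i' hi IH] m.
  by rewrite vv_N coef1; case: eqP => _; [apply: salg1|apply: salg0].
rewrite coef_vv //; apply: salg_scale; apply: salg_add; first apply: salg_add.
- by apply: V_D; apply: IH; lia.
- case: m => [|m] /=; first exact: salg0.
  by apply: (Vsgb true); apply: IH; lia.
rewrite big_nat_cond; apply: salg_sum => j _ /andP[/andP[h1 h2] _]; apply: salg_mul.
  by apply: low_q; rewrite ?rngN; lia.
by apply: IH; lia.
Qed.

Lemma Q_zero i j : (j.+1 < i)%N -> Q i j = 0.
Proof.
move=> h; rewrite /Q leqNgt ltnW //= fmatE; have -> : (i == j.+1) = false by lia.
by rewrite oppr0 scale0r.
Qed.

Lemma Q_sub i : (0 < i < N)%N -> Q i.+1 i = (- phi i)%:A.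
Proof.
move=> h; rewrite /Q ltnn fmatE eqxx /=.
by have -> : (0 < i < (4 * n).-1)%N by move: h; rewrite /Nd; lia.
Qed.

(* Row i of the linear system A v = v_0 e_1. *)
Lemma row_system i m : i \in rng n ->
  D (vv i)`_m + pre (fun k => sg (vv i)`_k) m + \sum_(j <- rng n) Q i j * (vv j)`_m =
  if i == 1%N then (vv 0)`_m else 0.
Proof.
rewrite rngN; case: i => [//|i] /andP[_ hi]; rewrite big_rng (big_cat_nat (n := i.+1)) //=; last by lia.
have -> : \sum_(i.+1 <= j < N.+1) Q i.+1 j * (vv j)`_m = \sum_(i.+1 <= j < N.+1) q i.+1 j * (vv j)`_m.
  by apply: eq_big_nat => j /andP[h _]; rewrite /Q h.
have := coef_vv m hi; set R := _ + \sum_(_ <= _ < _) _ => e.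
have eR : R = phi i *: (vv i)`_m by rewrite e scalerA phi_sq scale1r.
rewrite addrCA -/R eR eqSS; case: i hi {R e eR} => [|i] hi.
  by rewrite big_geq // add0r (phi0 K n_gt0) scale1r.
rewrite big_nat_recr //= Q_sub ?hi // big1_seq ?add0r.
  by rewrite scaleNr mulNr -scalerAl mul1r addNr.
by move=> j; rewrite mem_index_iota => /andP[_ /andP[h1 h2]]; rewrite Q_zero ?mul0r //; lia.
Qed.

Section Invariance.
Variables (i0 j0 : nat) (hi0 : i0 \in rng n) (hj0 : j0 \in rng n) (hij : (i0 < j0)%N).
Local Notation a := (Fm K n i0 j0).
Local Notation b := (pI i0 (+) pI j0).

Let ha : mhomo b a := mhomo_Fm hi0 hj0.
Let hinv : oinv n a := oinv_Fm K hi0 hj0.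

Lemma Fm_up i j : i \in rng n -> j \in rng n -> (j <= i)%N -> a i j = 0.
Proof.
move=> hi hj ij; rewrite FmE; have -> : (i == i0) && (j == j0) = false by lia.
have -> : (i == pr j0) && (j == pr i0) = false.
  by move: hi0 hj0 hij; rewrite !mem_rng /primeI; lia.
by rewrite mulr0 addr0.
Qed.

(* The chi^k-coefficient of the bracket with bar a, reduced modulo J. *)
Definition dl k u := rho (delt n a k u).

Lemma dl_linear k : linear (dl k).
Proof. by move=> c u v; rewrite /dl !linearP. Qed.
HB.instance Definition _ k := GRing.isLinear.Build K SV SV _ (dl k) (dl_linear k).

Lemma dlM k u v : dl k (u * v) = dl k u * rho v + sgb (b (+) odd k) (rho u) * dl k v.
Proof. by rewrite /dl (deltM _ ha) linearD /= !rhoM rho_sgb. Qed.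

Lemma dl_D k u : dl k (D u) = (-1) ^+ (b (+) odd k) *: (D (dl k u) - pre (fun k' => dl k' u) k).
Proof.
rewrite /dl (delt_D _ ha) linearZ linearB /= rho_D; congr (_ *: (_ - _)).
by case: k => [|k] //=; rewrite linear0.
Qed.

Lemma dl_sg k u : dl k (sg u) = (-1) ^+ (b (+) odd k) *: sg (dl k u).
Proof.
have := delt_sgb n ha k true u; rewrite /dl /= andbT => ->.
by rewrite linearZ /= (rho_sgb n true).
Qed.

Lemma dlC k c : dl k c%:A = 0.
Proof. by rewrite /dl deltC linear0. Qed.

(** The chi^0 part of the variation of the Lax matrix: its supercommutator with a, reduced modulo
    J. *)
Lemma dlq0 i j : i \in rng n -> j \in rng n -> dl 0 (q i j) =
  (-1) ^+ (b && (pI i (+) pI j)) *: \sum_(r <- rng n) a r j *: Q i r -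
  (-1) ^+ b *: \sum_(r <- rng n) a i r *: Q r j.
Proof.
move=> hi hj; rewrite qE // /dl linearZ linearZ /= (delt_Fb0 ha hinv) //.
rewrite linearZ linearB /= [rho (_ *: _)]linearZ /=.
have e1 : rho (\sum_(r <- rng n) a r j *: Fb 0 r i) =
    (2%:R * (-1) ^+ b * (-1) ^+ pI j) *: \sum_(r <- rng n) a r j *: Q i r.
  rewrite linear_sum scaler_sumr; apply: eq_big_seq => r hr; rewrite Fbq // linearZ linearZ /= rho_q // !scalerA.
  congr (_ *: _); case: (eqVneq (a r j) 0) => [->|/ha <-]; first by rewrite mul0r mulr0.
  by case: (pI r) (pI j) => [] [] /=; ring.
have e2 : rho (\sum_(r <- rng n) a i r *: Fb 0 j r) =
    (2%:R * (-1) ^+ pI j) *: \sum_(r <- rng n) a i r *: Q r j.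
  rewrite linear_sum scaler_sumr; apply: eq_big_seq => r hr; rewrite Fbq // linearZ linearZ /= rho_q // !scalerA.
  by congr (_ *: _); ring.
rewrite e1 e2 !scalerBr !scalerA (addbC (pI j)).
have s2 := sqrr_sign K (pI j); have t2 : 2%:R^-1 * 2%:R = 1 :> K by rewrite mulVf ?two_neq0.
move: s2 t2; rewrite expr2; set s := (-1) ^+ pI j; set h := _^-1; set t := 2%:R => s2 t2.
congr (_ *: _ - _ *: _).
  transitivity ((h * t) * (s * s) * ((-1) ^+ (b && ~~ (pI i (+) pI j)) * (-1) ^+ b)); first by ring.
  by rewrite t2 s2 !mul1r -signr_addb; case: (b) (pI i (+) pI j) => [] [].
transitivity ((h * t) * (s * s) * ((-1) ^+ (b && ~~ (pI i (+) pI j)) * (-1) ^+ (b && (pI i (+) pI j)))).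
  by ring.
by rewrite t2 s2 !mul1r -signr_addb; case: (b) (pI i (+) pI j) => [] [].
Qed.

Lemma dlq1 i j : i \in rng n -> j \in rng n -> dl 1 (q i j) = ((-1) ^+ b * a i j)%:A.
Proof.
move=> hi hj; rewrite qE // /dl linearZ linearZ /= (delt_Fb1 hinv) // rhoC scalerA.
congr (_ *: _); have t2 : 2%:R^-1 * 2%:R = 1 :> K by rewrite mulVf ?two_neq0.
have -> : 2%:R^-1 * (-1) ^+ pI j * (2 * (-1) ^+ pI i * a i j) =
   (2%:R^-1 * 2%:R) * ((-1) ^+ pI i * (-1) ^+ pI j * a i j) by ring.
rewrite t2 mul1r -signr_addb.
by case: (eqVneq (a i j) 0) => [->|/ha ->]; rewrite ?mulr0.
Qed.

Lemma dlq2 i j k : i \in rng n -> j \in rng n -> dl k.+2 (q i j) = 0.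
Proof.
by move=> hi hj; rewrite qE // /dl linearZ linearZ /= delt_Fb2 // linear0 scaler0.
Qed.

(** Under the gauge action v varies by -a v in the rows i > 0, while v_0 does not vary. The
    vanishing of positive powers of chi is proved jointly, because sesquilinearity links chi^k to
    chi^(k-1). *)
Lemma dl_vv i : (i <= N)%N -> (forall m, dl 0 (vv i)`_m =
    - (if i == 0%N then 0 else \sum_(j <- rng n) a i j *: (vv j)`_m)) /\
  (forall m k, dl k.+1 (vv i)`_m = 0).
Proof.
move=> hi; elim/down_ind: hi => [|{}i hi IH].
  have dc k m : dl k (vv N)`_m = 0.
    rewrite vv_N coef1; case: eqP => _; last by rewrite linear0.
    by rewrite -[1%:R]scale1r dlC.
  split=> [m|m k]; rewrite dc //; have -> : (N == 0%N) = false by rewrite /Nd; lia.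
  have hNN : N \in rng n by rewrite rngN leqnn andbT /Nd; lia.
  rewrite big_seq big1 ?oppr0 // => j hj; rewrite Fm_up ?scale0r //.
  by move: hj; rewrite rngN => /andP[].
have hi1 : i.+1 \in rng n by rewrite rngN.
have rv j m : (j <= N)%N -> rho (vv j)`_m = (vv j)`_m by move=> hj; apply/rho_low/low_vv.
have [d0 d1] := IH i.+1 (introT andP (conj (leqnn _) hi)).
have dlqv k j m : (i < j <= N)%N -> dl k (q i.+1 j * (vv j)`_m) =
    dl k (q i.+1 j) * (vv j)`_m + (-1) ^+ ((b (+) odd k) && ~~ (pI i.+1 (+) pI j)) *: (q i.+1 j * dl k (vv j)`_m).
  move=> h; have hj : j \in rng n by rewrite rngN; lia.
  rewrite dlM rv; last by lia.
  rewrite rho_low; last by apply: low_q => //; lia.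
  by rewrite (homo_sgb _ (homo_q hi1 hj)) -scalerAl.
have dpre k m : dl k (pre (fun k => sg (vv i.+1)`_k) m) =
    (-1) ^+ (b (+) odd k) *: pre (fun k' => sg (dl k (vv i.+1)`_k')) m.
  by case: m => [|m] /=; rewrite ?linear0 ?scaler0 // dl_sg.
split=> m; last first.
  move=> k; rewrite coef_vv // linearZ linearD linearD /= dl_D dpre d1 D0 linear_sum /=.
  have -> : pre (fun k' => sg (dl k.+1 (vv i.+1)`_k')) m = 0.
    by case: m => [|m] //=; rewrite d1 linear0.
  rewrite scaler0 addr0 sub0r.
  have e : \sum_(i.+1 <= j < N.+1) dl k.+1 (q i.+1 j * (vv j)`_m) =
      \sum_(i.+1 <= j < N.+1) dl k.+1 (q i.+1 j) * (vv j)`_m.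
    apply: eq_big_nat => j hj; rewrite dlqv //.
    by have [_ ->] := IH j hj; rewrite mulr0 scaler0 addr0.
  rewrite e; case: k e => [|k] _; last first.
    rewrite /= d1 oppr0 scaler0 add0r big1_seq ?scaler0 // => j.
    by rewrite mem_index_iota => /andP[_ hj]; rewrite dlq2 ?mul0r ?rngN //; lia.
  (* At chi^1 the index shift from D contributes row i + 1 of a v, and the chi-terms of the [q]
     contribute the same with opposite sign. *)
  rewrite /= d0 /= opprK.
  have -> : \sum_(i.+1 <= j < N.+1) dl 1 (q i.+1 j) * (vv j)`_m =
     (-1) ^+ b *: \sum_(j <- rng n) a i.+1 j *: (vv j)`_m.
    rewrite big_rng [in RHS](big_cat_nat (n := i.+1)) //=; last by lia.
    rewrite [X in _ *: (X + _)]big1_seq ?add0r; last first.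
      by move=> j; rewrite mem_index_iota => /andP[_ hj]; rewrite Fm_up ?scale0r ?rngN //; lia.
    rewrite scaler_sumr; apply: eq_big_nat => j hj; rewrite dlq1 ?rngN //; last by lia.
    by rewrite -scalerAl mul1r scalerA.
  by rewrite addbT signrN scaleNr addNr scaler0.
pose S j k := \sum_(l <- rng n) a j l *: (vv l)`_k.
pose ep j := (-1) ^+ (b && ~~ (pI i.+1 (+) pI j)) : K.
pose X j := (-1) ^+ (b && (pI i.+1 (+) pI j)) *: \sum_(r <- rng n) a r j *: Q i.+1 r -
  (-1) ^+ b *: \sum_(r <- rng n) a i.+1 r *: Q r j.
(* [Q] vanishes below its subdiagonal and a is strictly upper triangular, so their commutator
   vanishes below the diagonal. The sum over j > i may then be extended to all columns. *)
have X0 j : (0 < j <= i)%N -> X j = 0.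
  move=> hj; rewrite /X !big_seq !big1 ?scaler0 ?subr0 // => r hr.
    case: (leqP r i.+1) => h; first by rewrite Fm_up // scale0r.
    by rewrite Q_zero ?scaler0 //; lia.
  case: (ltnP r j) => h; first by rewrite Q_zero ?scaler0 //; lia.
  by rewrite Fm_up ?scale0r // rngN; lia.
have d0' k : dl 0 (vv i.+1)`_k = - S i.+1 k by exact: d0.
rewrite coef_vv // linearZ linearD linearD /= dl_D dpre /= subr0 addbF d0'.
have -> : pre (fun k' => sg (dl 0 (vv i.+1)`_k')) m = - \sum_(l <- rng n) a i.+1 l *: pre (fun k => sg (vv l)`_k) m.
  case: m => [|m] /=; first by rewrite big1 ?oppr0 // => l _; rewrite scaler0.
  rewrite d0' [sg (- _)]linearN /S linear_sum /=; congr (- _).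
  by apply: eq_bigr => l _; rewrite linearZ.
have -> : D (- S i.+1 m) = - \sum_(l <- rng n) a i.+1 l *: D (vv l)`_m.
  rewrite [D (- _)]linearN /S linear_sum /=; congr (- _).
  by apply: eq_bigr => l _; rewrite DZ.
(* The row system replaces the D-terms by Q v. Row 1, the only inhomogeneous one, is not met, since
   the first column of a is zero. *)
have T1 : (-1) ^+ b *: (- \sum_(l <- rng n) a i.+1 l *: D (vv l)`_m) +
   (-1) ^+ b *: (- \sum_(l <- rng n) a i.+1 l *: pre (fun k => sg (vv l)`_k) m) =
   (-1) ^+ b *: \sum_(l <- rng n) a i.+1 l *: \sum_(j <- rng n) Q l j * (vv j)`_m.
  rewrite -scalerDr -opprD -big_split -scaleN1r scaler_sumr /=; congr (_ *: _).
  apply: eq_big_seq => l hl; rewrite -scalerDr scaleN1r -scalerN.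
  case: (eqVneq l 1%N) => [e|ne].
    by rewrite e Fm_up ?scale0r //; move: hl; rewrite e.
  have := row_system m hl; rewrite (negbTE ne) => /eqP; rewrite addr_eq0 => /eqP ->.
  by rewrite opprK.
rewrite T1 [dl 0 (\sum_(_ <= _ < _) _)]linear_sum /=.
have -> : \sum_(i.+1 <= j < N.+1) dl 0 (q i.+1 j * (vv j)`_m) =
   \sum_(i.+1 <= j < N.+1) X j * (vv j)`_m - \sum_(i.+1 <= j < N.+1) ep j *: (Q i.+1 j * S j m).
  rewrite -sumrB; apply: eq_big_nat => j hj; have hjr : j \in rng n by rewrite rngN; lia.
  rewrite dlqv // addbF; have [-> _] := IH j hj; have -> : (j == 0%N) = false by lia.
  rewrite mulrN scalerN dlq0 //; congr (_ * _ - _ *: (_ * _)).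
  by rewrite /Q; case/andP: hj => ->.
have -> : \sum_(i.+1 <= j < N.+1) X j * (vv j)`_m = \sum_(j <- rng n) X j * (vv j)`_m.
  rewrite big_rng [in RHS](big_cat_nat (n := i.+1)) //=; last by lia.
  rewrite [X in _ = X + _]big1_seq ?add0r // => j.
  by rewrite mem_index_iota => /andP[_ hj]; rewrite X0 ?mul0r //; lia.
have -> : \sum_(j <- rng n) X j * (vv j)`_m = \sum_(r <- rng n) ep r *: (Q i.+1 r * S r m) -
    (-1) ^+ b *: \sum_(l <- rng n) a i.+1 l *: \sum_(j <- rng n) Q l j * (vv j)`_m.
  rewrite /X; under eq_bigr => j _ do rewrite mulrBl -!scalerAl !mulr_suml.
  rewrite sumrB; congr (_ - _); last first.
    rewrite -scaler_sumr exchange_big; congr (_ *: _); apply: eq_bigr => l _ /=.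
    by rewrite scaler_sumr; apply: eq_bigr => j _; rewrite scalerAl.
  under eq_bigr => j _ do rewrite scaler_sumr.
  rewrite exchange_big; apply: eq_bigr => r _ /=; rewrite /S mulr_sumr scaler_sumr.
  apply: eq_bigr => j _; rewrite -scalerAl -scalerAr !scalerA; congr (_ *: _).
  case: (eqVneq (a r j) 0) => [->|/ha e]; first by rewrite !mulr0.
  congr (_ * _); rewrite /ep -e; congr (_ ^+ nat_of_bool _).
  by rewrite /=; case: (pI i) (pI r) (pI j) => [] [] [].
have aux (x y z : SV) : x + (y - x - z) = y - z by rewrite addrA [x + _]addrC subrK.
rewrite aux big_rng (big_cat_nat (n := i.+1)) //=; last by lia.
(* What remains is the part of Q (a v) from columns 1 to i. For i = 0 it is empty; otherwise only
   the subdiagonal entry survives, and the outer factor [phi] cancels it up to sign. *)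
rewrite addrK; case: i hi @ep {X0 IH hi1 d0 d1 dlqv dpre d0' T1 X} => [|i] hi ep.
  by rewrite big_geq // scaler0 oppr0.
rewrite big_nat_recr //= big1_seq ?add0r; last first.
  by move=> j; rewrite mem_index_iota => /andP[_ hj]; rewrite Q_zero ?mul0r ?scaler0 //; lia.
have -> : ep i.+1 = 1 by rewrite /ep [pI i.+2]/= [pI i.+1]/=; case: (pI i); rewrite andbF.
rewrite Q_sub ?hi // scale1r -scalerAl mul1r scalerA mulrN phi_sq scaleN1r.
by [].
Qed.

Lemma dl_vv0 k m : dl k (vv 0)`_m = 0.
Proof.
have [h0 h1] := dl_vv (leq0n N).
by case: k => [|k]; rewrite ?h1 // h0 oppr0.
Qed.
End Invariance.

Lemma killed_wt t : killed n (cl (wt K n t)).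
Proof.
move=> i j k hi hj hij; rewrite cl_wt // linearZ linearZ /=.
by rewrite -[rho _]/(dl i j k _) dl_vv0 // scaler0.
Qed.

Lemma low_wt t : salg (Gens lowS) (cl (wt K n t)).
Proof. by rewrite cl_wt //; apply/salg_scale/low_vv. Qed.

Theorem wt_in_W t : inW n (wt K n t).
Proof. by apply/inWP; split; [apply: low_wt|apply: killed_wt]. Qed.
End GaugeInvariance.

(** * Leading terms *)

Section LeadingTerms.
Variable K : numFieldType.
Variable n : nat.
Hypothesis n_gt0 : (0 < n)%N.
Local Notation SV := (SV K).
Local Notation pr := (primeI n).
Local Notation Fb := (Fb K n).
Local Notation Gens := (@Gens K n).
Local Notation phi := (phi K n).
Local Notation N := (Nd n).
Local Notation q := (@q K n).
Local Notation vv := (@vv K n).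
Local Notation PP := (@PP K n).
Implicit Types (u v : SV) (w : seq X3) (p : {poly SV}).

Definition level_below s (i j : nat) : bool := (j <= i)%N && (i - j < s)%N.
(* The root vectors F_ij and F_{j'i'} are proportional.  A lowering pair (i, j) is
   plain if it is the representative chosen as a coordinate to be eliminated, and
   special if F_ij is the leading term of some w_t modulo the plain ones. *)
Definition plain_pair (i j : nat) : bool :=
  (j <= i)%N && ((i + j < (4 * n).-1)%N || (i + j == (4 * n).-1) && odd j).
Definition plain_below s (i j : nat) : bool := level_below s i j || plain_pair i j && (i - j == s)%N.

Lemma q_Lev s i j : i \in rng n -> j \in rng n -> (i <= j)%N -> (j - i < s)%N ->
  salg (Gens (level_below s)) (q i j).
Proof.
move=> hi hj ij h; rewrite qE //; apply/salg_scale/salg_gen; exists 0%N, j, i.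
by rewrite /level_below ij h.
Qed.

Lemma Lev_le s s' u : (s <= s')%N -> salg (Gens (level_below s)) u -> salg (Gens (level_below s')) u.
Proof. by move=> h; apply: V_le => i j /andP[h1 h2]; rewrite /level_below h1 (leq_trans h2 h). Qed.

Lemma homo_vv i m : (i <= N)%N -> homo (odd (N + i + m)) (vv i)`_m.
Proof.
move=> hi; elim/(down_ind n_gt0): hi m => [|i' hi IH] m.
  rewrite vv_N coef1 addnn oddD odd_double /=; case: eqP => [->|_]; [exact: homo1|exact: homo0].
rewrite coef_vv //; apply/homoZ/homoD; first apply: homoD.
- have h : (i' < i'.+1 <= N)%N by rewrite leqnn.
  by have := homo_D (IH i'.+1 h m); rewrite addnS /= negbK.
- case: m => [|m] /=; first exact: homo0.
  have h : (i' < i'.+1 <= N)%N by rewrite leqnn.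
  by have := homo_sg true (IH i'.+1 h m); rewrite !addnS /= ?addSn /=.
rewrite big_nat; apply: homo_sum => j hj.
have hi1 : i'.+1 \in rng n by rewrite rngN.
have hj1 : j \in rng n by rewrite rngN; lia.
have := homoM (homo_q K hi1 hj1) (IH j hj m); congr (homo _ _).
by rewrite !oddD /pI /=; case: (odd i') (odd j) (odd N) (odd m) => [] [] [] [].
Qed.

Lemma vv_big i m : (i <= N)%N -> (N - i < m)%N -> (vv i)`_m = 0.
Proof.
move=> hi; elim/(down_ind n_gt0): hi m => [|i' hi IH] m hm.
  by rewrite vv_N coef1; case: eqP hm => [->|//]; rewrite subnn.
rewrite coef_vv // IH ?D0; [|lia|lia].
have -> : pre (fun k => sg (vv i'.+1)`_k) m = 0.
  by case: m hm => [|m] //= hm; rewrite IH ?linear0 //; lia.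
rewrite big_nat big1 ?addr0 ?scaler0 // => j hj; rewrite IH ?mulr0 //; lia.
Qed.

(** Weight count: with D of weight 1 and q_ij of weight j - i + 1, this coefficient has weight N - i
    - m, so only levels below that number occur. *)
Lemma vv_Lev i m : (i <= N)%N -> (m <= N - i)%N -> salg (Gens (level_below (N - i - m))) (vv i)`_m.
Proof.
move=> hi; elim/(down_ind n_gt0): hi m => [|i' hi IH] m hm.
  by rewrite vv_N coef1; case: eqP => _; [apply: salg1|apply: salg0].
rewrite coef_vv //; apply/salg_scale/salg_add; first apply: salg_add.
- apply: V_D; case: (leqP m (N - i'.+1)) => h; last first.
    by rewrite vv_big //; apply: salg0.
  apply: (@Lev_le (N - i'.+1 - m)); first by lia.
  by apply: IH => //; lia.
- case: m hm => [|m] hm /=; first exact: salg0.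
  apply: (Vsgb true); apply: (@Lev_le (N - i'.+1 - m)); first by lia.
  by apply: IH; lia.
rewrite big_nat; apply: salg_sum => j _ hj.
case: (leqP m (N - j)) => h; last by rewrite vv_big ?mulr0 //; [apply: salg0|lia].
apply: salg_mul; first by apply: q_Lev; rewrite ?rngN; lia.
apply: (@Lev_le (N - j - m)); first by lia.
by apply: IH => //; lia.
Qed.

Lemma vv_top i : (i <= N)%N -> (vv i)`_(N - i) = (PP i N)%:A.
Proof.
move=> hi; elim/(down_ind n_gt0): hi => [|i' hi IH].
  by rewrite subnn vv_N coef1 PP_geq // scale1r.
rewrite coef_vv // vv_big ?D0 //; last by lia.
have -> : (N - i' = (N - i'.+1).+1)%N by lia.
rewrite /= IH ?leqnn // linearZ /= sg1 add0r big_nat big1 ?addr0; last first.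
  by move=> j hj; rewrite vv_big ?mulr0 //; lia.
by rewrite scalerA -PP_ltn.
Qed.

(** The factor with which q_{j,j+s} enters a coefficient of v_i: the products of entries of f before
    and after it, and the sign of moving D past an element of parity s + 1 once for each of the j -
    i - 1 rows in between. *)
Definition beta s i j : K := PP i j * (-1) ^+ ((j - i.+1) * s.+1) * PP (j + s) N.

(** Only two terms of the recursion reach level s: the undifferentiated shift of v_{i+1}, and
    q_{i+1,i+1+s} times the constant top coefficient of v_{i+1+s}. *)
Lemma vv_lead s i : (i + s < N)%N ->
  salg (Gens (level_below s)) ((vv i)`_(N - i - s.+1) -
    \sum_(i.+1 <= j < (N - s).+1) beta s i j *: q j (j + s)).
Proof.
move=> hs; have hi : (i <= N)%N by lia.
elim/(down_ind n_gt0): hi hs => [|i' hi IH] hs; first by lia.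
set m := (N - i' - s.+1)%N.
have hjs : (i'.+1 + s <= N)%N by lia.
have r1 : i'.+1 \in rng n by rewrite rngN.
have r2 : (i'.+1 + s)%N \in rng n by rewrite rngN; lia.
(* Before the index i' + 1 + s all factors have lower level; after it the coefficient of v_j
   vanishes by degree. *)
rewrite coef_vv // (big_cat_nat (n := (i'.+1 + s)%N)) /=; [|lia|lia].
have hb : (i'.+1 + s < N.+1)%N by lia.
rewrite [\sum_(i'.+1 + s <= _ < N.+1) _](big_ltn hb).
have -> : m = (N - (i'.+1 + s))%N by rewrite /m; lia.
rewrite vv_top // [\sum_((i'.+1 + s).+1 <= _ < N.+1) _]big_nat [X in q _ _ * _ + X]big1 ?addr0; last first.
  by move=> j hj; rewrite vv_big ?mulr0 //; lia.
have -> : (N - (i'.+1 + s))%N = m by rewrite /m; lia.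
rewrite [in X in _ - X]big_ltn; last by lia.
have -> : beta s i' i'.+1 = phi i' * PP (i'.+1 + s) N.
  by rewrite /beta subnn mul0n expr0 mulr1 PP_ltn // (@PP_geq K n i'.+1) // mulr1.
rewrite -scalerAr mulr1 !scalerDr scalerA.
set A := phi i' *: D _; set B := phi i' *: pre _ _; set C := phi i' *: \sum_(_ <= _ < _) _.
set E := _ *: q _ _; set F := \sum_(_ <= _ < _) _.
have -> : A + B + (C + E) - (E + F) = A + C + (B - F).
  by rewrite opprD [RHS]addrA !addrA [LHS](ACl (1*3*2*6*4*5)) /= addrK.
apply: salg_add; first apply: salg_add.
- apply/salg_scale/V_D/(@Lev_le (N - i'.+1 - m)); first by rewrite /m; lia.
  by apply: vv_Lev => //; rewrite /m; lia.
- apply: salg_scale; rewrite big_nat; apply: salg_sum => j _ /andP[h1 h2].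
  apply: salg_mul; first by apply: q_Lev; rewrite ?rngN; lia.
  apply: (@Lev_le (N - j - m)); first by rewrite /m; lia.
  by apply: vv_Lev; rewrite /m; lia.
rewrite /B /F; case em: m => [|m'] /=.
  rewrite scaler0 sub0r big_geq ?oppr0; first exact: salg0.
  by move: em; rewrite /m; lia.
have hs' : (i'.+1 + s < N)%N by move: em; rewrite /m; lia.
have h1 : (i' < i'.+1 <= N)%N by rewrite leqnn.
have := salg_scale (phi i') (Vsgb true (IH i'.+1 h1 hs')).
have -> : (N - i'.+1 - s.+1)%N = m' by move: em; rewrite /m; lia.
rewrite /= linearB /= scalerBr linear_sum scaler_sumr; congr (salg _ (_ - _)).
apply: eq_big_nat => j hj; have rj : j \in rng n by rewrite rngN; lia.
have rjs : (j + s)%N \in rng n by rewrite rngN; lia.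
have hq := homo_q K rj rjs; rewrite linearZ /= hq !scalerA; congr (_ *: _).
rewrite /beta (@PP_ltn K n i' j); last by lia.
have -> : ~~ (pI j (+) pI (j + s)) = odd s.+1.
  by rewrite /pI oddD /=; case: (odd j) (odd s) => [] [].
have -> : (j - i'.+1 = (j - i'.+2).+1)%N by lia.
by rewrite mulSn exprD -[(-1) ^+ s.+1 in RHS]signr_odd; ring.
Qed.

Lemma Fb_anti m i : i \in rng n -> ~~ odd i -> Fb m (pr i) i = 0.
Proof.
move=> hi oi; rewrite FbE ?prime_rng // primeK //.
have -> : sF n (pr i) i = true.
  by rewrite /sF deltaI_prime // pI_prime // /pI (negbTE oi) /deltaI (negbTE oi).
by rewrite expr1 scaleN1r subrr.
Qed.

(* Off the middle of the diagonal k - l = s, a root vector or its mirror image is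
   an ordinary (non-special) representative. *)
Lemma Fb_Lo s j : (0 < j)%N -> (j + s <= N)%N ->
  (2 * j + s < (4 * n).-1)%N || (4 * n + 1 < 2 * j + s)%N -> salg (Gens (plain_below s)) (Fb 0 (j + s) j).
Proof.
move=> h0 hj h.
have rj : j \in rng n by rewrite rngN; lia.
have rjs : (j + s)%N \in rng n by rewrite rngN; lia.
have lo i k : i \in rng n -> k \in rng n -> (i + k < (4 * n).-1)%N -> i = (k + s)%N -> salg (Gens (plain_below s)) (Fb 0 i k).
  move=> hi hk h1 h2; apply: salg_gen; exists 0%N, i, k; split=> //.
  apply/orP; right; rewrite /plain_pair h1 /=; lia.
case/orP: h => h; first by apply: lo => //; lia.
have -> : Fb 0 (j + s) j = (-1) ^+ sF n (j + s) j *: Fb 0 (pr j) (pr (j + s)).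
  by rewrite Fb_prime // scalerA -signr_addb addbb scale1r.
apply/salg_scale/lo; rewrite ?prime_rng // /primeI; move: hj; rewrite /Nd; lia.
Qed.

(** With t = k - l + 1, the first alternative gives t = 4n - 2l + 1 with l odd, so t = 3 mod 4; the
    second gives t = 4n - 2l with l even, so t = 0 mod 4. *)
Definition special_pair (k l : nat) : bool :=
  (l <= k)%N && ((k + l == 4 * n) && odd l || (k + l == (4 * n).-1) && ~~ odd l).

Lemma wt_sum s : (s < N)%N -> salg (Gens (level_below s)) (cl (wt K n s.+1) -
  \sum_(1 <= j < (N - s).+1) (PP 0 N * beta s 0 j) *: q j (j + s)).
Proof.
move=> hs; rewrite cl_wt //; have := salg_scale (PP 0 N) (@vv_lead s 0 hs).
rewrite subn0 scalerBr scaler_sumr; congr (salg _ (_ - _)).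
by apply: eq_bigr => j _; rewrite scalerA.
Qed.

Lemma Lev_Lo s u : salg (Gens (level_below s)) u -> salg (Gens (plain_below s)) u.
Proof. by apply: V_le => i j h; rewrite /plain_below h. Qed.

Lemma q_Lo s j : (0 < j)%N -> (j + s <= N)%N ->
  (2 * j + s < (4 * n).-1)%N || (4 * n + 1 < 2 * j + s)%N -> salg (Gens (plain_below s)) (q j (j + s)).
Proof.
by move=> h0 hj h; rewrite qE ?rngN; first (by apply/salg_scale/Fb_Lo); lia.
Qed.

Lemma beta_neq0 s i j : beta s i j != 0.
Proof. by rewrite /beta !mulf_neq0 ?PP_neq0 // expf_neq0 // oppr_eq0 oner_neq0. Qed.

(** Among the linear terms q_{j,j+s}, only those with 2j + s between 4n - 1 and 4n + 1 are not plain
    up to mirror: one term if k + l = 4n, two if k + l = 4n - 1. *)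
Lemma wt_special k l : k \in rng n -> l \in rng n -> special_pair k l ->
  exists2 c : K, c != 0 & salg (Gens (plain_below (k - l))) (cl (wt K n (k - l).+1) - c *: Fb 0 k l).
Proof.
move=> hk hl /andP[lk hsp]; have := hk; have := hl; rewrite !(rngN n_gt0) => /andP[l0 lN] /andP[k0 kN].
have := @wt_sum (k - l) _; set s := (k - l)%N => /(_ ltac:(rewrite /s; lia)) hw.
have ek : (l + s = k)%N by rewrite /s; lia.
pose c0 j := PP 0 N * beta s 0 j.
have c0n j : c0 j != 0 by rewrite mulf_neq0 ?PP_neq0 ?beta_neq0.
have hlr : l \in index_iota 1 (N - s).+1 by rewrite mem_index_iota; move: ek lN kN; rewrite /Nd; lia.
have n2 : 2%:R^-1 != 0 :> K by rewrite invr_neq0 ?two_neq0.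
have key c : salg (Gens (plain_below s)) (\sum_(1 <= j < (N - s).+1) c0 j *: q j (j + s) - c *: Fb 0 k l) ->
   salg (Gens (plain_below s)) (cl (wt K n s.+1) - c *: Fb 0 k l).
  move=> h; have -> : cl (wt K n s.+1) - c *: Fb 0 k l =
    (cl (wt K n s.+1) - \sum_(1 <= j < (N - s).+1) c0 j *: q j (j + s)) +
    (\sum_(1 <= j < (N - s).+1) c0 j *: q j (j + s) - c *: Fb 0 k l) by rewrite addrA subrK.
  by apply: salg_add => //; apply: Lev_Lo.
have sum_rest (P : pred nat) x y : (0 < x)%N -> (y <= (N - s).+1)%N -> (forall j, (x <= j < y)%N -> P j ->
     (2 * j + s < (4 * n).-1)%N || (4 * n + 1 < 2 * j + s)%N) ->
   salg (Gens (plain_below s)) (\sum_(x <= j < y | P j) c0 j *: q j (j + s)).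
  move=> hx hy hP; apply: salg_sum => j; rewrite mem_index_iota => hj Pj; apply/salg_scale/q_Lo; try lia.
  by apply: hP => //; lia.
case/orP: hsp => /andP[/eqP hs ol].
  exists (c0 l * (2%:R^-1 * (-1) ^+ pI k)).
    by rewrite mulf_neq0 ?c0n // mulf_neq0 ?signr_eq0.
  apply: key; rewrite (bigD1_seq l) ?iota_uniq //= ek qE // scalerA addrAC subrr add0r.
  by apply: sum_rest => // j h1 jl; lia.
(* The middle terms j = l and j = l + 1 are mirror images. Since phi_l = 1 and phi_k = -1, the
   coefficient changes sign between them, and for this reason the two contributions add up instead
   of cancelling. *)
have rl1 : l.+1 \in rng n by rewrite (rngN n_gt0); move: hs; rewrite /Nd; lia.
have rk1 : k.+1 \in rng n by rewrite (rngN n_gt0); move: l0 hs; rewrite /Nd; lia.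
have pk : pr k = l.+1 by rewrite /primeI; lia.
have pl : pr l = k.+1 by rewrite /primeI; lia.
exists (- (c0 l * 1)); first by rewrite oppr_eq0 mulr1.
apply: key; rewrite (big_cat_nat (n := l)) /=; [|lia|lia].
have h1 : (l < (N - s).+1)%N by lia.
have h2 : (l.+1 < (N - s).+1)%N by move: hs ek; rewrite /Nd; lia.
rewrite [\sum_(l <= _ < _) _](big_ltn h1) [\sum_(l.+1 <= _ < _) _](big_ltn h2) addSn ek.
set A := \sum_(_ <= _ < l) _; set B := \sum_(_ <= _ < _) _.
have ok : odd k by lia.
have kn : (2 * n + 1 <= k)%N by lia.
have -> : c0 l.+1 *: q l.+1 k.+1 = (- c0 l * 2%:R^-1) *: Fb 0 k l.
  rewrite qE // -pk -pl Fb_prime // !scalerA; congr (_ *: _).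
  rewrite pI_prime // pk.
  have -> : sF n k l = false by rewrite /sF /deltaI /pI (negbTE ol) andbF ok kn.
  rewrite /pI (negbTE ol) !expr0 !mulr1; congr (_ * _).
  have e1 x : (-1) ^+ (x * s.+1) = 1 :> K.
    rewrite -signr_odd oddM; have -> : odd s.+1 = false by lia.
    by rewrite andbF.
  have kN1 : (k < N)%N by move: rk1; rewrite (rngN n_gt0) => /andP[].
  rewrite /c0 /beta !e1 !mulr1 addSn ek (@PP_ltn K n k N) // (@PP_cat K n 0 l l.+1) //.
  rewrite (@PP_ltn K n l l.+1) // (@PP_geq K n l.+1 l.+1) // mulr1.
  have -> : phi l = 1 by apply: phi_lt; lia.
  have -> : phi k = -1 by rewrite phi_ge ?ok //; lia.
  by ring.
have hA : salg (Gens (plain_below s)) A by apply: sum_rest => // [|j hj _]; lia.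
have hB : salg (Gens (plain_below s)) B by apply: sum_rest => // j hj _; lia.
have -> : A + (c0 l *: q l k + ((- c0 l / 2) *: Fb 0 k l + B)) - - (c0 l * 1) *: Fb 0 k l = A + B.
  rewrite qE // /pI ok expr1 scalerA scaleNr opprK [_ *: _ + (_ + B)]addrA -scalerDl.
  have -> : c0 l * (2^-1 * -1) + - c0 l / 2 = - c0 l * (2%:R^-1 * 2%:R) by ring.
  have aux (x y z : SV) : x + (- y + z) + y = x + z by rewrite -addrA [- y + z]addrC subrK.
  by rewrite mulVf ?two_neq0 // !mulr1 scaleNr aux.
exact: salg_add.
Qed.
End LeadingTerms.

(** * Partial derivatives and removal of variables in characteristic 0 *)

Section Elimination.
Variable K : numFieldType.
Local Notation SV := (SV K).
Local Notation gen := (gen K).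
Local Notation word := (word K).
Implicit Types (u v : SV) (w : seq X3) (Z Y : pred X3).

Definition LG Z u := exists x, Z x /\ u = gen x.

Lemma LG_list Z u : salg (LG Z) u <-> exists L : V K, all (fun t => all Z t.2) L /\ u = cl L.
Proof.
rewrite (salg_lists gen (fun x => Z x)); split=> [[Q [hQ ->]]|[L [hL ->]]].
  exists Q; split; last by rewrite cl_words; apply: eq_bigr => t _; rewrite wordE.
  apply/allP => t ht; apply/allP => x hx; apply: (hQ t).
    by elim: Q ht {hQ} => [//|s Q IH]; rewrite inE => /orP[/eqP ->|/IH]; [left|right].
  by elim: t.2 hx => [//|y s IH]; rewrite inE => /orP[/eqP ->|/IH]; [left|right].
exists L; split; last by rewrite cl_words; apply: eq_bigr => t _; rewrite wordE.
move=> t x ht hx.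
have : all Z t.2.
  by elim: L hL ht => [//|s L IH] /= /andP[h1 h2] [<- //|]; apply: IH.
by elim: t.2 hx => [//|y s IH] /= [<-|/IH h] /andP[h1 h2] //; apply: h.
Qed.

Definition pd x : SV -> SV := Der gen (fun y => (y == x)%:R%:A) (par3 x).
HB.instance Definition _ x := GRing.Linear.copy (pd x) (pd x).

Lemma homo_pd x y : homo (par3 y (+) par3 x) ((y == x)%:R%:A : SV).
Proof.
case: eqP => [->|_]; last by rewrite scale0r; apply: homo0.
by rewrite addbb; apply: homo_const.
Qed.

Lemma pdM x u v : pd x (u * v) = pd x u * v + sgb (par3 x) u * pd x v.
Proof. by rewrite /pd (DerM (compat_gen K) (homo_pd x)) !Hom_id. Qed.
Lemma pd_gen x y : pd x (gen y) = (y == x)%:R%:A.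
Proof. exact: (Der_gen (compat_gen K) (homo_pd x)). Qed.
Lemma pdC x c : pd x c%:A = 0.
Proof. exact: (DerC (compat_gen K) (homo_pd x)). Qed.

Lemma pd_LG Z x u : salg (LG Z) u -> salg (LG Z) (pd x u).
Proof.
elim=> {u} [u [y [_ ->]]|c|u v _ hu _ hv|u v hu hu' hv hv'].
- by rewrite pd_gen; apply: salg_const.
- by rewrite pdC; apply: salg0.
- by rewrite linearD; apply: salg_add.
- rewrite pdM; apply: salg_add; apply: salg_mul => //.
  case: (par3 x) => //=; apply: salg_sg => // w [y [hy ->]].
  by rewrite (homo_gen K y); apply/salg_scale/salg_gen; exists y.
Qed.

Lemma euler x w : gen x * pd x (word w) = (count_mem x w)%:R *: word w.
Proof.
elim: w => [|y w IH]; first by rewrite word_nil -[1]scale1r pdC mulr0 scale0r.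
rewrite word_cons pdM pd_gen mulrDr (homo_sgb _ (homo_gen K y)) -[count_mem _ _]/(_ + _)%N.
rewrite natrD scalerDl; congr (_ + _).
  by rewrite /=; case: eqP => [->|_]; rewrite ?(scale1r, scale0r, mul1r, mul0r, mulr0).
rewrite -scalerAl -scalerAr mulrA (gen_swap K x y) -scalerAl scalerA andbC -signr_addb addbb.
by rewrite scale1r -mulrA IH -scalerAr.
Qed.

Lemma elimination Z Y u : salg (LG Z) u -> (forall x, Y x -> pd x u = 0) ->
  salg (LG (fun x => Z x && ~~ Y x)) u.
Proof.
move=> /LG_list [L [hL ->]] h; apply/LG_list.
exists [seq t <- L | all (fun x => ~~ Y x) t.2]; split.
  apply/allP => t; rewrite mem_filter => /andP[h1 h2].
  by rewrite all_predI (allP hL _ h2) h1.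
have zero mu x : Y x -> x \in mu -> coef par3 lt3 L mu = 0.
  move=> hx hxmu; pose L' := [seq ((count_mem x t.2)%:R * t.1, t.2) | t <- L].
  have e : cl L' = 0.
    rewrite -(mulr0 (gen x)) -(h x hx) !cl_words linear_sum mulr_sumr big_map.
    apply: eq_bigr => t _ /=; rewrite linearZ /= -scalerAr euler scalerA mulrC.
    by [].
  have : coef par3 lt3 L' mu = (count_mem x mu)%:R * coef par3 lt3 L mu.
    rewrite !coef_cwE big_map mulr_sumr; apply: eq_bigr => t _ /=.
    rewrite /cw; case: ifP => [/andP[hp _]|_]; last by rewrite !mulr0.
    by rewrite (seq.permP hp) mulrA.
  have /clP -> : cl L' = cl [::] by rewrite e.
  rewrite coef_nil => /esym/eqP; rewrite mulf_eq0 pnatr_eq0 => /orP[|/eqP //].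
  by rewrite eqn0Ngt -has_count has_pred1 hxmu.
apply/clP => mu; rewrite !coef_cwE big_filter.
case: (boolP (all (fun x => ~~ Y x) mu)) => hmu.
  rewrite [RHS]big_mkcond; apply: eq_bigr => t _; case: ifP => // ht.
  rewrite /cw; case: ifP => [/andP[hp _]|_]; last by rewrite mulr0.
  by rewrite (perm_all _ hp) hmu in ht.
have [x hx hxmu] : exists2 x, Y x & x \in mu.
  by case/allPn: hmu => x h1 /negPn h2; exists x.
rewrite -coef_cwE (zero mu x) // big1 // => t ht.
rewrite /cw; case: ifP => [/andP[hp _]|_]; last by rewrite mulr0.
by rewrite (perm_all _ hp) (negbTE hmu) in ht.
Qed.

Lemma LG_le Z Z' u : (forall x, Z x -> Z' x) -> salg (LG Z) u -> salg (LG Z') u.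
Proof. by move=> h; apply: salg_le => v [x [hx ->]]; apply: salg_gen; exists x; split=> //; apply: h. Qed.

End Elimination.

(** * A left inverse of the coordinate map, built level by level *)

Section Coordinates.
Variable K : numFieldType.
Variable n : nat.
Hypothesis n_gt0 : (0 < n)%N.
Local Notation SV := (SV K).
Local Notation gen := (gen K).
Local Notation pr := (primeI n).
Local Notation Fb := (Fb K n).
Local Notation Gens := (@Gens K n).
Local Notation N := (Nd n).
Implicit Types (u v : SV) (w : seq X3) (p : {poly SV}).
Local Notation Lev := level_below.
Local Notation Lo := (plain_below n).
Local Notation nsp := (plain_pair n).
Local Notation special := (special_pair n).
Local Notation W t := (cl (wt K n t)).

Definition ext (b : nat -> nat -> SV) (x : X3) : SV := iter x.1.1 (@D K) (b x.1.2 x.2).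
Definition hb (b : nat -> nat -> SV) := forall k l, homo (par3 (0%N, k, l)) (b k l).

Lemma compat_ext b : hb b -> compat (ext b).
Proof.
move=> h [[m k] l]; rewrite /ext /=; elim: m => [|m IH]; first exact: h.
have := homo_D IH; congr (homo _ _); rewrite /par3 /=.
by case: (pI k) (pI l) (odd m) => [] [] [].
Qed.

Definition EH b := sHom (ext b).
HB.instance Definition _ b := GRing.Linear.copy (EH b) (EH b).

Section ExtHom.
Variable b : nat -> nat -> SV.
Hypothesis b_homo : hb b.
Let cb := compat_ext b_homo.

Lemma EHM u v : EH b (u * v) = EH b u * EH b v. Proof. exact: HomM. Qed.
Lemma EHC c : EH b c%:A = c%:A. Proof. exact: HomC. Qed.
Lemma EH_D u : EH b (D u) = D (EH b u). Proof. exact: Hom_D. Qed.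
Lemma EH_iterD m u : EH b (iter m (@D K) u) = iter m (@D K) (EH b u).
Proof. by elim: m => //= m <-; rewrite EH_D. Qed.
Lemma EH_gen x : EH b (gen x) = ext b x. Proof. exact: Hom_gen. Qed.
Lemma EH_sgb c u : EH b (sgb c u) = sgb c (EH b u). Proof. exact: Hom_sgb. Qed.
Lemma EH_homo c u : homo c u -> homo c (EH b u). Proof. exact: homo_Hom. Qed.
End ExtHom.

Lemma iterD_gen m k l : iter m (@D K) (gen (0%N, k, l)) = gen (m, k, l).
Proof. by elim: m => //= m ->; rewrite D_gen. Qed.
Lemma iterD_Fb m k l : iter m (@D K) (Fb 0 k l) = Fb m k l.
Proof. by elim: m => //= m ->; rewrite D_Fb. Qed.

Lemma EH_Fb b m k l : hb b -> k \in rng n -> l \in rng n ->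
  EH b (Fb m k l) = iter m (@D K) (b k l + (-1) ^+ sF n k l *: b (pr l) (pr k)).
Proof.
move=> h hk hl; rewrite -iterD_Fb EH_iterD // FbE // linearD linearZ /=.
by rewrite !EH_gen.
Qed.

(** Allows the prescription [b] to be changed at one level without disturbing images of lower
    levels. *)
Lemma EH_ext (S : nat -> nat -> bool) b b' u : hb b -> hb b' ->
  (forall k l, k \in rng n -> l \in rng n -> S k l -> b k l = b' k l /\ b (pr l) (pr k) = b' (pr l) (pr k)) ->
  salg (Gens S) u -> EH b u = EH b' u.
Proof.
move=> h h' e; elim=> {u} [u [m [k [l [hk hl hS ->]]]]|c|u v _ hu _ hv|u v _ hu _ hv].
- by have [e1 e2] := e k l hk hl hS; rewrite !EH_Fb // e1 e2.
- by rewrite !EHC.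
- by rewrite !linearD /= hu hv.
- by rewrite !EHM // hu hv.
Qed.

Lemma homo_wt t : (0 < t <= N)%N -> homo (odd t) (W t).
Proof.
move=> ht; rewrite cl_wt //; apply: homoZ; have := @homo_vv K n n_gt0 0 (N - t) (leq0n _).
congr (homo _ _); rewrite addn0 oddD oddB; last by lia.
by case: (odd N) (odd t) => [] [].
Qed.

Lemma Lev_wt t : (0 < t <= N)%N -> salg (Gens (Lev t)) (W t).
Proof.
move=> ht; rewrite cl_wt //; apply: salg_scale.
have := @vv_Lev K n n_gt0 0 (N - t) (leq0n _); rewrite subn0 => /(_ (leq_subr _ _)).
by have -> : (N - (N - t) = t)%N by lia.
Qed.

Lemma special_level k l : k \in rng n -> l \in rng n -> special k l -> (0 < (k - l).+1 <= N)%N.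
Proof. by rewrite !(rngN n_gt0) => hk hl _; lia. Qed.

Lemma special_nsp k l : special k l -> nsp k l = false.
Proof. by rewrite /special_pair /plain_pair => h; lia. Qed.

Lemma mirror_nsp k l : k \in rng n -> l \in rng n -> nsp k l -> nsp (pr l) (pr k) = false.
Proof. by rewrite !mem_rng /primeI /plain_pair => hk hl h; lia. Qed.

(* Row 0 is not used by the matrix units: (m, 0, t+1) serves as a letter for D^m w_t. *)
Definition Tl t : X3 := (0%N, 0%N, t.+1).
Definition inverts s (b : nat -> nat -> SV) :=
  (forall k l, k \in rng n -> l \in rng n -> nsp k l -> (k - l < s)%N -> EH b (Fb 0 k l) = gen (0%N, k, l)) /\
  (forall k l, k \in rng n -> l \in rng n -> special k l -> (k - l < s)%N ->
     EH b (W (k - l).+1) = gen (Tl (k - l).+1)).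

Lemma inverts_ext s b b' : hb b -> hb b' ->
  (forall k l, k \in rng n -> l \in rng n -> (l <= k)%N -> (k - l < s)%N -> b k l = b' k l) ->
  inverts s b -> inverts s b'.
Proof.
move=> h h' e [i1 i2].
have E u : salg (Gens (Lev s)) u -> EH b u = EH b' u.
  apply: EH_ext => // k l hk hl /andP[h1 h2]; split; apply: e; rewrite ?prime_rng //.
    by move: hk hl h1; rewrite !mem_rng /primeI; lia.
  by move: hk hl h1 h2; rewrite !mem_rng /primeI; lia.
split=> k l hk hl hs hkl.
  rewrite -E; first exact: i1.
  apply: salg_gen; exists 0%N, k, l; split=> //; rewrite /level_below hkl andbT.
  by case/andP: hs.
rewrite -E; first exact: i2.
by apply: (@Lev_le _ _ (k - l).+1) => //; apply: Lev_wt; apply: special_level.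
Qed.

(** Triangularity: w_{s+1} is a nonzero multiple of the special root vector plus terms whose images
    are already fixed, so the value on the special unit solves a linear equation. *)
Lemma ex_inverts s : exists2 b, hb b & inverts s b.
Proof.
elim: s => [|s [b hbb ib]].
  by exists (fun _ _ => 0); [move=> k l; apply: homo0|split].
(* F_kl combines e_kl with its mirror; the whole value is put on the plain unit, and its mirror
   receives 0. *)
pose b1 k l := if (l <= k)%N && (k - l == s)%N then (if nsp k l then gen (0%N, k, l) else 0) else b k l.
have hb1 : hb b1.
  move=> k l; rewrite /b1; case: ifP => _; last exact: hbb.
  by case: ifP => _; [apply: homo_gen|apply: homo0].
have nsp1 b' k l : hb b' -> (forall k l, k \in rng n -> l \in rng n ->
     (l <= k)%N -> (k - l == s)%N -> ~~ special k l -> b' k l = b1 k l) ->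
   k \in rng n -> l \in rng n -> nsp k l -> (k - l = s)%N -> EH b' (Fb 0 k l) = gen (0%N, k, l).
  move=> hb' e hk hl hn hs; rewrite EH_Fb //=.
  have lk : (l <= k)%N by case/andP: hn.
  have e2 : (pr k <= pr l)%N && (pr l - pr k == s)%N.
    by move: hk hl lk hs; rewrite !mem_rng /primeI; lia.
  case/andP: (e2) => e3 e4.
  have -> : b' k l = b1 k l.
    apply: e => //; first by rewrite hs.
    by apply/negP => /special_nsp; rewrite hn.
  have -> : b' (pr l) (pr k) = b1 (pr l) (pr k).
    apply: e; rewrite ?prime_rng //; apply/negP; rewrite /special_pair.
    by move: hk hl hn; rewrite !mem_rng /primeI /plain_pair; lia.
  by rewrite /b1 e2 (mirror_nsp hk hl hn) lk hs eqxx hn /= scaler0 addr0.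
case: (pselect (exists k l, [/\ k \in rng n, l \in rng n, special k l & (k - l = s)%N])) => [|hno]; last first.
  exists b1 => //; split=> k l hk hl hs; rewrite ltnS leq_eqVlt => /orP[/eqP e|h].
  - by apply: nsp1.
  - have [i1 _] : inverts s b1.
      by apply: (inverts_ext hbb hb1 _ ib) => k' l' _ _ _ h'; rewrite /b1 ltn_eqF // andbF.
    exact: i1.
  - by case: hno; exists k, l.
  - have [_ i2] : inverts s b1.
      by apply: (inverts_ext hbb hb1 _ ib) => k' l' _ _ _ h'; rewrite /b1 ltn_eqF // andbF.
    exact: i2.
case=> k0 [l0 [hk0 hl0 hs0 e0]].
have [c c0 hc] := @wt_special K n n_gt0 k0 l0 hk0 hl0 hs0; rewrite e0 in hc.
(* On k0 + l0 = 4n the unit is its own mirror and the root vector is twice it; otherwise the mirror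
   unit has value 0. *)
pose mu : K := if (k0 + l0 == 4 * n)%N then 2%:R else 1.
have mu0 : mu != 0 by rewrite /mu; case: ifP; rewrite ?two_neq0 ?oner_neq0.
(* Raising the value on the special unit from 0 to [val] adds c mu val to the image of w_{s+1},
   which makes that image the desired letter. *)
pose val := (c * mu)^-1 *: (gen (Tl s.+1) - EH b1 (W s.+1)).
pose b2 k l := if (k == k0) && (l == l0) then val else b1 k l.
have lk0 : (l0 <= k0)%N by case/andP: hs0.
have hs1 : (0 < s.+1 <= N)%N by rewrite -e0; apply: special_level.
have hb2 : hb b2.
  move=> k l; rewrite /b2; case: ifP => [/andP[/eqP -> /eqP ->]|_]; last exact: hb1.
  have -> : par3 (0%N, k0, l0) = odd s.+1.
    by rewrite -e0 /par3 /= oddB // /pI; case: (odd k0) (odd l0) => [] [].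
  apply/homoZ/homoB; last by apply/EH_homo/homo_wt.
  by have := homo_gen K (Tl s.+1); congr (homo _ _); rewrite /par3 /= /pI /=; case: (odd s).
exists b2 => //.
have b12 k l : ~~ special k l -> b2 k l = b1 k l.
  by rewrite /b2; case: ifP => // /andP[/eqP -> /eqP ->]; rewrite hs0.
have i12 : inverts s b2.
  apply: (inverts_ext hbb hb2 _ ib) => k' l' _ _ _ h'; rewrite /b2 /b1 [(k' - l' == s)%N]ltn_eqF // andbF.
  by case: ifP h' => // /andP[/eqP -> /eqP ->]; rewrite e0 ltnn.
have agree u : salg (Gens (Lo s)) u -> EH b1 u = EH b2 u.
  apply: EH_ext => // k l hk hl hkl; split; symmetry; rewrite /b2; case: ifP => // /andP[/eqP e1 /eqP e2].
    move: hkl; rewrite e1 e2 /plain_below /level_below e0 ltnn andbF /=.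
    by rewrite special_nsp.
  have : (k - l = s)%N.
    by rewrite -e0 -e1 -e2; move: hk hl; rewrite !mem_rng /primeI; lia.
  move: hkl; rewrite /plain_below /level_below => + e; rewrite e ltnn andbF /= => /andP[hn _].
  by move: hs0; rewrite /special_pair -e1 -e2; move: hk hl hn; rewrite !mem_rng /primeI /plain_pair; lia.
have np : nsp (pr l0) (pr k0) = false.
  by move: hk0 hl0 hs0; rewrite /special_pair !mem_rng /primeI /plain_pair; lia.
have lv : (pr k0 <= pr l0)%N && (pr l0 - pr k0 == s)%N.
  by move: hk0 hl0 lk0 e0; rewrite !mem_rng /primeI; lia.
have F1 : EH b1 (Fb 0 k0 l0) = 0.
  by rewrite EH_Fb //= /b1 lv np lk0 e0 eqxx /= special_nsp // scaler0 addr0.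
have F2 : EH b2 (Fb 0 k0 l0) = mu *: val.
  rewrite EH_Fb //= /b2 !eqxx /= /mu.
  case: (eqVneq (k0 + l0)%N (4 * n)%N) => e.
    have [-> ->] : pr l0 = k0 /\ pr k0 = l0 by rewrite /primeI; lia.
    have ol : odd l0 by move: hs0; rewrite /special_pair; lia.
    rewrite !eqxx /=; have -> : sF n k0 l0 = false.
      have <- : pr l0 = k0 by rewrite /primeI; lia.
      by rewrite /sF deltaI_prime // pI_prime // /pI ol; case: (deltaI n l0).
    by rewrite scale1r scaler_nat mulr2n.
  have -> : (pr l0 == k0) = false by rewrite /primeI; move: hl0; rewrite mem_rng; lia.
  by rewrite /b1 lv np scaler0 addr0 scale1r.
split=> k l hk hl hs; rewrite ltnS leq_eqVlt => /orP[/eqP e|h].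
- by apply: nsp1 => // k' l' _ _ _ _; apply: b12.
- by have [i1 _] := i12; apply: i1.
- have -> : (k - l = s)%N by [].
  have E : EH b2 (W s.+1) = EH b1 (W s.+1) + (c * mu) *: val.
    have -> : EH b1 (W s.+1) = EH b1 (W s.+1 - c *: Fb 0 k0 l0).
      by rewrite linearB /= [EH b1 (_ *: _)]linearZ /= F1 scaler0 subr0.
    rewrite agree // -scalerA -F2 -linearZ -linearD /=.
    by rewrite subrK.
  by rewrite E /val scalerA mulfV ?mulf_neq0 // scale1r addrC subrK.
- by have [_ i2] := i12; apply: i2.
Qed.

End Coordinates.

(** * Free generation *)

Section Generation.
Variable K : numFieldType.
Variable n : nat.
Hypothesis n_gt0 : (0 < n)%N.
Local Notation SV := (SV K).
Local Notation gen := (gen K).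
Local Notation pr := (primeI n).
Local Notation Fb := (Fb K n).
Local Notation Gens := (@Gens K n).
Local Notation phi := (phi K n).
Local Notation lowS := (fun i j : nat => (j <= i)%N).
Local Notation N := (Nd n).
Local Notation q := (@q K n).
Local Notation rho := (@rho K n).
Implicit Types (u v : SV) (w : seq X3) (p : {poly SV}).
Local Notation Lo := (plain_below n).
Local Notation nsp := (plain_pair n).
Local Notation special := (special_pair n).
Local Notation W t := (cl (wt K n t)).

Definition Tletter (x : X3) : bool := (x.1.2 == 0%N) && (0 < x.2)%N && Tset n x.2.-1.
Definition Nletter (x : X3) : bool := [&& x.1.2 \in rng n, x.2 \in rng n & nsp x.1.2 x.2].
Definition Zletter x := Tletter x || Nletter x.

(** The free algebra serves as its own ring of coordinates: letters of row 0 stand for the w_t and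
    their derivatives, letters at plain pairs for root vectors. *)
Definition bPhi k l : SV :=
  if k == 0%N then (if (0 < l)%N && Tset n l.-1 then W l.-1 else 0)
  else if (k \in rng n) && (l \in rng n) then Fb 0 k l else 0.

Lemma hb_bPhi : hb bPhi.
Proof.
move=> k l; rewrite /bPhi; case: eqP => [->|_].
  case: ifP => [/andP[l0 /andP[ht _]]|_]; last exact: homo0.
  have := homo_wt K n_gt0 ht; congr (homo _ _); rewrite /par3 /= /pI.
  by case: l l0 {ht} => //= l _; case: (odd l).
by case: ifP => [/andP[hk hl]|_]; [apply: homo_Fb|apply: homo0].
Qed.

Definition Phi := EH bPhi.
HB.instance Definition _ := GRing.Linear.copy Phi Phi.

Lemma PhiM u v : Phi (u * v) = Phi u * Phi v. Proof. exact: EHM hb_bPhi _ _. Qed.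
Lemma PhiC c : Phi c%:A = c%:A. Proof. exact: EHC hb_bPhi _. Qed.
Lemma Phi_sgb c u : Phi (sgb c u) = sgb c (Phi u). Proof. exact: EH_sgb hb_bPhi _ _. Qed.

Lemma Phi_T m t : Tset n t -> Phi (gen (m, 0%N, t.+1)) = iter m (@D K) (W t).
Proof. by move=> h; rewrite /Phi (EH_gen hb_bPhi) /ext /= /bPhi /= h. Qed.

Lemma Phi_N m k l : Nletter (m, k, l) -> Phi (gen (m, k, l)) = Fb m k l.
Proof.
move=> /and3P[/= hk hl _]; rewrite /Phi (EH_gen hb_bPhi) /ext /= /bPhi hk hl.
have -> : (k == 0%N) = false by move: hk; rewrite mem_rng; lia.
exact: iterD_Fb.
Qed.

Lemma V_iterD S m u : salg (Gens S) u -> salg (Gens S) (iter m (@D K) u).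
Proof. by move=> h; elim: m => //= m; apply: V_D. Qed.

Lemma Phi_low u : salg (LG Zletter) u -> salg (Gens lowS) (Phi u).
Proof.
apply: Hom_salg; first exact: compat_ext hb_bPhi.
move=> v [[[m k] l] [/orP[hT|hN] ->]]; rewrite -/(EH _) -/Phi; last first.
  rewrite Phi_N //; case/and3P: hN => /= hk hl /andP[lk _].
  by apply: salg_gen; exists m, k, l.
case: l hT => [|t] /andP[/andP[/eqP /= ->]] // _ ht.
by rewrite Phi_T //; apply/V_iterD/low_wt.
Qed.

Definition ImZ u := exists2 P, salg (LG Zletter) P & Phi P = u.

Lemma ImZ_salg G u : (forall v, G v -> ImZ v) -> salg G u -> ImZ u.
Proof.
move=> h; elim=> {u} [u /h //|c|u v _ [P hP <-] _ [P' hP' <-]|u v _ [P hP <-] _ [P' hP' <-]].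
- by exists c%:A; [apply: salg_const|apply: PhiC].
- by exists (P + P'); [apply: salg_add|rewrite linearD].
- by exists (P * P'); [apply: salg_mul|apply: PhiM].
Qed.

Lemma LGZ_D u : salg (LG Zletter) u -> salg (LG Zletter) (D u).
Proof.
apply: salg_D => v [x [hx ->]].
  by rewrite (homo_gen K x); apply/salg_scale/salg_gen; exists x.
by rewrite D_gen; apply: salg_gen; exists (d3 x).
Qed.

Lemma ImZ_D m u : ImZ u -> ImZ (iter m (@D K) u).
Proof.
move=> [P hP <-]; exists (iter m (@D K) P); last exact: EH_iterD hb_bPhi _ _.
by elim: m => //= m; apply: LGZ_D.
Qed.

Lemma ImZ_scale c u : ImZ u -> ImZ (c *: u).
Proof. by move=> [P hP <-]; exists (c *: P); [apply: salg_scale|rewrite linearZ]. Qed.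

Lemma special_Tset k l : k \in rng n -> l \in rng n -> special k l -> Tset n (k - l).+1.
Proof.
move=> hk hl hs; rewrite /Tset special_level //=.
by move: hs; rewrite /special_pair; lia.
Qed.

Lemma Tset_special t : Tset n t -> exists k l,
  [/\ k \in rng n, l \in rng n, special k l & (k - l).+1 = t].
Proof.
move=> /andP[ht hm]; have oh := odd_double_half (4 * n + 1 - t).
(* From k - l = t - 1 and k + l equal to 4n or 4n - 1, l is (4n + 1 - t)/2 rounded down. *)
exists ((4 * n + 1 - t)./2 + t.-1)%N, (4 * n + 1 - t)./2.
rewrite !mem_rng /special_pair; move: ht hm oh; rewrite /Nd -muln2.
move: (odd _)%N (_./2) => o x ht hm oh.
by split; lia.
Qed.

(** Surjectivity by level. A root vector of level s is plain, special, zero, or the mirror of a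
    plain or special one; a special one is recovered from w_{s+1} by [wt_special]. *)
Lemma ImZ_Lev s u : salg (Gens (level_below s)) u -> ImZ u.
Proof.
elim: s u => [|s IH] u.
  by apply: ImZ_salg => v [m [i [j [_ _ /andP[_]]]]].
have hLo v : Gens (Lo s) v -> ImZ v.
  move=> [m [i [j [hi hj /orP[h|/andP[h _]] ->]]]].
    by apply/IH/salg_gen; exists m, i, j.
  exists (gen (m, i, j)); last by apply: Phi_N; rewrite /Nletter /= hi hj h.
  by apply: salg_gen; exists (m, i, j); rewrite /Zletter /Nletter /= hi hj h orbT.
have hsp i j : i \in rng n -> j \in rng n -> special i j -> (i - j = s)%N -> ImZ (Fb 0 i j).
  move=> hi hj hs e; have [c c0 hc] := @wt_special K n n_gt0 i j hi hj hs; rewrite e in hc.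
  have -> : Fb 0 i j = c^-1 *: (W s.+1 - (W s.+1 - c *: Fb 0 i j)).
    by rewrite opprB addrCA subrr addr0 scalerA mulVf // scale1r.
  apply: ImZ_scale; have [P hP e1] := ImZ_salg hLo hc.
  have hT : Tset n s.+1 by rewrite -e special_Tset.
  exists (gen (0%N, 0%N, s.+2) - P); last by rewrite linearB /= Phi_T // e1.
  apply: salg_sub => //; apply: salg_gen; exists (0%N, 0%N, s.+2); split=> //.
  by rewrite /Zletter /Tletter /= hT.
have hns i j : i \in rng n -> j \in rng n -> nsp i j -> (i - j = s)%N -> ImZ (Fb 0 i j).
  move=> hi hj h e; apply: hLo; exists 0%N, i, j; split=> //.
  by rewrite /plain_below h e eqxx orbT.
apply: ImZ_salg => v [m [i [j [hi hj /andP[ji hij] ->]]]].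
rewrite -iterD_Fb; apply: ImZ_D.
move: hij; rewrite ltnS leq_eqVlt => /orP[/eqP e|h]; last first.
  by apply/IH/salg_gen; exists 0%N, i, j; rewrite /level_below ji h.
case: (boolP (nsp i j)) => h1; first exact: hns.
case: (boolP (special i j)) => h2; first exact: hsp.
case: (eqVneq (i + j)%N (4 * n)%N) => e4.
  have -> : Fb 0 i j = 0.
    have <- : pr j = i by rewrite /primeI; lia.
    apply: Fb_anti => //; move: h2; rewrite /special_pair; lia.
  by exists 0; [apply: salg0|rewrite linear0].
have -> : Fb 0 i j = (-1) ^+ sF n i j *: Fb 0 (pr j) (pr i).
  by rewrite Fb_prime // scalerA -signr_addb addbb scale1r.
apply: ImZ_scale; have e' : (pr j - pr i = s)%N by move: hi hj ji e; rewrite !mem_rng /primeI; lia.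
case: (boolP (nsp (pr j) (pr i))) => h3; first by apply: hns; rewrite ?prime_rng.
apply: hsp; rewrite ?prime_rng //.
by move: hi hj ji h1 h2 h3 e4; rewrite /special_pair /plain_pair !mem_rng /primeI; lia.
Qed.

Lemma ImZ_low u : salg (Gens lowS) u -> ImZ u.
Proof.
move=> h; apply: (@ImZ_Lev (4 * n)); apply: salg_le h => v [m [i [j [hi hj ji ->]]]].
apply: salg_gen; exists m, i, j; split=> //; rewrite /level_below ji /=.
by move: hi; rewrite mem_rng; lia.
Qed.

(** Since 4n exceeds every level, [ex_inverts] supplies a left inverse on all letters in use. *)
Lemma Phi_inj u : salg (LG Zletter) u -> Phi u = 0 -> u = 0.
Proof.
have [b hbb [i1 i2]] := ex_inverts K n_gt0 (4 * n).
move=> hu e; suff E : EH b (Phi u) = u by rewrite -E e linear0.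
elim: hu {e} => {u} [u [[[m k] l] [/orP[hT|hN] ->]]|c|u v _ hu _ hv|u v _ hu _ hv].
- case: l hT => [|t] /andP[/andP[/eqP /= ->]] // _ ht; rewrite Phi_T // EH_iterD //.
  have [k' [l' [hk hl hs e]]] := Tset_special ht.
  rewrite -e i2 //; first by rewrite iterD_gen.
  by move: hk; rewrite mem_rng; lia.
- rewrite Phi_N // -iterD_Fb EH_iterD //; case/and3P: hN => /= hk hl h.
  rewrite i1 //; first by rewrite iterD_gen.
  by move: hk; rewrite mem_rng; lia.
- by rewrite PhiC EHC.
- by rewrite !linearD /= hu hv.
- by rewrite PhiM EHM // hu hv.
Qed.

(** * Elimination of one plain generator *)

Section Kill.
Variables (s l : nat).
Hypotheses (hl0 : l \in rng n) (hls : (l + s)%N \in rng n) (hn : nsp (l + s) l).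
Local Notation j0 := (l + s.+1)%N.

Lemma kill_rng : j0 \in rng n.
Proof. by move: hn hl0; rewrite /plain_pair !mem_rng; lia. Qed.

Local Notation a := (Fm K n l j0).
Local Notation b := (pI l (+) pI j0).
Local Notation dlk := (dl n l j0).

Lemma kill_lt : (l < j0)%N. Proof. lia. Qed.

Lemma Fm_supp i j : i \in rng n -> j \in rng n -> a i j != 0 -> j = (i + s.+1)%N /\ (i = l \/ i = (4 * n - j0)%N).
Proof.
move=> hi hj; rewrite FmE; case: (boolP ((i == l) && (j == j0))) => [/andP[/eqP -> /eqP ->] _|_].
  by split; [|left].
rewrite add0r; case: (boolP ((i == pr j0) && (j == pr l))) => [|_]; last by rewrite mulr0 eqxx.
by have := kill_rng; rewrite mem_rng /primeI => h /andP[/eqP -> /eqP ->] _; split; [lia|right].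
Qed.

(** a shifts columns by s + 1 and [Q] goes back by at most one, so only level s could survive,
    through the rows of a that are nonzero. These are l and its mirror partner, and plainness puts
    the latter at or below l. *)
Lemma dl_q_off i j : i \in rng n -> j \in rng n -> (i <= j)%N ->
  (j - i < s)%N || (j - i == s)%N && (i < l)%N -> dlk 0 (q i j) = 0.
Proof.
move=> hi hj ij h; rewrite dlq0 ?kill_rng // !big_seq !big1 ?scaler0 ?subr0 // => r hr.
  case: (eqVneq (a i r) 0) => [->|/(Fm_supp hi hr) [e1 e2]]; first by rewrite scale0r.
  by rewrite Q_zero ?scaler0 //; move: hn e2; rewrite /plain_pair; lia.
case: (eqVneq (a r j) 0) => [->|/(Fm_supp hr hj) [e1 e2]]; first by rewrite scale0r.
by rewrite Q_zero ?scaler0 //; move: hn e2; rewrite /plain_pair; lia.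
Qed.

(** If a is self-mirror, plainness forces l odd, and then its two summands add to 2 instead of
    cancelling. *)
Lemma a_neq0 : a l j0 != 0.
Proof.
rewrite FmE !eqxx /=.
case: (boolP ((l == pr j0) && (j0 == pr l))) => [/andP[/eqP e /eqP e']|_]; last by rewrite mulr0 addr0 oner_neq0.
have ol : odd l by move: hn e; rewrite /plain_pair /primeI; lia.
have -> : sF n l j0 = false.
  rewrite e' sF_sym /sF deltaI_prime // pI_prime // /pI ol.
  by case: (deltaI n l).
by rewrite expr0 mulr1 -[1 + 1]/(2%:R) two_neq0.
Qed.

Lemma dl_q_on : exists2 c : K, c != 0 & dlk 0 (q l (l + s)) = c%:A.
Proof.
exists ((-1) ^+ b * a l j0 * phi (l + s)).
  by rewrite !mulf_neq0 ?a_neq0 ?phi_neq0 ?signr_eq0.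
rewrite dlq0 ?kill_rng // [X in _ *: X - _]big_seq big1 ?scaler0 ?sub0r; last first.
  move=> r hr; case: (eqVneq (a r (l + s)) 0) => [->|/(Fm_supp hr hls) [e1 e2]]; first by rewrite scale0r.
  by rewrite Q_zero ?scaler0 //; move: hn e2; rewrite /plain_pair; lia.
rewrite (bigD1_seq j0) ?kill_rng ?iota_uniq //= big_seq_cond big1 ?addr0; last first.
  move=> r /andP[hr rj]; case: (eqVneq (a l r) 0) => [->|/(Fm_supp hl0 hr) [e1 _]]; first by rewrite scale0r.
  by rewrite e1 eqxx in rj.
rewrite addnS Q_sub //; last by have := kill_rng; rewrite (rngN n_gt0); move: hls; rewrite mem_rng; lia.
by rewrite !scalerA -scaleNr mulrN opprK.
Qed.

Lemma dl_iterD_zero u : (forall k, dlk k u = 0) -> forall m k, dlk k (iter m (@D K) u) = 0.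
Proof.
move=> h; elim=> [|m IH] k //=; rewrite dl_D ?kill_rng // IH D0 sub0r.
by case: k => [|k] /=; rewrite ?IH oppr0 scaler0.
Qed.

Lemma dl_Fb_off m i j : i \in rng n -> j \in rng n -> (j <= i)%N ->
  (i - j < s)%N || (i - j == s)%N && (j < l)%N -> forall k, dlk k (Fb m i j) = 0.
Proof.
move=> hi hj ij h; rewrite -iterD_Fb; apply: dl_iterD_zero => k.
rewrite Fbq // linearZ /=; case: k => [|[|k]].
- by rewrite dl_q_off // scaler0.
- rewrite dlq1 ?kill_rng //; case: (eqVneq (a j i) 0) => [->|/(Fm_supp hj hi) [e1 _]].
    by rewrite mulr0 scale0r scaler0.
  by lia.
- by rewrite dlq2 ?scaler0 ?kill_rng.
Qed.

(** The bracket with the underived generator is a constant, so applying D + chi repeatedly leaves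
    only the pure power of chi: the powers of chi separate the derivatives. *)
Lemma dl_Fb_on m : exists2 c : K, c != 0 &
  forall m', dlk m (Fb m' (l + s) l) = ((m' == m)%:R * c)%:A.
Proof.
have [c0 c0n e0] : exists2 c : K, c != 0 & forall k, dlk k (Fb 0 (l + s) l) = ((k == 0%N)%:R * c)%:A.
  have [c c0 e] := dl_q_on; exists (2%:R * (-1) ^+ pI (l + s) * c).
    by rewrite !mulf_neq0 ?signr_eq0 ?two_neq0.
  move=> k; rewrite Fbq // linearZ /=; case: k => [|[|k]].
  - by rewrite e mul1r scalerA.
  - rewrite dlq1 ?kill_rng //; case: (eqVneq (a l (l + s)) 0) => [->|/(Fm_supp hl0 hls) [e1 _]].
      by rewrite mulr0 scale0r scaler0 mul0r scale0r.
    by lia.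
  - by rewrite dlq2 ?kill_rng // scaler0 mul0r scale0r.
elim: m => [|m [c cn IH]].
  exists c0 => // -[|m']; first by rewrite e0.
  elim: m' => [|m' IHm]; rewrite -D_Fb dl_D ?kill_rng //= subr0.
    by rewrite e0 mul1r DC scaler0 mul0r scale0r.
  by rewrite IHm mul0r scale0r D0 scaler0.
exists ((-1) ^+ (b (+) odd m.+1) * - c) => [|m'].
  by rewrite mulf_neq0 ?oppr_eq0 ?signr_eq0.
case: m' => [|m']; first by rewrite e0 !mul0r.
elim: m' => [|m' IHm].
  rewrite -D_Fb dl_D ?kill_rng // e0 mul0r scale0r D0 sub0r [pre _ _]/= IH.
  by rewrite -scaleNr scalerA; congr (_ *: _); rewrite mulrCA -mulrN.
rewrite -D_Fb dl_D ?kill_rng // IHm DC sub0r [pre _ _]/= IH.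
by rewrite -scaleNr scalerA; congr (_ *: _); rewrite mulrCA -mulrN.
Qed.

(** The letters still present when F_{l+s,l} is about to be eliminated; [Yr] marks the derivatives
    of that generator. *)
Definition Zr (x : X3) : bool := Tletter x || Nletter x &&
  ((x.1.2 - x.2 < s)%N || (x.1.2 - x.2 == s)%N && (x.2 <= l)%N).
Definition Yr (x : X3) : bool := (x.1.2 == (l + s)%N) && (x.2 == l).

(** Both sides are derivations along [Phi] of the same parity, so comparison on letters suffices;
    [rho] fixes the images because they lie in V(bar p). *)
Lemma dl_Phi m : exists2 c : K, c != 0 & forall u, salg (LG Zr) u ->
  dlk m (Phi u) = c *: Phi (pd (m, (l + s)%N, l) u).
Proof.
have [c cn hc] := dl_Fb_on m; exists c => // u; set x := (m, (l + s)%N, l).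
have Zrz v : salg (LG Zr) v -> salg (LG Zletter) v.
  by apply: LG_le => y; rewrite /Zr /Zletter => /orP[->//|/andP[-> _]]; rewrite orbT.
have rP v : salg (LG Zr) v -> rho (Phi v) = Phi v.
  by move=> h; apply/rho_low/Phi_low/Zrz.
have ep : b (+) odd m = par3 x.
  by rewrite /x /par3 /pI /= !oddD /=; case: (odd l) (odd s) (odd m) => [] [] [].
elim=> {u} [u [[[m' k'] l'] [/orP[hT|/andP[hN h]] ->]]|c'|u v _ hu _ hv|u v hu hu' hv hv'].
- rewrite pd_gen; case: l' hT => [|t] /andP[/andP[/eqP /= ek]] // _ ht; rewrite ek Phi_T //.
  have -> : (m', 0%N, t.+1) == x = false.
    by apply/eqP => -[_]; move: hls; rewrite mem_rng; lia.
  rewrite scale0r linear0 scaler0; apply: dl_iterD_zero => k.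
  by apply: (killed_wt K n_gt0 t k); rewrite ?kill_rng // kill_lt.
- rewrite pd_gen Phi_N //; case/and3P: hN => /= hk hl' hns.
  case: (eqVneq (m', k', l') x) => [[-> -> ->]|nx].
    by rewrite hc eqxx mul1r scale1r -[1]scale1r PhiC scale1r.
  rewrite scale0r linear0 scaler0.
  case: (boolP (Yr (m', k', l'))) => [/andP[/= /eqP e1 /eqP e2]|hY].
    rewrite e1 e2 hc; have -> : (m' == m) = false by apply/eqP => e; move: nx; rewrite e e1 e2 eqxx.
    by rewrite mul0r scale0r.
  by apply: dl_Fb_off => //; move: h hns hY; rewrite /Yr /plain_pair /=; lia.
- by rewrite pdC PhiC dlC // linear0 scaler0.
- by rewrite !linearD /= hu hv.
- rewrite PhiM dlM ?kill_rng // pdM [Phi (_ + _)]linearD /= !PhiM Phi_sgb !rP // hu' hv' [RHS]scalerDr ep.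
  by rewrite scalerAl scalerAr.
Qed.

(** The condition of W gives only that the image of each partial derivative is 0; injectivity of
    [Phi] carries this back to the coordinates, where [elimination] applies. *)
Lemma kill_step u : salg (LG Zr) u -> killed n (Phi u) -> salg (LG (fun x => Zr x && ~~ Yr x)) u.
Proof.
move=> hu hk; apply: (elimination hu) => -[[m k'] l'] /andP[/= /eqP -> /eqP ->].
have [c cn hc] := dl_Phi m; have := hc u hu.
rewrite {1}/dl hk ?kill_rng ?kill_lt // => /esym/eqP; rewrite scaler_eq0 (negbTE cn) => /eqP e.
apply: Phi_inj e; apply: pd_LG; apply: LG_le hu => y.
by rewrite /Zr /Zletter => /orP[->//|/andP[-> _]]; rewrite orbT.
Qed.
End Kill.

(* The coordinates are eliminated from the highest rank down: first by decreasing
   level k - l, then by decreasing l. *)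
Definition rank (x : X3) : nat := ((x.1.2 - x.2) * (4 * n) + x.2)%N.

Lemma only_T u : salg (LG Zletter) u -> killed n (Phi u) -> salg (LG Tletter) u.
Proof.
move=> hu hk.
have [R hR] : exists R, forall x, Nletter x -> (rank x < R)%N.
  exists ((4 * n) * (4 * n) + 4 * n)%N => x /and3P[]; rewrite !mem_rng /rank => h1 h2 _.
  rewrite -addnS leq_add //; last by lia.
  by rewrite leq_mul2r; apply/orP; right; lia.
have {hu} : salg (LG (fun x => Tletter x || Nletter x && (rank x < R)%N)) u.
  apply: LG_le hu => x; rewrite /Zletter => /orP[->//|h].
  by rewrite h hR // orbT.
elim: R {hR} => [|R IH] hu.
  by apply: LG_le hu => x; rewrite ltn0 andbF orbF.
apply: IH.
(* As l < 4n, the number R determines s and l. Either it is the rank of a plain pair, whose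
   generator is eliminated now, or no letter has this rank. *)
case: (boolP [exists s : 'I_(4 * n), exists l : 'I_(4 * n),
   [&& (l : nat) \in rng n, (l + s)%N \in rng n, nsp (l + s) l & (s * (4 * n) + l == R)%N]]).
  case/existsP => s /existsP [l /and4P[hl hls hn /eqP e]].
  have hr x : Nletter x -> (x.2 < 4 * n)%N.
    by case/and3P => _; rewrite mem_rng => /andP[].
  have hlt : (l < 4 * n)%N := ltn_ord l.
  have lexi s' l' : (l' < 4 * n)%N -> (s' * (4 * n) + l' <= s * (4 * n) + l)%N ->
     (s' < s)%N || (s' == s)%N && (l' <= l)%N.
    move=> h1 h2; case: (ltngtP s' s) => //= h3; last by move: h2; rewrite h3 leq_add2l.
    have : (s.+1 * (4 * n) <= s' * (4 * n))%N by rewrite leq_mul2r h3 orbT.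
    by rewrite mulSn; lia.
  have h : salg (LG (Zr s l)) u.
    apply: LG_le hu => x /orP[h|/andP[h1 h2]]; rewrite /Zr ?h // h1 lexi ?orbT //; first exact: hr.
    by move: h2; rewrite /rank -e ltnS.
  apply: LG_le (kill_step hl hls hn h hk) => x /andP[/orP[->//|/andP[h1 h2]] hY].
  rewrite h1 /= /rank -e; apply/orP; right.
  case/orP: h2 => [h2|/andP[/eqP h2 h3]].
    have : ((x.1.2 - x.2).+1 * (4 * n) <= s * (4 * n))%N by rewrite leq_mul2r h2 orbT.
    by have := hr x h1; rewrite (mulSn (x.1.2 - x.2)); lia.
  rewrite h2 ltn_add2l ltn_neqAle h3 andbT.
  move: hY h2; rewrite /Yr; case/and3P: h1 => _ _ /andP[h1 _]; case: eqP => //= e2 _; lia.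
move=> hno; apply: LG_le hu => x /orP[->//|/andP[h1]]; rewrite ltnS leq_eqVlt => /orP[/eqP e|h]; last first.
  by rewrite h1 h orbT.
case/negP: hno; case/and3P: h1 => hk1 hl1 hns.
have h4 : (x.1.2 - x.2 < 4 * n)%N by move: hk1; rewrite mem_rng; lia.
have h5 : (x.2 < 4 * n)%N by move: hl1; rewrite mem_rng; lia.
apply/existsP; exists (Ordinal h4); apply/existsP; exists (Ordinal h5) => /=.
have -> : (x.2 + (x.1.2 - x.2) = x.1.2)%N by case/andP: hns; lia.
by rewrite hk1 hl1 hns -e /rank /=.
Qed.
End Generation.

(** * Transfer to polynomials in the w_t *)

Section FreeGeneration.
Variable K : numFieldType.
Variable n : nat.
Hypothesis n_gt0 : (0 < n)%N.
Local Notation SV := (SV K).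
Local Notation gen := (gen K).
Local Notation N := (Nd n).
Local Notation q := (@q K n).
Local Notation rho := (@rho K n).
Implicit Types (u v : SV) (w : seq X3) (p : {poly SV}).
Local Notation Phi := (@Phi K n).
Local Notation allT Q := (all (fun q => all (fun x => Tset n x.1) q.2) Q).

(** The shift to t + 1 makes the letter have parity t + m, that of D^m w_t. *)
Definition fwd (x : X2) : X3 := (x.2, 0%N, x.1.+1).
Definition bwd (x : X3) : X2 := (x.2.-1, x.1.1).
Definition lift_poly (P : fpoly K X2) : V K := [seq (t.1, map fwd t.2) | t <- P].

Lemma cl_iterDV m (P : V K) : cl (iter m (@DV K) P) = iter m (@D K) (cl P).
Proof. by elim: m => //= m <-; rewrite cl_DV. Qed.

Lemma cl_evalW (P : fpoly K X2) : allT P -> cl (evalW n P) = Phi (cl (lift_poly P)).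
Proof.
move=> hP; rewrite cl_flatten cl_words linear_sum big_map; apply: eq_big_seq => t ht.
rewrite linearZ /= clZ cl_fprod big_map; congr (_ *: _).
have /= := allP hP t ht; elim: t.2 => [|x w IH] /=.
  by rewrite big_nil word_nil -[1]scale1r PhiC.
move=> /andP[hx hw]; rewrite big_cons word_cons PhiM // IH //.
by rewrite [Phi (gen _)]Phi_T // cl_iterDV.
Qed.

Lemma lift_poly_T (P : fpoly K X2) : allT P -> salg (LG (Tletter n)) (cl (lift_poly P)).
Proof.
move=> hP; apply/LG_list; exists (lift_poly P); split=> //.
rewrite all_map; apply: sub_all hP => t /= ht; rewrite all_map.
by apply: sub_all ht => x.
Qed.

Lemma LG_T_lift u : salg (LG (Tletter n)) u -> exists2 P : fpoly K X2, allT P & u = cl (lift_poly P).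
Proof.
move=> /LG_list [L [hL ->]]; exists [seq (t.1, map bwd t.2) | t <- L].
  rewrite all_map; apply: sub_all hL => t /= ht; rewrite all_map.
  by apply: sub_all ht => x /andP[].
congr cl; rewrite /lift_poly -map_comp -[LHS]map_id; apply/eq_in_map => t ht /=.
have /= := allP hL t ht; case: t {ht} => c w /= hw; congr (_, _).
rewrite -map_comp -[LHS]map_id; apply/eq_in_map => x /(allP hw).
by case: x => [[m k] l] /andP[/andP[/= /eqP -> h] _]; rewrite /fwd /bwd /= prednK.
Qed.

Lemma T_Zletter x : Tletter n x -> Zletter n x. Proof. by rewrite /Zletter => ->. Qed.

(** The condition of W passes to derivatives by sesquilinearity and to products by the Leibniz
    rule. *)
Lemma killed_Phi u : salg (LG (Tletter n)) u -> killed n (Phi u).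
Proof.
move=> hu i j k hi hj hij; rewrite -[rho _]/(dl n i j k (Phi u)).
have rP v : salg (LG (Tletter n)) v -> rho (Phi v) = Phi v.
  by move=> h; apply/rho_low/(Phi_low n_gt0); apply: LG_le h; apply: T_Zletter.
elim: hu => {u} [u [[[m k'] l'] [hT ->]]|c|u v _ hu _ hv|u v hu hu' hv hv'].
- case: l' hT => [|t] /andP[/andP[/eqP /= ->]] // _ ht; rewrite Phi_T //.
  elim: m k => [|m IH] k /=; first exact: (killed_wt K n_gt0 t).
  rewrite dl_D // IH D0 sub0r; case: k => [|k] /=; first by rewrite oppr0 scaler0.
  by rewrite IH oppr0 scaler0.
- by rewrite PhiC // dlC.
- by rewrite !linearD /= hu hv addr0.
- rewrite PhiM // dlM // hu' hv' !rP //.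
  by rewrite mul0r mulr0 addr0.
Qed.

Theorem W_generated (v : V K) : inW n v <->
  exists P : fpoly K X2, allT P /\ Veq v (evalW n P).
Proof.
split=> [/inWP [hv hk]|[P [hP /clP e]]].
  have [u hu e] := ImZ_low n_gt0 hv.
  rewrite -e in hk; have [P hP eP] := LG_T_lift (only_T n_gt0 hu hk).
  by exists P; split=> //; apply/clP; rewrite cl_evalW // -eP.
apply/inWP; rewrite e cl_evalW //; have hT := lift_poly_T hP; split.
  by apply/(Phi_low n_gt0); apply: LG_le hT; apply: T_Zletter.
exact: killed_Phi.
Qed.

Lemma lt2_asym x y : x != y -> lt2 x y = ~~ lt2 y x.
Proof. by case: x y => [a b] [a' b']; rewrite /lt2 !xpair_eqE /=; lia. Qed.

(* Reads off a coefficient of a polynomial in the [w_t] from its image in [V]: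
   the two monomial orders differ, but either presentation satisfies the same relations. *)
Definition coef_fun mu (w : seq X3) : K^o :=
  if all (fun x => (x.1.2 == 0%N) && (0 < x.2)%N) w then cw K par2 lt2 (map bwd w) mu else 0.

Lemma swapc_coef_fun mu : swapc par3 (coef_fun mu).
Proof.
apply: swapc_of_swap => w1 x y w2; rewrite /coef_fun !all_cat /=.
case: (boolP ((x.1.2 == 0%N) && (0 < x.2)%N)) => hx; last by rewrite ?(andbF, andFb) /= ?andbF scaler0.
case: (boolP ((y.1.2 == 0%N) && (0 < y.2)%N)) => hy; last by rewrite ?(andbF, andFb) /= ?andbF scaler0.
rewrite /=; case: ifP => _; last by rewrite scaler0.
have e z : (z.1.2 == 0%N) && (0 < z.2)%N -> par2 (bwd z) = par3 z.
  case: z => [[m k] l] /andP[/= /eqP -> h]; rewrite /par2 /par3 /bwd /pI /= oddD.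
  by case: l h => //= l _; case: (odd l) (odd m) => [] [].
by rewrite !map_cat /= (cw_swap K par2 lt2_asym) !e.
Qed.

(** Injectivity of [Phi] makes the lifted polynomial zero in the ring of coordinates, where
    [coef_fun] reads off each coefficient. *)
Theorem wt_independent (P : fpoly K X2) : allT P -> Veq (evalW n P) [::] ->
  forall mu, coef par2 lt2 P mu = 0.
Proof.
move=> hP /clP; rewrite cl_evalW // => e mu.
have hT := lift_poly_T hP.
have h0 : cl (lift_poly P) = 0.
  by apply: (Phi_inj n_gt0) e; apply: LG_le hT; apply: T_Zletter.
have := lin_cl (lift_poly P) (swapc_coef_fun mu); rewrite h0 linear0 big_map => /esym <-.
rewrite coef_cwE; apply: eq_bigr => t _ /=; rewrite /coef_fun all_map.
rewrite (eq_all (a2 := predT)) // all_predT -map_comp map_id_in //.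
by case.
Qed.

End FreeGeneration.

Theorem mainTheorem10 : forall n : nat, (1 <= n)%N ->
  (forall t : nat, (1 <= t <= Nd n)%N -> inW n (wt Cc n t)) /\
  (forall v : V Cc, inW n v <->
     exists Q : fpoly Cc X2,
       all (fun q => all (fun x => Tset n x.1) q.2) Q /\ Veq v (evalW n Q)) /\
  (forall Q : fpoly Cc X2,
     all (fun q => all (fun x => Tset n x.1) q.2) Q ->
     Veq (evalW n Q) [::] -> forall mu, coef par2 lt2 Q mu = 0).
Proof.
(* [Cc] is declared as a plain field; the numeric structure on the same complex numbers provides
   characteristic 0. *)
move=> n n_gt0; pose K : numFieldType := (Rdefinitions.R[i])%C.
split; last split.
- by move=> t _; apply: (wt_in_W K n_gt0).
- exact: (W_generated (K := K) n_gt0).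
- exact: (wt_independent (K := K) n_gt0).
Qed.
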